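(* Let $M\ge 2$, let $c_1,\dots,c_M\in\mathbb{C}$ be distinct, and let $\Omega=\mathbb{C}\setminus\{c_1,\dots,c_M\}$. Let $D$ be a hypersurface in $\mathbb{P}^n(\mathbb{C})$ defined by a homogeneous polynomial $Q$ of degree $d$, and let $f=(f_0:\dots:f_n):\Omega\to\mathbb{P}^n(\mathbb{C})$ be a holomorphic curve whose image is not contained in $D$. Then for any $r_0<r<+\infty$, $$d\,T_f(r)=m_f(r,D)+N_f(r,D)+O(1),$$ where $O(1)$ is bounded by a constant independent of $r$.
   Context: Let $\rho=\frac12\min\{|c_j-c_k|: j\neq k\}$ and $r_0=1/\rho+\max\{|c_j|:1\le j\le M\}$. Let $D_r(c)$ be the open disk of radius $r$ centered at $c$. For $t\ge r_0$ put $\Omega_t=D_t(0)\setminus\bigcup_{j=1}^M\overline{D}_{1/t}(c_j)$. A holomorphic curve $f:\Omega\to\mathbb{P}^n(\mathbb{C})$ is written $f=(f_0:\dots:f_n)$ with $f_0,\dots,f_n$ holomorphic on $\Omega$ without common zeros (a reduced representation), and $\|f(z)\|=\max\{|f_0(z)|,\dots,|f_n(z)|\}$. For $r_0<r<+\infty$ the characteristic function is $$T_f(r)=\frac1{2\pi}\int_0^{2\pi}\log\|f(re^{i\theta})\|\,d\theta+\frac1{2\pi}\sum_{j=1}^M\int_0^{2\pi}\log\|f(c_j+\tfrac1re^{i\theta})\|\,d\theta .$$ For the hypersurface $D$ with defining homogeneous polynomial $Q$ of degree $d$ and $Q(f)=Q(f_0,\dots,f_n)\not\equiv0$, the proximity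 function is $$m_f(r,D)=\frac1{2\pi}\int_0^{2\pi}\log\frac{\|f(re^{i\theta})\|^d}{|Q(f)(re^{i\theta})|}\,d\theta+\frac1{2\pi}\sum_{j=1}^M\int_0^{2\pi}\log\frac{\|f(c_j+\frac1re^{i\theta})\|^d}{|Q(f)(c_j+\frac1re^{i\theta})|}\,d\theta ,$$ and the counting function is $N_f(r,D)=\int_{r_0}^r\frac{n_f(t,D)}{t}\,dt$, where $n_f(t,D)$ is the number of zeros of $Q(f)$ in $\overline{\Omega}_t$, counted with multiplicity. $T_f$, $m_f$ are independent of the reduced representation up to an additive constant. *)

(* Defs.v *)
From HB Require Import structures.
From mathcomp Require Import all_boot all_order all_algebra.
From mathcomp Require Import complex.
From mathcomp Require Import -(notations) mpoly.
From mathcomp Require Import all_classical all_reals all_analysis.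

Set Implicit Arguments.
Unset Strict Implicit.
Unset Printing Implicit Defensive.

Import Order.TTheory GRing.Theory Num.Theory.
Import numFieldNormedType.Exports.

Local Open Scope classical_set_scope.
Local Open Scope ring_scope.
Local Open Scope complex_scope.

(* The library norm on R[i] takes its values in R[i]; [Normc.normc] is the modulus as
   a real number.  The alias R[i]^o carries the topology and the
   normed-module structure of R[i] over itself, so that [derivable _ z 1]
   on it is complex differentiability at z. *)

Definition holomorphic_on (R : realType) (U : set R[i]) (g : R[i] -> R[i]) :=
  forall z, U z -> derivable (g : R[i]^o -> R[i]^o) z 1.

Definition disk (R : realType) (a : R[i]) (s : R) : set R[i] :=
  [set z | Normc.normc (z - a) < s].

Definition closed_disk (R : realType) (a : R[i]) (s : R) : set R[i] :=
  [set z | Normc.normc (z - a) <= s].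

Section PuncturedPlane.
Context {R : realType} {M : nat}.
Implicit Type c : 'I_M -> R[i].

Definition Omega c : set R[i] := [set z | forall j, z != c j].

Definition rho c : R :=
  2^-1 * inf [set Normc.normc (c jk.1 - c jk.2) | jk in [set jk | jk.1 != jk.2]].

Definition r0 c : R := (rho c)^-1 + \big[Num.max/0]_(j < M) Normc.normc (c j).

Definition Omega_t c (t : R) : set R[i] :=
  disk 0 t `\` \bigcup_j closed_disk (c j) t^-1.

Definition circle_mean (u : R[i] -> R) (a : R[i]) (s : R) : R :=
  (2 * pi)^-1 *
  \int[lebesgue_measure]_(x in `[0, 2 * pi]) u (a + s * cos x +i* (s * sin x)).

(* Sum of the means of u over all the boundary circles of Omega_t c r. *)
Definition boundary_mean c (u : R[i] -> R) (r : R) : R :=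
  circle_mean u 0 r + \sum_(j < M) circle_mean u (c j) r^-1.

End PuncturedPlane.

(* m is the order of vanishing of g at a; it exists, and is unique, for g
   holomorphic near a and not identically zero there. *)
Definition has_order (R : realType) (g : R[i] -> R[i]) (a : R[i]) (m : nat) :=
  exists h : R[i] -> R[i],
    [/\ \forall z \near (a : R[i]^o), derivable (h : R[i]^o -> R[i]^o) z 1,
        h a != 0 &
        \forall z \near (a : R[i]^o), g z = (z - a) ^+ m * h z].

Definition zero_multiplicity (R : realType) (g : R[i] -> R[i]) (a : R[i]) : nat :=
  xget 0%N [set m | has_order g a m].

Section Nevanlinna.
Context {R : realType} {M n : nat}.
Implicit Types (c : 'I_M -> R[i]) (f : R[i] -> 'I_n.+1 -> R[i]).
Implicit Types (Q : mpoly n.+1 R[i]) (d : nat) (r t : R).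

(* A holomorphic curve U -> P^n is given by its homogeneous coordinates
   (f_0 : ... : f_n); values of f outside U are irrelevant. *)
Definition reduced_representation (U : set R[i]) f :=
  (forall i, holomorphic_on U (fun z => f z i)) /\
  (forall z, U z -> exists i, f z i != 0).

(* The hypersurface {Q = 0}, as a set of homogeneous coordinates. *)
Definition hypersurface Q : set ('I_n.+1 -> R[i]) :=
  [set x | meval x Q = 0].

Definition max_norm (x : 'I_n.+1 -> R[i]) : R :=
  \big[Num.max/0]_(i < n.+1) Normc.normc (x i).

Definition characteristic_function c f r : R :=
  boundary_mean c (fun z => ln (max_norm (f z))) r.

Definition proximity_function c f Q d r : R :=
  boundary_mean c
    (fun z => ln (max_norm (f z) ^+ d / Normc.normc (meval (f z) Q))) r.

(* The sum ranges over a compact subset of Omega c when r0 c <= t, hence it has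
   finite support as soon as Q(f) is not identically zero. *)
Definition zero_count c f Q t : nat :=
  let g z := meval (f z) Q in
  \big[addn/0%N]_(z \in closure (Omega_t c t : set R[i]^o) `&`
                        [set z | g z = 0]) zero_multiplicity g z.

Definition counting_function c f Q r : R :=
  \int[lebesgue_measure]_(t in `[r0 c, r]) ((zero_count c f Q t)%:R / t).

End Nevanlinna.

(* Main.v *)
From HB Require Import structures.
Require Import Defs.
From mathcomp Require Import all_boot all_order all_algebra.
From mathcomp Require Import complex.
From mathcomp Require Import -(notations) mpoly.
From mathcomp Require Import all_classical all_reals all_analysis.
From mathcomp Require Import measurable_realfun.
From mathcomp Require Import ring lra.

(** Write g = Q(f), a holomorphic function on Omega that does not vanish
    identically.  Since the logarithm of ||f||^d / |g| splits off the zeros of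
    g, d T_f(r) - m_f(r, D) is the boundary mean B(r) of ln |g|, the sum of
    its means over the boundary circles of Omega_r.  The theorem is therefore
    the formula of Jensen for Omega ([jensen]): N_f(r, D) = B(r) - B(r0), and
    the error term is exactly the constant B(r0).

    The formula of Jensen is additive in g.  The zeros of g are isolated, so
    only finitely many lie near the closure of Omega_r, and g is the product of
    the linear factors w - a at these zeros, with multiplicity, and of a
    zero-free function h ([factor_Omega]).

    For w - a the mean of ln |w - a| over |w - b| = s is
    ln max(s, |a - b|) ([log_kernel]).  On the other side, the closed disks of
    radius 1/t around the punctures are disjoint and contained in |z| < t for
    t >= r0, so the indicator of a in Omega_t is a signed sum of indicators of
    half-lines in t ([indicator_Omega_t]), and integrating it against dt / t
    gives the same combination of logarithms ([kernel_boundary]).  The zero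
    count uses the closure of Omega_t; this matters for finitely many t only.

    For the zero-free h the mean of ln |h| over circles with a common center is
    affine in the logarithm of the radius, with slope the real part of the
    residue mean of h'/h ([log_mean_annulus]).  Increasing r moves the outer
    circle outwards and the inner ones inwards, so the change of the boundary
    mean is proportional to the mean over the outer circle minus the sum of
    those over the inner ones, which vanishes by the theorem of Cauchy for a
    disk with holes ([cauchy_holes], [zero_free_boundary]).

    The complex analysis behind this rests on one fact: means of a holomorphic
    function over concentric circles agree ([cmean_const]), which the
    exponential map reduces to the theorem of Goursat for rectangles.  It gives
    the formula of Cauchy, holomorphy of derivatives, removable singularities,
    orders of zeros and the identity theorem. *)

Set Implicit Arguments.
Unset Strict Implicit.
Unset Printing Implicit Defensive.

Import Order.TTheory GRing.Theory Num.Theory.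
Import numFieldNormedType.Exports.

Local Open Scope classical_set_scope.
Local Open Scope ring_scope.
Local Open Scope complex_scope.

(** * Modulus, complex differentiability and continuity *)

(** Locked, as is ccont, so that unification never unfolds complex
    differentiability and continuity to statements about filters. *)
HB.lock Definition hol {R : realType} (F : R[i] -> R[i]) (z : R[i]) : Prop :=
  derivable (F : R[i]^o -> R[i]^o) z 1.
Canonical hol_unlockable := Unlockable hol.unlock.

HB.lock Definition ccont {R : realType} (F : R[i] -> R[i]) (z : R[i]) : Prop :=
  {for z, continuous (F : R[i]^o -> R[i]^o)}.
Canonical ccont_unlockable := Unlockable ccont.unlock.

Section ComplexBasics.
Context {R : realType}.
Local Notation C := R[i].
Local Notation nc := (@Normc.normc R).
Local Notation Re := (@complex.Re R).
Local Notation Im := (@complex.Im R).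
Implicit Types (z w a b l : C) (F G : C -> C).

Lemma nc_ge0 z : 0 <= nc z.
Proof. by case: z => x y; exact: sqrtr_ge0. Qed.

Lemma nc_eq0 z : (nc z == 0) = (z == 0).
Proof.
apply/eqP/eqP => [/Normc.eq0_normc//|->]; exact: Normc.normc0.
Qed.

Lemma nc_gt0 z : (0 < nc z) = (z != 0).
Proof. by rewrite lt_def nc_ge0 andbT nc_eq0. Qed.

Lemma ncN z : nc (- z) = nc z.
Proof. exact: normcN. Qed.

Lemma ncB z w : nc (z - w) = nc (w - z).
Proof. by rewrite -ncN opprB. Qed.

Lemma ncD z w : nc (z + w) <= nc z + nc w.
Proof. exact: le_normcD. Qed.

Lemma ncM z w : nc (z * w) = nc z * nc w.
Proof. exact: Normc.normcM. Qed.

Lemma ncV z : nc z^-1 = (nc z)^-1.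
Proof. exact: Normc.normcV. Qed.

Lemma ncX z n : nc (z ^+ n) = nc z ^+ n.
Proof.
by elim: n => [|n IH]; rewrite ?expr0 ?Normc.normc1// !exprS ncM IH.
Qed.

Lemma nc_triB z w : nc z - nc w <= nc (z - w).
Proof. by rewrite lerBlDr -{1}(subrK w z) ncD. Qed.

Lemma nc_real (x : R) : nc x%:C = `|x|.
Proof. by rewrite /= expr0n/= addr0 sqrtr_sqr. Qed.

Lemma nc_Re z : `|Re z| <= nc z.
Proof.
case: z => x y /=; rewrite -sqrtr_sqr ler_wsqrtr// lerDl sqr_ge0//.
Qed.

Lemma nc_Im z : `|Im z| <= nc z.
Proof.
case: z => x y /=; rewrite -sqrtr_sqr ler_wsqrtr// lerDr sqr_ge0//.
Qed.

Lemma nc_ReIm z : nc z <= `|Re z| + `|Im z|.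
Proof.
rewrite {1}(complexE z); apply: le_trans (ncD _ _) _.
by rewrite ncM !nc_real /= expr0n /= add0r expr1n sqrtr1 mul1r.
Qed.

Lemma normC_nc z : `|z| = (nc z)%:C.
Proof. by rewrite normc_def; case: z. Qed.

(** The balls of R[i] have radii in R[i]; real radii suffice, because a
    positive element of R[i] is real. *)
Lemma nbhsCP (P : set C) z :
  (\forall w \near (z : C^o), P w) <->
  exists2 e : R, 0 < e & forall w, nc (w - z) < e -> P w.
Proof.
split=> [/nbhs_ballP [e /= e0 H]|[e e0 H]].
  exists (Re e); first by move: e0; rewrite ltcE /= => /andP[].
  move=> w wz; apply: H; rewrite /ball /= normC_nc ncB.
  by move: e0 wz; case: e => ex ey; rewrite !ltcE /= => /andP[/eqP -> _] ->; rewrite eqxx.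
apply/nbhs_ballP; exists e%:C; first by rewrite /= ltcR.
by move=> w; rewrite /ball /= normC_nc ltcR ncB => /H.
Qed.

Lemma holE F z : hol F z = derivable (F : C^o -> C^o) z 1.
Proof. by rewrite unlock. Qed.

Lemma ccontE F z : ccont F z = {for z, continuous (F : C^o -> C^o)}.
Proof. by rewrite unlock. Qed.

Lemma ccontP F z :
  ccont F z <->
  (forall e, 0 < e -> exists2 d, 0 < d &
     forall w, nc (w - z) < d -> nc (F w - F z) < e).
Proof.
rewrite ccontE; split=> [cF e e0|H].
  have /nbhsCP : \forall w \near (z : C^o), nc (F w - F z) < e.
    have := cF [set y | nc (y - F z) < e].
    move=> /(_ _); rewrite /nbhs /=; apply; apply/nbhsCP.
    by exists e.
  by case=> d d0 Hd; exists d.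
move=> A /nbhsCP [e e0 He]; apply/nbhsCP.
have [d d0 Hd] := H e e0; exists d => // w /Hd; exact: He.
Qed.

(** Differentiability with the remainder bounded linearly; unlike the
    limit of the difference quotient, it is directly an estimate for F on
    a whole disk around z. *)
Definition has_cderiv F z l := forall e : R, 0 < e -> exists2 d, 0 < d &
  forall w, nc (w - z) < d -> nc (F w - F z - l * (w - z)) <= e * nc (w - z).

Lemma has_cderivP F z l :
  has_cderiv F z l <-> is_derive (z : C^o) 1 (F : C^o -> C^o) l.
Proof.
have step k h : h != 0 ->
    h^-1 *: (F (h *: (1 : C^o) + z) - F z) - k
    = h^-1 * (F (z + h) - F z - k * h).
  move=> h0; rewrite [RHS]mulrBr (mulrCA _ k) mulVf// mulr1.
  by congr (_ * (F _ - _) - _); rewrite /GRing.scale/= mulr1 addrC.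
split=> [H|[dF <-] e e0].
  have lim : h^-1 *: (F (h *: (1 : C^o) + z) - F z)
               @[h --> (0 : C^o)^'] --> (l : C^o).
    move=> A /nbhsCP [e e0 He].
    have [d d0 Hd] := H (e / 2) ltac:(lra).
    rewrite /nbhs /= /dnbhs /within /=; apply/nbhsCP.
    exists d => // h; rewrite subr0 => hd h0; apply: He.
    rewrite step// ncM ncV mulrC ltr_pdivrMr ?nc_gt0//.
    have := Hd (z + h); rewrite [z + h]addrC addrK (addrC h z) => /(_ hd).
    move=> /le_lt_trans; apply; rewrite ltr_pM2r ?nc_gt0//; lra.
  apply: DeriveDef; last by rewrite /derive; apply/cvg_lim.
  by apply/cvg_ex; exists l.
set L := 'D_1 (F : C^o -> C^o) z.
have : h^-1 *: (F (h *: (1 : C^o) + z) - F z)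
               @[h --> (0 : C^o)^'] --> (L : C^o) by exact: dF.
move=> /(_ [set y | nc (y - L) < e]) [].
  by apply/nbhsCP; exists e.
move=> d /= d0 Hd.
have : \forall h \near (0 : C^o), h != 0 -> nc (h^-1 *: (F (h *: (1 : C^o) + z) - F z) - L) < e.
  by apply/nbhs_ballP; exists d => // h hd h0; exact: Hd.
move=> /nbhsCP [d' d'0 Hd']; exists d' => // w wz.
have [->|wz0] := eqVneq w z; first by rewrite !subrr mulr0 subr0 Normc.normc0 mulr0.
have h0 : w - z != 0 by rewrite subr_eq0.
have := Hd' (w - z); rewrite subr0 step// => /(_ wz h0).
rewrite ncM ncV mulrC ltr_pdivrMr ?nc_gt0//.
by rewrite [z + _]addrC subrK => /ltW.
Qed.

Lemma holP F z : hol F z <-> exists l, has_cderiv F z l.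
Proof.
rewrite holE; split=> [dF|[l /has_cderivP[]//]].
by exists ('D_1 (F : C^o -> C^o) z); apply/has_cderivP; split.
Qed.

Lemma has_cderiv_cont F z l :
  has_cderiv F z l -> ccont F z.
Proof.
move=> /has_cderivP [dF _]; rewrite ccontE.
by apply: differentiable_continuous; apply/derivable1_diffP.
Qed.

Lemma hol_ccont F z :
  hol F z -> ccont F z.
Proof. by move=> /holP [l /has_cderiv_cont]. Qed.

Lemma holB F G z : hol F z -> hol G z -> hol (fun w => F w - G w) z.
Proof. rewrite !holE; by move=> dF dG; exact: (@derivableB C C^o C^o F G z 1 dF dG). Qed.

Lemma hol_cst k z : hol (fun=> k) z.
Proof. rewrite !holE; exact: (@derivable_cst C C^o C^o). Qed.

Lemma hol_id z : hol id z.
Proof. rewrite !holE; exact: (@derivable_id C C^o). Qed.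

Lemma hol_sub a z : hol (fun w => w - a) z.
Proof. exact: (@holB id (fun=> a) z (hol_id z) (hol_cst a z)). Qed.

Lemma holV F z : hol F z -> F z != 0 -> hol (fun w => (F w)^-1) z.
Proof. rewrite !holE; by move=> dF F0; exact: (@derivableV C C^o F z 1 F0 dF). Qed.

Lemma holM F G z : hol F z -> hol G z -> hol (fun w => F w * G w) z.
Proof. rewrite !holE; by move=> dF dG; exact: (@derivableM C C^o F G z 1 dF dG). Qed.

Lemma holD F G z : hol F z -> hol G z -> hol (fun w => F w + G w) z.
Proof. rewrite !holE; by move=> dF dG; exact: (@derivableD C C^o C^o F G z 1 dF dG). Qed.

Lemma ccontM F G z : ccont F z -> ccont G z -> ccont (fun w => F w * G w) z.
Proof. rewrite !ccontE; by move=> cF cG; exact: (@continuousM C C^o F G z cF cG). Qed.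

Lemma ccontD F G z : ccont F z -> ccont G z -> ccont (fun w => F w + G w) z.
Proof. rewrite !ccontE; by move=> cF cG; exact: (@continuousD C C^o C^o F G z cF cG). Qed.

Lemma ccontB F G z : ccont F z -> ccont G z -> ccont (fun w => F w - G w) z.
Proof. rewrite !ccontE; by move=> cF cG; exact: (@continuousB C C^o C^o F G z cF cG). Qed.

Lemma ccontV F z : ccont F z -> F z != 0 -> ccont (fun w => (F w)^-1) z.
Proof. rewrite !ccontE; by move=> cF F0; exact: (@continuousV C C^o F z F0 cF). Qed.

Lemma ccont_cst k z : ccont (fun=> k) z.
Proof. exact: hol_ccont (hol_cst _ _). Qed.

Lemma ccont_id z : ccont id z.
Proof. exact: hol_ccont (hol_id _). Qed.

Lemma ccont_sub a z : ccont (fun w => w - a) z.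
Proof. exact: hol_ccont (hol_sub _ _). Qed.

End ComplexBasics.

(** * Integrals of real functions and the bisection argument *)

Section RealIntegral.
Context {R : realType}.
Local Notation mu := (@lebesgue_measure R).
Implicit Types (u v : R -> R) (a b m t : R).

Definition rint u a b : R := \int[mu]_(t in `[a, b]) u t.

(** Two-sided continuity at the endpoints as well: the integrands below
    are restrictions of functions that are continuous on a neighbourhood,
    and subintervals are then immediate. *)
Definition cont_on u a b := forall t, a <= t <= b -> {for t, continuous u}.

Lemma cont_on_integrable u a b :
  cont_on u a b -> mu.-integrable `[a, b] (EFin \o u).
Proof.
move=> cu; apply: continuous_compact_integrable; first exact: segment_compact.
apply: continuous_in_subspaceT => t; rewrite inE /= in_itv /=; exact: cu.
Qed.

Lemma rintD u v a b : cont_on u a b -> cont_on v a b ->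
  rint (fun t => u t + v t) a b = rint u a b + rint v a b.
Proof. by move=> cu cv; rewrite /rint RintegralD//; exact: cont_on_integrable. Qed.

Lemma rintB u v a b : cont_on u a b -> cont_on v a b ->
  rint (fun t => u t - v t) a b = rint u a b - rint v a b.
Proof. by move=> cu cv; rewrite /rint RintegralB//; exact: cont_on_integrable. Qed.

Lemma rintZ u k a b : cont_on u a b ->
  rint (fun t => k * u t) a b = k * rint u a b.
Proof. by move=> cu; rewrite /rint RintegralZl//; exact: cont_on_integrable. Qed.

Lemma rint_cst k a b : a <= b -> rint (fun=> k) a b = k * (b - a).
Proof.
move=> ab; rewrite /rint Rintegral_cst//= lebesgue_measure_itv/= lte_fin.
case: ltP => //= ba; have -> : b = a by lra.
by rewrite subrr mulr0.
Qed.

Lemma eq_rint u v a b : (forall t, a <= t <= b -> u t = v t) ->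
  rint u a b = rint v a b.
Proof.
by move=> uv; apply: eq_Rintegral => t; rewrite inE/= in_itv/=; exact: uv.
Qed.

Lemma cst_cont_on k a b : cont_on (fun=> k) a b.
Proof. by move=> t _; exact: cst_continuous. Qed.

Lemma rint_le u k a b : a <= b -> cont_on u a b ->
  (forall t, a <= t <= b -> `|u t| <= k) -> `|rint u a b| <= k * (b - a).
Proof.
move=> ab cu uk.
have ci := cont_on_integrable cu.
apply: le_trans (le_normr_Rintegral _ ci) _ => //.
rewrite -(rint_cst _ ab); apply: le_Rintegral => //.
- exact: integrable_norm ci.
- by apply: (@cont_on_integrable (fun=> k)); exact: cst_cont_on.
Qed.

Lemma rint_split u a m b : a <= m <= b -> cont_on u a b ->
  rint u a b = rint u a m + rint u m b.
Proof.
move=> /andP[am mb] cu; rewrite /rint.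
have ci := cont_on_integrable cu.
have H := @Rintegral_itvB _ u (BLeft a) (BRight b) m ci.
rewrite -[LHS](subrK (\int[mu]_(t in `[a, m]) u t)) H ?bnd_simp//.
rewrite addrC Rintegral_itv_obnd_cbnd//.
by apply: integrableS ci => //; apply: subset_itvr; rewrite bnd_simp.
Qed.

Lemma rint_FTC u v a b : a <= b -> cont_on u a b ->
  (forall t, a <= t <= b -> is_derive t 1 v (u t)) -> rint u a b = v b - v a.
Proof.
move=> ab cu vu; have [e|ab'] := eqVneq a b.
  rewrite e subrr /rint -(Rintegral_set1 u b); congr Rintegral.
  by rewrite set_itv1.
have {ab ab'} ab : a < b by rewrite lt_neqAle ab'.
rewrite /rint /Rintegral (@continuous_FTC2 _ u v)//.
- apply: continuous_in_subspaceT => t; rewrite inE /= in_itv /=; exact: cu.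
- have cv t : a <= t <= b -> {for t, continuous v}.
    move=> /vu [dv _]; apply: differentiable_continuous.
    exact/derivable1_diffP.
  split.
  + by move=> t; rewrite in_itv /= => /andP[? ?]; have [|//] := vu t; lra.
  + by apply: cvg_at_right_filter; apply: cv; lra.
  + by apply: cvg_at_left_filter; apply: cv; lra.
- move=> t; rewrite in_itv/= => /andP[? ?]; rewrite derive1E.
  by have [|_ ->] := vu t; first lra.
Qed.

End RealIntegral.

Section Bisection.
Context {R : realType}.
Local Notation C := R[i].
Local Notation nc := (@Normc.normc R).

Lemma lt_pow2 (x d : R) : 0 < d -> exists n, x / 2 ^+ n < d.
Proof.
move=> d0; exists (Num.bound (`|x| / d)).
rewrite ltr_pdivrMr ?exprn_gt0// mulrC -ltr_pdivrMr//.
apply: (@le_lt_trans _ _ (`|x| / d)).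
  by rewrite ler_pM2r ?invr_gt0// ler_norm.
apply: lt_le_trans (archi_boundP _) _; first by rewrite divr_ge0// ltW.
by rewrite -natrX ler_nat ltnW// ltn_expl.
Qed.

Lemma nested_point (a b : nat -> R) :
  (forall n, a n <= a n.+1) -> (forall n, b n.+1 <= b n) ->
  (forall n, a n <= b n) -> exists p, forall n, a n <= p <= b n.
Proof.
move=> ai bi ab.
have amono : {homo a : m n / (m <= n)%N >-> m <= n}.
  by apply: homo_leq => //; exact: le_trans.
have bmono : {homo b : m n / (m <= n)%N >-> n <= m}.
  apply: (@homo_leq _ b (fun x y => y <= x)) => //.
  by move=> x y z yx zy; exact: le_trans zy yx.
have abmn m n : a m <= b n.
  apply: le_trans (amono m (maxn m n) (leq_maxl _ _)) _.
  by apply: le_trans (ab _) _; apply: bmono; exact: leq_maxr.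
exists (sup (range a)) => n; apply/andP; split.
  apply: sup_upper_bound; last by exists n.
  by split; [exists (a 0%N); exists 0%N|exists (b 0%N) => _ [m _ <-]].
apply: sup_le_ub; first by exists (a 0%N); exists 0%N.
by move=> _ [m _ <-].
Qed.

(** The bisection argument of Goursat, for any function J of rectangles
    that is additive in both directions: some quarter of a rectangle
    carries a quarter of the modulus of J, so the nested quarters shrink
    to a point near which J is of smaller order than the square of the
    side lengths, which forces J to vanish. *)
Lemma rect_additive_null (J : R -> R -> R -> R -> C) x1 x2 y1 y2 :
  x1 <= x2 -> y1 <= y2 ->
  (forall a m b c d, x1 <= a -> a <= m -> m <= b -> b <= x2 ->
     y1 <= c -> c <= d -> d <= y2 -> J a b c d = J a m c d + J m b c d) ->
  (forall a b c m d, x1 <= a -> a <= b -> b <= x2 ->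
     y1 <= c -> c <= m -> m <= d -> d <= y2 -> J a b c d = J a b c m + J a b m d) ->
  (forall px py e, x1 <= px <= x2 -> y1 <= py <= y2 -> 0 < e ->
     exists2 r, 0 < r & forall a b c d, x1 <= a -> a <= px -> px <= b -> b <= x2 ->
       y1 <= c -> c <= py -> py <= d -> d <= y2 -> b - a < r -> d - c < r ->
       nc (J a b c d) <= e * ((b - a) + (d - c)) ^+ 2) ->
  J x1 x2 y1 y2 = 0.
Proof.
move=> hx hy addx addy loc.
pose ok (q : R * R * (R * R)) :=
  [/\ x1 <= q.1.1, q.1.1 <= q.1.2, q.1.2 <= x2 &
      [/\ y1 <= q.2.1, q.2.1 <= q.2.2 & q.2.2 <= y2]].
pose Jq (q : R * R * (R * R)) := J q.1.1 q.1.2 q.2.1 q.2.2.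
have stepP q : exists q', ok q ->
    [/\ ok q', q.1.1 <= q'.1.1 /\ q'.1.2 <= q.1.2,
        q.2.1 <= q'.2.1 /\ q'.2.2 <= q.2.2,
        q'.1.2 - q'.1.1 = (q.1.2 - q.1.1) / 2 /\
        q'.2.2 - q'.2.1 = (q.2.2 - q.2.1) / 2 &
        nc (Jq q) / 4 <= nc (Jq q')].
  have [okq|nok] := pselect (ok q); last by exists q => /nok.
  case: q okq => [[a b] [c d]] [/= xa ab bx [yc cd dy]].
  set m := (a + b) / 2; set k := (c + d) / 2.
  have am : a <= m <= b by rewrite /m; lra.
  have ck : c <= k <= d by rewrite /k; lra.
  have JE : J a b c d = J a m c k + J m b c k + (J a m k d + J m b k d).
    have /andP[am1 mb1] := am; have /andP[ck1 kd1] := ck.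
    rewrite (addy a b c k d)// (addx a m b c k)// ?(addx a m b k d)//.
      exact: le_trans yc ck1.
    exact: le_trans kd1 dy.
  have /or4P : [|| nc (J a b c d) / 4 <= nc (J a m c k),
      nc (J a b c d) / 4 <= nc (J m b c k),
      nc (J a b c d) / 4 <= nc (J a m k d) |
      nc (J a b c d) / 4 <= nc (J m b k d)].
    apply: contraT; rewrite !negb_or -!ltNge => /and4P[h1 h2 h3 h4].
    have := ncD (J a m c k + J m b c k) (J a m k d + J m b k d).
    have := ncD (J a m c k) (J m b c k).
    have := ncD (J a m k d) (J m b k d).
    rewrite -JE; lra.
  have /andP[am1 mb1] := am; have /andP[ck1 kd1] := ck.
  have xm := le_trans xa am1; have mx := le_trans mb1 bx.
  have yk := le_trans yc ck1; have ky := le_trans kd1 dy.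
  have [w1 w2] : m - a = (b - a) / 2 /\ b - m = (b - a) / 2 by split; rewrite /m; field.
  have [w3 w4] : k - c = (d - c) / 2 /\ d - k = (d - c) / 2 by split; rewrite /k; field.
  by case=> h; [exists ((a, m), (c, k))|exists ((m, b), (c, k))|
    exists ((a, m), (k, d))|exists ((m, b), (k, d))] => _; split => //; split.
have [step stepH] := choice stepP.
pose q n := iter n step ((x1, x2), (y1, y2)).
have okq n : ok (q n).
  by elim: n => [|n IH]; [split|case: (stepH _ IH)].
have qs n := stepH _ (okq n).
have wx n : (q n).1.2 - (q n).1.1 = (x2 - x1) / 2 ^+ n.
  elim: n => [|n IH]; first by rewrite expr0 divr1.
  by have [_ _ _ [-> _] _] := qs n; rewrite IH exprSr invfM mulrA.
have wy n : (q n).2.2 - (q n).2.1 = (y2 - y1) / 2 ^+ n.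
  elim: n => [|n IH]; first by rewrite expr0 divr1.
  by have [_ _ _ [_ ->] _] := qs n; rewrite IH exprSr invfM mulrA.
have Jn n : nc (J x1 x2 y1 y2) / 4 ^+ n <= nc (Jq (q n)).
  elim: n => [|n IH]; first by rewrite expr0 divr1.
  have [_ _ _ _ h] := qs n.
  by rewrite exprSr invfM mulrA; apply: le_trans h; rewrite ler_pM2r ?invr_gt0.
have [px pxH] : exists p, forall n, (q n).1.1 <= p <= (q n).1.2.
  by apply: nested_point => n; [case: (qs n) => _ []|case: (qs n) => _ []|case: (okq n)].
have [py pyH] : exists p, forall n, (q n).2.1 <= p <= (q n).2.2.
  by apply: nested_point => n; [case: (qs n) => _ _ []|case: (qs n) => _ _ []|case: (okq n) => _ _ _ []].
have key e : 0 < e -> nc (J x1 x2 y1 y2) <= e * ((x2 - x1) + (y2 - y1)) ^+ 2.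
  move=> e0; have [r r0 Hr] := loc px py e (pxH 0%N) (pyH 0%N) e0.
  have [n Hn] := lt_pow2 ((x2 - x1) + (y2 - y1)) r0.
  have p2 : 0 < 2 ^- n :> R by rewrite invr_gt0 exprn_gt0.
  have wX : (x2 - x1) / 2 ^+ n < r.
    by apply: le_lt_trans Hn; rewrite ler_pM2r//; lra.
  have wY : (y2 - y1) / 2 ^+ n < r.
    by apply: le_lt_trans Hn; rewrite ler_pM2r//; lra.
  have [h1 h2 h3 [h4 h5 h6]] := okq n.
  have /andP[h7 h8] := pxH n; have /andP[h9 h10] := pyH n.
  have := Hr _ _ _ _ h1 h7 h8 h3 h4 h9 h10 h6.
  rewrite wx wy => /(_ wX wY) h.
  have := le_trans (Jn n) h; rewrite -mulrDl exprMn mulrA ler_pdivrMr ?exprn_gt0//.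
  rewrite -[X in _ <= X -> _]mulrA.
  suff -> : (2 ^- n) ^+ 2 * 4 ^+ n = 1 :> R by rewrite mulr1.
  rewrite -exprVn -exprM mulnC exprM -exprMn.
  by rewrite (_ : _ * _ = 1) ?expr1n//; field.
apply: Normc.eq0_normc; apply/eqP; rewrite eq_le nc_ge0 andbT.
apply/ler_addgt0Pr => e e0; rewrite add0r.
set S := ((x2 - x1) + (y2 - y1)) ^+ 2 in key *.
have S0 : 0 <= S by exact: sqr_ge0.
have := key (e / (S + 1)) ltac:(by rewrite divr_gt0//; lra).
move=> /le_trans; apply; rewrite mulrAC ler_pdivrMr; last lra.
by rewrite ler_pM2l//; lra.
Qed.

End Bisection.

(** * Integrals along segments and around rectangles *)

Section ComplexIntegral.
Context {R : realType}.
Local Notation C := R[i].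
Local Notation nc := (@Normc.normc R).
Local Notation Re := (@complex.Re R).
Local Notation Im := (@complex.Im R).
Implicit Types (F G : R -> C) (a b t : R) (k : C).

Lemma ReD (x y : C) : Re (x + y) = Re x + Re y. Proof. by case: x y => ? ? []. Qed.
Lemma ImD (x y : C) : Im (x + y) = Im x + Im y. Proof. by case: x y => ? ? []. Qed.
Lemma ReN (x : C) : Re (- x) = - Re x. Proof. by case: x. Qed.
Lemma ImN (x : C) : Im (- x) = - Im x. Proof. by case: x. Qed.
Lemma ReM (x y : C) : Re (x * y) = Re x * Re y - Im x * Im y.
Proof. by case: x y => ? ? []. Qed.
Lemma ImM (x y : C) : Im (x * y) = Re x * Im y + Im x * Re y.
Proof. by case: x y => ? ? []. Qed.

Lemma eqC (x y : C) : Re x = Re y -> Im x = Im y -> x = y.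
Proof. by case: x y => ? ? [? ?] /= -> ->. Qed.

Lemma contRCP F t :
  {for t, continuous (F : R -> C^o)} <->
  (forall e, 0 < e -> \forall s \near t, nc (F s - F t) < e).
Proof.
split=> [cF e e0|H].
  have := cF [set y | nc (y - F t) < e].
  by move=> /(_ _); rewrite /nbhs /=; apply; apply/nbhsCP; exists e.
move=> A /nbhsCP [e e0 He]; near=> s; apply: He; near: s; exact: H.
Unshelve. all: by end_near. Qed.

Lemma cont_Re F t : {for t, continuous (F : R -> C^o)} ->
  {for t, continuous (fun s => Re (F s))}.
Proof.
move=> /contRCP cF; apply/cvgrPdist_lt => e e0; near=> s.
rewrite -ReN -ReD; apply: le_lt_trans (nc_Re _) _; rewrite ncB.
by near: s; exact: cF.
Unshelve. all: by end_near. Qed.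

Lemma cont_Im F t : {for t, continuous (F : R -> C^o)} ->
  {for t, continuous (fun s => Im (F s))}.
Proof.
move=> /contRCP cF; apply/cvgrPdist_lt => e e0; near=> s.
rewrite -ImN -ImD; apply: le_lt_trans (nc_Im _) _; rewrite ncB.
by near: s; exact: cF.
Unshelve. all: by end_near. Qed.

Lemma cont_ReIm F t : {for t, continuous (fun s => Re (F s))} ->
  {for t, continuous (fun s => Im (F s))} -> {for t, continuous (F : R -> C^o)}.
Proof.
move=> /cvgrPdist_lt cR /cvgrPdist_lt cI; apply/contRCP => e e0; near=> s.
rewrite ncB; apply: le_lt_trans (nc_ReIm _) _.
rewrite ReD ImD ReN ImN (splitr e) ltrD//; near: s.
  by apply: cR; lra.
by apply: cI; lra.
Unshelve. all: by end_near. Qed.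

Definition ccont_on F a b :=
  forall t, a <= t <= b -> {for t, continuous (F : R -> C^o)}.

Definition cint F a b : C :=
  rint (fun t => Re (F t)) a b +i* rint (fun t => Im (F t)) a b.

Lemma ccont_Re F a b : ccont_on F a b -> cont_on (fun t => Re (F t)) a b.
Proof. by move=> cF t /cF /cont_Re. Qed.

Lemma ccont_Im F a b : ccont_on F a b -> cont_on (fun t => Im (F t)) a b.
Proof. by move=> cF t /cF /cont_Im. Qed.

Lemma ccont_onM F G a b : ccont_on F a b -> ccont_on G a b ->
  ccont_on (fun t => F t * G t) a b.
Proof. by move=> cF cG t tab; apply: (@cvgM C); [exact: cF|exact: cG]. Qed.

Lemma ccont_onN F a b : ccont_on F a b -> ccont_on (fun t => - F t) a b.
Proof. by move=> cF t tab; apply: (@cvgN _ C^o); exact: cF. Qed.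

Lemma ccont_on_cst k a b : ccont_on (fun=> k) a b.
Proof. by move=> t _; exact: (@cst_continuous _ C^o). Qed.

Lemma ccont_real a b : ccont_on (fun t => t%:C) a b.
Proof.
move=> t _; apply: cont_ReIm => /=; first exact: cvg_id.
exact: cst_continuous.
Qed.

Lemma eq_cint F G a b : (forall t, a <= t <= b -> F t = G t) ->
  cint F a b = cint G a b.
Proof. by move=> FG; congr (_ +i* _); apply: eq_rint => t /FG ->. Qed.

Lemma cintD F G a b : ccont_on F a b -> ccont_on G a b ->
  cint (fun t => F t + G t) a b = cint F a b + cint G a b.
Proof.
move=> cF cG; apply: eqC => /=.
  rewrite -rintD; [|exact: ccont_Re|exact: ccont_Re].
  by apply: eq_rint => t _; rewrite ReD.
rewrite -rintD; [|exact: ccont_Im|exact: ccont_Im].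
by apply: eq_rint => t _; rewrite ImD.
Qed.

Lemma cont_onZ (x : R) (u : R -> R) a b : cont_on u a b -> cont_on (fun t => x * u t) a b.
Proof. by move=> cu t tab; apply: cvgM; [exact: cvg_cst|exact: cu]. Qed.

Lemma cintZ k F a b : ccont_on F a b ->
  cint (fun t => k * F t) a b = k * cint F a b.
Proof.
move=> cF; have cR := ccont_Re cF; have cI := ccont_Im cF.
apply: eqC => /=.
  rewrite ReM /= -rintZ// -rintZ// -rintB; try exact: cont_onZ.
  by apply: eq_rint => t _; rewrite ReM.
rewrite ImM /= -rintZ// -rintZ// -rintD; try exact: cont_onZ.
by apply: eq_rint => t _; rewrite ImM.
Qed.

Lemma cintB F G a b : ccont_on F a b -> ccont_on G a b ->
  cint (fun t => F t - G t) a b = cint F a b - cint G a b.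
Proof.
move=> cF cG; rewrite (cintD cF (ccont_onN cG)).
by rewrite -mulN1r -cintZ//; congr (_ + _); apply: eq_cint => t _; rewrite mulN1r.
Qed.

(** The factor 2 comes from estimating the real and imaginary parts
    separately; only the order of magnitude of such bounds is ever used. *)
Lemma cint_le F a b (K : R) : a <= b -> ccont_on F a b ->
  (forall t, a <= t <= b -> nc (F t) <= K) -> nc (cint F a b) <= 2 * K * (b - a).
Proof.
move=> ab cF FK; apply: le_trans (nc_ReIm _) _.
have -> : 2 * K * (b - a) = K * (b - a) + K * (b - a) by ring.
rewrite lerD//; apply: rint_le => //; try (by [exact: ccont_Re|exact: ccont_Im]);
  move=> t /FK; apply: le_trans; [exact: nc_Re|exact: nc_Im].
Qed.

Lemma cint_cst k a b : a <= b -> cint (fun=> k) a b = k * (b - a)%:C.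
Proof.
move=> ab; rewrite /cint !rint_cst//.
by apply: eqC; rewrite ?ReM ?ImM /= ?mulr0 ?subr0 ?add0r.
Qed.

Lemma cint_split F a m b : a <= m <= b -> ccont_on F a b ->
  cint F a b = cint F a m + cint F m b.
Proof.
move=> amb cF; apply: eqC; rewrite /= (rint_split amb)//;
  [exact: ccont_Re|exact: ccont_Im].
Qed.

Lemma cint_affine k l a b : a <= b ->
  cint (fun t => k + l * t%:C) a b =
  k * (b - a)%:C + l * ((b ^+ 2 - a ^+ 2) / 2)%:C.
Proof.
move=> ab; rewrite cintD; first last.
  by apply: ccont_onM; [exact: ccont_on_cst|exact: ccont_real].
  exact: ccont_on_cst.
rewrite cint_cst// cintZ; last exact: ccont_real.
congr (_ + _ * _); apply: eqC => /=; last by rewrite rint_cst// mul0r.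
rewrite mulrBl; apply: (@rint_FTC _ _ (fun t => t ^+ 2 / 2)) => //.
  by move=> t _; exact: cvg_id.
by move=> t _; apply: is_derive_eq; rewrite /GRing.scale /=; field.
Qed.

End ComplexIntegral.

Section Goursat.
Context {R : realType}.
Local Notation C := R[i].
Local Notation nc := (@Normc.normc R).

Lemma ccont_horizontal (F : C -> C) (x1 x2 y : R) :
  (forall x, x1 <= x <= x2 -> ccont F (x +i* y)) ->
  ccont_on (fun x => F (x +i* y)) x1 x2.
Proof.
move=> cF x xab; apply: (@continuous_comp _ C^o C^o (fun x => x +i* y) F).
  by apply: cont_ReIm => /=; [exact: cvg_id|exact: cst_continuous].
by move: (cF _ xab); rewrite ccontE.
Qed.

Lemma ccont_vertical (F : C -> C) (x y1 y2 : R) :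
  (forall y, y1 <= y <= y2 -> ccont F (x +i* y)) ->
  ccont_on (fun y => F (x +i* y)) y1 y2.
Proof.
move=> cF y yab; apply: (@continuous_comp _ C^o C^o (fun y => x +i* y) F).
  by apply: cont_ReIm => /=; [exact: cst_continuous|exact: cvg_id].
by move: (cF _ yab); rewrite ccontE.
Qed.

Lemma nc4 (x y z w : C) : nc (x + y - z - w) <= nc x + nc y + nc z + nc w.
Proof.
have := ncD (x + y - z) (- w); have := ncD (x + y) (- z).
have := ncD x y; rewrite !ncN; lra.
Qed.

(** The integral of F dz around the rectangle, anticlockwise from its
    lower left corner. *)
Definition rect_int (F : C -> C) (x1 x2 y1 y2 : R) : C :=
  cint (fun x => F (x +i* y1)) x1 x2 + 'i * cint (fun y => F (x2 +i* y)) y1 y2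
  - cint (fun x => F (x +i* y2)) x1 x2 - 'i * cint (fun y => F (x1 +i* y)) y1 y2.

Lemma rect_int_affine (k l : C) (x1 x2 y1 y2 : R) : x1 <= x2 -> y1 <= y2 ->
  rect_int (fun w => k + l * w) x1 x2 y1 y2 = 0.
Proof.
move=> hx hy; rewrite /rect_int.
have H y : cint (fun x => k + l * (x +i* y)) x1 x2 =
    (k + l * (0 +i* y)) * (x2 - x1)%:C + l * ((x2 ^+ 2 - x1 ^+ 2) / 2)%:C.
  rewrite -cint_affine//; apply: eq_cint => t _.
  by rewrite -addrA -mulrDr; congr (_ + _ * _); apply: eqC; rewrite /= ?add0r ?addr0.
have V x : cint (fun y => k + l * (x +i* y)) y1 y2 =
    (k + l * x%:C) * (y2 - y1)%:C + (l * 'i) * ((y2 ^+ 2 - y1 ^+ 2) / 2)%:C.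
  rewrite -cint_affine//; apply: eq_cint => t _.
  rewrite -addrA -mulrA -mulrDr; congr (_ + _ * _).
  by apply: eqC => /=; ring.
rewrite !H !V; case: k l {H V} => [k1 k2] [l1 l2].
by apply: eqC; rewrite !(ReD, ImD, ReN, ImN, ReM, ImM) /=; field.
Qed.

(** On a small rectangle around p the function differs from its affine
    approximation at p by a small multiple of the side lengths, and an
    affine function integrates to zero; bisection does the rest. *)
Theorem goursat_rectangle (F : C -> C) (x1 x2 y1 y2 : R) :
  x1 <= x2 -> y1 <= y2 ->
  (forall x y, x1 <= x <= x2 -> y1 <= y <= y2 ->
     hol F (x +i* y)) ->
  rect_int F x1 x2 y1 y2 = 0.
Proof.
move=> hx hy dF.
have cF x y : x1 <= x <= x2 -> y1 <= y <= y2 ->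
    ccont F (x +i* y).
  by move=> ? ?; apply: hol_ccont; exact: dF.
have ch a b y : x1 <= a -> b <= x2 -> y1 <= y <= y2 -> ccont_on (fun x => F (x +i* y)) a b.
  by move=> ? ? ?; apply: ccont_horizontal => x /andP[? ?]; apply: cF => //; lra.
have cv c d x : y1 <= c -> d <= y2 -> x1 <= x <= x2 -> ccont_on (fun y => F (x +i* y)) c d.
  by move=> ? ? ?; apply: ccont_vertical => y /andP[? ?]; apply: cF => //; lra.
apply: (rect_additive_null hx hy).
- move=> a m b c d xa am mb bx yc cd dy; rewrite /rect_int.
  rewrite !(@cint_split _ _ a m b) ?am ?mb//; last by apply: ch => //; lra.
    ring.
  by apply: ch => //; lra.
- move=> a b c m d xa ab bx yc cm md dy; rewrite /rect_int.
  rewrite !(@cint_split _ _ c m d) ?cm ?md//; last by apply: cv => //; lra.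
    ring.
  by apply: cv => //; lra.
move=> px py e hpx hpy e0.
have /holP [l Hl] := dF _ _ hpx hpy.
have [r r0 Hr] := Hl (e / 4) ltac:(lra).
exists (r / 2); first lra.
move=> a b c d xa apx pxb bx yc cpy pyd dy bar dcr.
set p := px +i* py in Hl Hr.
pose A w := F p - l * p + l * w.
pose E w := F w - A w.
have near_p x y : a <= x <= b -> c <= y <= d -> nc (E (x +i* y)) <= e / 4 * ((b - a) + (d - c)).
  move=> /andP[? ?] /andP[? ?].
  have dist : nc ((x +i* y) - p) <= (b - a) + (d - c).
    apply: le_trans (nc_ReIm _) _; rewrite /=.
    by apply: lerD; rewrite ler_norml; lra.
  have -> : E (x +i* y) = F (x +i* y) - F p - l * ((x +i* y) - p).
    by rewrite /E /A; ring.
  apply: le_trans (Hr _ _) _; first by lra.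
  by rewrite ler_pM2l//; lra.
have cA w : ccont A w.
  apply: (@ccontD _ (fun=> F p - l * p) (fun w => l * w)); first exact: ccont_cst.
  by apply: (@ccontM _ (fun=> l) id); [exact: ccont_cst|exact: ccont_id].
have cE x y : x1 <= x <= x2 -> y1 <= y <= y2 -> ccont E (x +i* y).
  by move=> hx' hy'; apply: ccontB => //; exact: cF.
have cEh a' b' y : x1 <= a' -> b' <= x2 -> y1 <= y <= y2 -> ccont_on (fun x => E (x +i* y)) a' b'.
  by move=> ? ? ?; apply: ccont_horizontal => x /andP[? ?]; apply: cE => //; lra.
have cEv c' d' x : y1 <= c' -> d' <= y2 -> x1 <= x <= x2 -> ccont_on (fun y => E (x +i* y)) c' d'.
  by move=> ? ? ?; apply: ccont_vertical => y /andP[? ?]; apply: cE => //; lra.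
have -> : rect_int F a b c d = rect_int E a b c d.
  transitivity (rect_int E a b c d + rect_int A a b c d); last first.
    by rewrite (rect_int_affine _ _ (le_trans apx pxb) (le_trans cpy pyd)) addr0.
  rewrite /rect_int.
  have hE y : y1 <= y <= y2 -> cint (fun x => F (x +i* y)) a b = cint (fun x => E (x +i* y)) a b + cint (fun x => A (x +i* y)) a b.
    move=> hy'; rewrite -cintD; [|by apply: cEh|].
      by apply: eq_cint => t _; rewrite /E subrK.
    by apply: ccont_horizontal => x _; exact: cA.
  have vE x : x1 <= x <= x2 -> cint (fun y => F (x +i* y)) c d = cint (fun y => E (x +i* y)) c d + cint (fun y => A (x +i* y)) c d.
    move=> hx'; rewrite -cintD; [|by apply: cEv|].
      by apply: eq_cint => t _; rewrite /E subrK.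
    by apply: ccont_vertical => y _; exact: cA.
  rewrite (hE c); last lra.
  rewrite (hE d); last lra.
  rewrite (vE a); last lra.
  rewrite (vE b); last lra.
  rewrite !mulrDr; move: (cint _ _ _) (cint _ _ _) ('i * _) ('i * _).
  clear=> *; ring.
have i1 : nc ('i : C) = 1 by rewrite /= expr0n/= add0r expr1n sqrtr1.
rewrite /rect_int; set S := (b - a) + (d - c).
have bh y : c <= y <= d -> nc (cint (fun x => E (x +i* y)) a b) <= 2 * (e / 4 * S) * (b - a).
  move=> hy'; apply: cint_le; [lra|by apply: cEh => //; lra|].
  by move=> t ht; exact: near_p.
have bv x : a <= x <= b -> nc (cint (fun y => E (x +i* y)) c d) <= 2 * (e / 4 * S) * (d - c).
  move=> hx'; apply: cint_le; [lra|by apply: cEv => //; lra|].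
  by move=> t ht; exact: near_p.
apply: le_trans (nc4 _ _ _ _) _; rewrite !ncM i1 !mul1r.
have hc : c <= c <= d by lra.
have hd : c <= d <= d by lra.
have ha : a <= a <= b by lra.
have hb : a <= b <= b by lra.
apply: le_trans (lerD (lerD (lerD (bh c hc) (bv b hb)) (bh d hd)) (bv a ha)) _.
by rewrite le_eqVlt; apply/orP; left; apply/eqP; rewrite /S; field.
Qed.

End Goursat.

(** * Means over circles *)

Section CircleMean.
Context {R : realType}.
Local Notation C := R[i].
Local Notation nc := (@Normc.normc R).
Local Notation Re := (@complex.Re R).
Local Notation Im := (@complex.Im R).
Implicit Types (F : C -> C) (b z w : C) (s t x y : R).

Lemma is_derive_small (f : R -> R) (x l e : R) : is_derive x 1 f l -> 0 < e ->
  \forall h \near (0 : R), `|f (x + h) - f x - l * h| <= e * `|h|.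
Proof.
move=> [df <-] e0.
have : h^-1 *: (f (h *: 1 + x) - f x) @[h --> 0^'] --> 'D_1 f x by exact: df.
move=> /cvgrPdist_lt /(_ e e0); rewrite near_withinE.
apply: filterS => h H.
have [->|h0] := eqVneq h 0; first by rewrite addr0 mulr0 !subrr normr0 mulr0.
have := H h0; rewrite /GRing.scale /= mulr1 (addrC h) => /ltW H'.
rewrite -ler_pdivrMr ?normr_gt0// -normfV -normrM; apply: le_trans H'.
rewrite distrC; set D := f _; rewrite le_eqVlt; apply/orP; left; apply/eqP.
by congr (`|_|); field.
Qed.

Definition cis t : C := cos t +i* sin t.

Definition cexp z : C := (expR (Re z))%:C * cis (Im z).

Lemma nc_cis t : nc (cis t) = 1.
Proof. by rewrite /= cos2Dsin2 sqrtr1. Qed.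

Lemma cisD t u : cis (t + u) = cis t * cis u.
Proof. by apply: eqC; rewrite ?ReM ?ImM /= ?cosD ?sinD; ring. Qed.

Lemma cexpD z w : cexp (z + w) = cexp z * cexp w.
Proof. by rewrite /cexp ReD ImD expRD cisD rmorphM /=; ring. Qed.

(** By cexpD only the derivative at 0 matters, where it follows from the
    real derivatives of exp, cos and sin. *)
Lemma cexp_has_cderiv z : has_cderiv cexp z (cexp z).
Proof.
suff H0 e : 0 < e -> exists2 d, 0 < d &
    forall h, nc h < d -> nc (cexp h - 1 - h) <= e * nc h.
  have z0 : 0 < nc (cexp z).
    by rewrite ncM nc_real nc_cis mulr1 normr_gt0 gt_eqF ?expR_gt0.
  move=> e e0; have [d d0 Hd] := H0 (e / nc (cexp z)) (divr_gt0 e0 z0).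
  exists d => // w /Hd H.
  have -> : cexp w - cexp z - cexp z * (w - z) = cexp z * (cexp (w - z) - 1 - (w - z)).
    have -> : cexp w = cexp z * cexp (w - z) by rewrite -cexpD addrC subrK.
    by ring.
  by rewrite ncM mulrC -ler_pdivlMr// mulrAC.
move=> e0; have e4 : 0 < e / 4 by lra.
have d1 := @is_derive_expR R 0; rewrite expR0 in d1.
have d2 := @is_derive_cos R 0; rewrite sin0 oppr0 in d2.
have d3 := @is_derive_sin R 0; rewrite cos0 in d3.
have := is_derive_small d3 e4; have := is_derive_small d2 e4.
have := is_derive_small d1 e4.
move=> /nbhs_ballP [r1 /= r10 H1] /nbhs_ballP [r2 /= r20 H2] /nbhs_ballP [r3 /= r30 H3].
pose d := Num.min (Num.min r1 r2) (Num.min r3 (e / 4 / (2 * (e / 4) + 1))).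
have q0 : 0 < 2 * (e / 4) + 1 by lra.
exists d; first by rewrite /d !lt_min r10 r20 r30 divr_gt0.
move=> h; rewrite /d !lt_min => /andP[/andP[h1 h2] /andP[h3 h4]].
have hR := nc_Re h; have hI := nc_Im h.
have := H1 (Re h); rewrite /ball /= sub0r normrN => /(_ (le_lt_trans hR h1)).
have := H2 (Im h); rewrite /ball /= sub0r normrN => /(_ (le_lt_trans hI h2)).
have := H3 (Im h); rewrite /ball /= sub0r normrN => /(_ (le_lt_trans hI h3)).
rewrite !add0r expR0 cos0 sin0 mul0r !subr0 !mul1r => A3 A2 A1.
have -> : cexp h - 1 - h = (expR (Re h) - 1 - Re h)%:C * cis (Im h)
    + (cis (Im h) - 1 - 'i * (Im h)%:C) + (Re h)%:C * (cis (Im h) - 1).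
  by apply: eqC; rewrite !(ReD, ImD, ReN, ImN, ReM, ImM) /=; ring.
have B2 : nc (cis (Im h) - 1 - 'i * (Im h)%:C) <= 2 * (e / 4) * nc h.
  apply: le_trans (nc_ReIm _) _; rewrite /=.
  have -> : cos (Im h) - 1 - (0 * Im h - 1 * 0) = cos (Im h) - 1 by ring.
  have -> : sin (Im h) - 0 - (0 * 0 + 1 * Im h) = sin (Im h) - Im h by ring.
  have := ler_wpM2l (ltW e4) hI; lra.
have B3 : nc (cis (Im h) - 1) <= (2 * (e / 4) + 1) * nc h.
  have -> : cis (Im h) - 1 = (cis (Im h) - 1 - 'i * (Im h)%:C) + 'i * (Im h)%:C by ring.
  apply: le_trans (ncD _ _) _.
  have -> : nc ('i * (Im h)%:C) = `|Im h|.
    by rewrite ncM nc_real /= expr0n/= add0r expr1n sqrtr1 mul1r.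
  by rewrite mulrDl mul1r lerD.
have B4 : nc (cis (Im h) - 1) <= e / 4.
  apply: le_trans B3 _; rewrite mulrC -ler_pdivlMr//; exact: ltW.
apply: le_trans (ncD _ _) _; apply: le_trans (lerD (ncD _ _) (lexx _)) _.
rewrite !ncM !nc_real nc_cis mulr1.
have C1 : `|expR (Re h) - 1 - Re h| <= e / 4 * nc h.
  by apply: le_trans A1 _; rewrite ler_pM2l.
have C3 : `|Re h| * nc (cis (Im h) - 1) <= e / 4 * nc h.
  by rewrite mulrC; apply: ler_pM; rewrite ?nc_ge0.
have -> : e * nc h = e / 4 * nc h + 2 * (e / 4) * nc h + e / 4 * nc h by field.
by apply: lerD => //; apply: lerD.
Qed.

(** The parametrization that defines circle_mean. *)
Definition circ b s t : C := b + s * cos t +i* (s * sin t).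

Lemma circE b s t : circ b s t = b + s%:C * cis t.
Proof. by rewrite /circ; congr (_ + _); apply: eqC => /=; ring. Qed.

Lemma circ_dist b s t : nc (circ b s t - b) = `|s|.
Proof. by rewrite circE addrC addKr ncM nc_real nc_cis mulr1. Qed.

Lemma circ_cexp b x y : circ b (expR x) y = b + cexp (x +i* y).
Proof. by rewrite circE. Qed.

Lemma circ_2pi b s : circ b s (2 * pi) = circ b s 0.
Proof.
by rewrite /circ mulr_natl cos2pi sin2pi cos0 sin0.
Qed.

Lemma cont_circ b s t : {for t, continuous (circ b s : R -> C^o)}.
Proof.
rewrite /circ; apply: (@continuousD _ C^o); first exact: cst_continuous.
apply: cont_ReIm => /=.
  by apply: continuousM; [exact: cst_continuous|exact: continuous_cos].
by apply: continuousM; [exact: cst_continuous|exact: continuous_sin].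
Qed.

Definition cont_circle F b s :=
  forall w, nc (w - b) = s -> ccont F w.

Lemma ccont_circ F b s x y : 0 <= s -> cont_circle F b s ->
  ccont_on (fun t => F (circ b s t)) x y.
Proof.
move=> s0 cF t _; apply: (@continuous_comp _ C^o C^o (circ b s) F).
  exact: cont_circ.
have : ccont F (circ b s t) by apply: cF; rewrite circ_dist ger0_norm.
by rewrite ccontE.
Qed.

(** The normalized contour integral of G over |w - b| = s is the mean of
    G(w) (w - b), so contour integrals are handled as means of F over
    circles. *)
Definition cmean F b s : C :=
  ((2 * pi)^-1)%:C * cint (fun t => F (circ b s t)) 0 (2 * pi).

Lemma pi2_gt0 : 0 < 2 * pi :> R.
Proof. by rewrite mulr_gt0// pi_gt0. Qed.
Hint Resolve pi2_gt0 : core.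

Lemma pi2_ge0 : 0 <= 2 * pi :> R.
Proof. exact: ltW. Qed.
Hint Resolve pi2_ge0 : core.

Lemma eq_cmean F G b s : 0 <= s -> (forall w, nc (w - b) = s -> F w = G w) ->
  cmean F b s = cmean G b s.
Proof.
by move=> s0 FG; congr (_ * _); apply: eq_cint => t _; rewrite FG// circ_dist ger0_norm.
Qed.

Lemma cmeanD F G b s : 0 <= s -> cont_circle F b s -> cont_circle G b s ->
  cmean (fun w => F w + G w) b s = cmean F b s + cmean G b s.
Proof. by move=> s0 cF cG; rewrite -mulrDr -cintD//; exact: ccont_circ. Qed.

Lemma cmeanB F G b s : 0 <= s -> cont_circle F b s -> cont_circle G b s ->
  cmean (fun w => F w - G w) b s = cmean F b s - cmean G b s.
Proof. by move=> s0 cF cG; rewrite -mulrBr -cintB//; exact: ccont_circ. Qed.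

Lemma cmeanZ k F b s : 0 <= s -> cont_circle F b s ->
  cmean (fun w => k * F w) b s = k * cmean F b s.
Proof. by move=> s0 cF; rewrite /cmean cintZ 1?mulrCA//; exact: ccont_circ. Qed.

Lemma cmean_cst k b s : cmean (fun=> k) b s = k.
Proof.
rewrite /cmean cint_cst// subr0 mulrCA -rmorphM mulVf ?mulr1//.
by rewrite gt_eqF.
Qed.

Lemma cmean_le F b s (K : R) : 0 <= s -> cont_circle F b s ->
  (forall w, nc (w - b) = s -> nc (F w) <= K) -> nc (cmean F b s) <= 2 * K.
Proof.
move=> s0 cF FK; rewrite ncM nc_real ger0_norm ?invr_ge0// mulrC ler_pdivrMr//.
rewrite -[X in _ <= _ * X]subr0; apply: cint_le => //; first exact: ccont_circ.
by move=> t _; apply: FK; rewrite circ_dist ger0_norm.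
Qed.

(** Uniformity in t comes from the compactness of the parameter interval. *)
Lemma circ_radius_unif F b s e : 0 <= s -> cont_circle F b s -> 0 < e ->
  \forall s' \near s, forall t, 0 <= t <= 2 * pi ->
    nc (F (circ b s' t) - F (circ b s t)) < e.
Proof.
move=> s0 cF e0.
have /compact_near_coveringP := @segment_compact R 0 (2 * pi).
move=> /(_ _ (nbhs s) (fun s' t => nc (F (circ b s' t) - F (circ b s t)) < e)).
move=> /(_ _) H.
suff /H : forall t, `[0, 2 * pi]%classic t -> \forall t' \near t & s' \near s,
    nc (F (circ b s' t') - F (circ b s t')) < e.
  apply: filterS => s' Hs' t ht; apply: Hs' => /=; by rewrite in_itv.
move=> t _.
have /ccontP /(_ (e / 2) ltac:(lra)) [d d0 Hd] : ccont F (circ b s t).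
  by apply: cF; rewrite circ_dist ger0_norm.
have n1 : \forall t' \near t, nc (circ b s t' - circ b s t) < d / 2.
  have /contRCP := @cont_circ b s t; apply; lra.
have n2 : \forall s' \near s, `|s' - s| < d / 2.
  by apply/nbhs_ballP; exists (d / 2) => /=; [lra|move=> s' /=; rewrite distrC].
near=> t' s'.
have a1 : nc (circ b s t' - circ b s t) < d / 2 by near: t'.
have a2 : nc (circ b s' t' - circ b s t') < d / 2.
  have -> : circ b s' t' - circ b s t' = (s' - s)%:C * cis t'.
    by rewrite !circE rmorphB /=; ring.
  by rewrite ncM nc_cis nc_real mulr1; near: s'.
have b1 : nc (F (circ b s t') - F (circ b s t)) < e / 2 by apply: Hd; lra.
have b2 : nc (F (circ b s' t') - F (circ b s t)) < e / 2.
  apply: Hd; have := ncD (circ b s' t' - circ b s t') (circ b s t' - circ b s t).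
  by rewrite addrA subrK; lra.
have := ncD (F (circ b s' t') - F (circ b s t)) (F (circ b s t) - F (circ b s t')).
by rewrite addrA subrK (ncB (F (circ b s t))); lra.
Unshelve. all: by end_near. Qed.

Lemma cmean_cont F b s1 s2 s e : 0 <= s1 -> s1 <= s <= s2 ->
  (forall w, s1 <= nc (w - b) <= s2 -> ccont F w) ->
  0 < e ->
  \forall s' \near s, s1 <= s' <= s2 -> nc (cmean F b s' - cmean F b s) <= e.
Proof.
move=> s10 s12 cF e0; have s0 : 0 <= s by lra.
have cFs s' : s1 <= s' <= s2 -> cont_circle F b s'.
  by move=> h w e'; apply: cF; rewrite e'.
have := @circ_radius_unif F b s (e / 2) s0 (cFs _ s12) ltac:(lra).
apply: filterS => s' H hs'; have s'0 : 0 <= s' by lra.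
rewrite -mulrBr -cintB; [|by apply: ccont_circ => //; exact: cFs..].
rewrite ncM nc_real ger0_norm ?invr_ge0// mulrC ler_pdivrMr//.
have -> : e * (2 * pi) = 2 * (e / 2) * (2 * pi - 0) by field.
apply: cint_le => //.
  rewrite -/(ccont_on _ _ _) => t ht.
  by apply: (@continuousB _ C^o); apply: ccont_circ ht => //; exact: cFs.
by move=> t /H /ltW.
Qed.

(** In the coordinate w = b + exp z the annulus is a rectangle of height 2
    pi. Its horizontal sides cancel by periodicity, so that the theorem of
    Goursat equates the vertical ones, which are the two circles. *)
Lemma cmean_const_open F b s1 s2 : 0 < s1 -> s1 <= s2 ->
  (forall w, s1 <= nc (w - b) <= s2 -> hol F w) ->
  cmean F b s1 = cmean F b s2.
Proof.
move=> s10 s12 dF.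
pose Phi z := F (b + cexp z).
have lns : ln s1 <= ln s2 by rewrite ler_ln// posrE; lra.
have dPhi x y : ln s1 <= x <= ln s2 -> 0 <= y <= 2 * pi ->
    hol Phi (x +i* y).
  move=> /andP[x1 x2] _; rewrite holE; apply/derivable1_diffP.
  apply: (@differentiable_comp _ C^o C^o C^o (fun z => b + cexp z) F).
    apply: (@differentiableD _ C^o C^o); first exact: differentiable_cst.
    apply/derivable1_diffP; rewrite -(holE cexp); apply/holP.
    by exists (cexp (x +i* y)); exact: cexp_has_cderiv.
  apply/derivable1_diffP; rewrite -(holE F); apply: dF.
  rewrite -circ_cexp circ_dist ger0_norm ?expR_ge0//.
  have e1 : s1 = expR (ln s1) by rewrite lnK// posrE.
  have e2 : s2 = expR (ln s2) by rewrite lnK// posrE; lra.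
  by rewrite e1 e2 !ler_expR x1 x2.
have := goursat_rectangle lns pi2_ge0 dPhi; rewrite /rect_int.
have -> : cint (fun x => Phi (x +i* 0)) (ln s1) (ln s2) =
    cint (fun x => Phi (x +i* (2 * pi))) (ln s1) (ln s2).
  by apply: eq_cint => x _; rewrite /Phi -!circ_cexp circ_2pi.
rewrite [X in X - _]addrAC subrr add0r -mulrBr => /eqP; rewrite mulf_eq0 => /orP[/eqP[] /eqP|].
  by rewrite oner_eq0.
rewrite subr_eq0 => /eqP E; congr (_ * _); move: E.
have V s : 0 < s -> cint (fun y => Phi (ln s +i* y)) 0 (2 * pi) =
    cint (fun t => F (circ b s t)) 0 (2 * pi).
  by move=> s0; apply: eq_cint => t _; rewrite /Phi -circ_cexp lnK.
by rewrite !V//; lra.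
Qed.

(** Continuity of the mean in the radius extends the equality to circles
    on which F is only continuous, in particular to the degenerate circle
    of radius 0. *)
Theorem cmean_const F b s1 s2 : 0 <= s1 -> s1 <= s2 ->
  (forall w, s1 <= nc (w - b) <= s2 -> ccont F w) ->
  (forall w, s1 < nc (w - b) < s2 -> hol F w) ->
  cmean F b s1 = cmean F b s2.
Proof.
move=> s10 s12 cF dF; have [<-//|ne] := eqVneq s1 s2.
have {ne} lt12 : s1 < s2 by rewrite lt_neqAle ne.
have K t u : s1 < t < s2 -> s1 < u < s2 -> cmean F b t = cmean F b u.
  move=> ht hu; wlog tu : t u ht hu / t <= u.
    by move=> H; have [tu|/ltW tu] := leP t u; [|symmetry]; apply: H.
  move: ht hu => /andP[? ?] /andP[? ?].
  apply: cmean_const_open => //; first lra.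
  by move=> w /andP[? ?]; apply: dF; lra.
set m := (s1 + s2) / 2.
have M : s1 < m < s2 by rewrite /m; lra.
have lim s : s1 <= s <= s2 -> cmean F b s = cmean F b m.
  move=> hs; apply/eqP; rewrite -subr_eq0 -nc_eq0 eq_le nc_ge0 andbT.
  apply/ler_addgt0Pr => e e0; rewrite add0r ncB.
  have /nbhs_ballP [d d0 Hd] := cmean_cont s10 hs cF e0; have {}d0 : 0 < d := d0.
  pose l := d / (d + (s2 - s1)).
  have l01 : 0 < l < 1.
    by rewrite /l divr_gt0 ?ltr_pdivrMr; lra.
  have ld : l * (s2 - s1) < d.
    by rewrite /l mulrAC ltr_pdivrMr ?ltr_pM2l//; lra.
  (* the point s + l (m - s) is inside the open annulus and close to s *)
  pose t := s + l * (m - s).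
  have t1 : s1 < t < s2 by rewrite /t /m; apply/andP; split; nra.
  rewrite (K m t M t1); apply: Hd; last by lra.
  rewrite /ball /= /t opprD addrA subrr add0r normrN ltr_norml /m.
  by apply/andP; split; nra.
by rewrite (lim s1) ?(lim s2)//; lra.
Qed.

(** The circle of radius 0 is the center. Mere continuity at b is what
    admits difference quotients completed at b. *)
Theorem mean_value F b s : 0 <= s ->
  (forall w, nc (w - b) <= s -> ccont F w) ->
  (forall w, 0 < nc (w - b) < s -> hol F w) ->
  cmean F b s = F b.
Proof.
move=> s0 cF dF; rewrite -(@cmean_const F b 0 s)//; last first.
  by move=> w /andP[_]; exact: cF.
rewrite -[RHS](cmean_cst _ b 0); apply: eq_cmean => // w.
by move=> /Normc.eq0_normc /eqP; rewrite subr_eq0 => /eqP ->.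
Qed.

End CircleMean.

(** * The formula of Cauchy and removable singularities *)

#[local] Arguments Normc.normc {R} x : simpl never.
#[local] Arguments cmean {R} F b s : simpl never.

Section CauchyFormula.
Context {R : realType}.
Local Notation C := R[i].
Local Notation nc := (@Normc.normc R).
Implicit Types (F G g phi : C -> C) (a b z w : C) (s t : R).

Lemma has_cderiv_near F G z l (d : R) : 0 < d ->
  (forall w, nc (w - z) < d -> F w = G w) -> has_cderiv F z l -> has_cderiv G z l.
Proof.
move=> d0 FG H e e0; have [r r0 Hr] := H e e0.
exists (Num.min d r); first by rewrite lt_min d0.
move=> w; rewrite lt_min => /andP[wd wr].
by rewrite -FG// -FG ?subrr ?Normc.normc0//; exact: Hr.
Qed.

Lemma hol_near F G z (d : R) : 0 < d ->
  (forall w, nc (w - z) < d -> F w = G w) ->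
  hol F z -> hol G z.
Proof.
move=> d0 FG /holP [l H]; apply/holP; exists l.
exact: has_cderiv_near d0 FG H.
Qed.

Lemma ccont_near F G z (d : R) : 0 < d ->
  (forall w, nc (w - z) < d -> F w = G w) ->
  ccont F z -> ccont G z.
Proof.
move=> d0 FG /ccontP H; apply/ccontP => e e0; have [r r0 Hr] := H e e0.
exists (Num.min d r); first by rewrite lt_min d0.
move=> w; rewrite lt_min => /andP[wd wr].
by rewrite -FG// -FG ?subrr ?Normc.normc0//; exact: Hr.
Qed.

Definition dC F z : C := 'D_1 (F : C^o -> C^o) z.

Lemma has_cderiv_dC F z : hol F z -> has_cderiv F z (dC F z).
Proof. by rewrite holE => dF; apply/has_cderivP; split. Qed.

Lemma has_cderiv_dCE F z l : has_cderiv F z l -> dC F z = l.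
Proof. by move=> /has_cderivP []. Qed.

Lemma nc_sub_gt0 z w : (0 < nc (z - w)) = (z != w).
Proof. by rewrite nc_gt0 subr_eq0. Qed.

Definition dquot g a w : C := if w == a then dC g a else (g w - g a) / (w - a).

Lemma dquotE g a w : g w = g a + (w - a) * dquot g a w.
Proof.
rewrite /dquot; case: eqVneq => [->|wa]; first by rewrite subrr mul0r addr0.
by rewrite mulrC divfK ?subr_eq0// addrC subrK.
Qed.

Lemma dquot_near g a z w : nc (w - z) < nc (z - a) ->
  (g w - g a) / (w - a) = dquot g a w.
Proof.
move=> wz; rewrite /dquot ifN//; apply/eqP => wa; move: wz; rewrite wa.
by rewrite ncB ltxx.
Qed.

Lemma hol_dquot g a z : z != a -> hol g z ->
  hol (dquot g a) z.
Proof.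
move=> za dg; have za0 : 0 < nc (z - a) by rewrite nc_sub_gt0.
apply: (hol_near za0 (@dquot_near g a z)).
apply: holM.
  by apply: holB => //; exact: hol_cst.
by apply: holV; [exact: hol_sub|rewrite subr_eq0].
Qed.

Lemma ccont_dquot g a z : z != a -> ccont g z ->
  ccont (dquot g a) z.
Proof.
move=> za cg; have za0 : 0 < nc (z - a) by rewrite nc_sub_gt0.
apply: (ccont_near za0 (@dquot_near g a z)).
apply: ccontM.
  by apply: ccontB => //; exact: ccont_cst.
by apply: ccontV; [exact: ccont_sub|rewrite subr_eq0].
Qed.

Lemma ccont_dquot_at g a : hol g a ->
  ccont (dquot g a) a.
Proof.
move=> /has_cderiv_dC H; apply/ccontP => e e0.
have [d d0 Hd] := H (e / 2) ltac:(lra); exists d => // w wd.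
rewrite {2}/dquot eqxx /dquot; case: eqVneq => [_|wa].
  by rewrite subrr Normc.normc0.
have -> : (g w - g a) / (w - a) - dC g a = (g w - g a - dC g a * (w - a)) / (w - a).
  by field; rewrite subr_eq0.
have wa0 : 0 < nc (w - a) by rewrite nc_sub_gt0.
rewrite ncM ncV ltr_pdivrMr//; apply: le_lt_trans (Hd _ wd) _.
by rewrite ltr_pM2r//; lra.
Qed.

Lemma cmean_inv_inside b s z : nc (z - b) < s ->
  cmean (fun w => (w - z)^-1) b s = 0.
Proof.
move=> zs; have zb := nc_ge0 (z - b).
have far w : s <= nc (w - b) -> s - nc (z - b) <= nc (w - z).
  move=> ws; have := nc_triB (w - b) (z - b).
  have -> : w - b - (z - b) = w - z by ring.
  lra.
have nz w : s <= nc (w - b) -> w - z != 0.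
  by move=> /far ?; rewrite -nc_gt0; lra.
have dF w : s <= nc (w - b) -> hol (fun w => (w - z)^-1) w.
  by move=> /nz ?; apply: holV => //; exact: hol_sub.
apply/eqP; rewrite -nc_eq0 eq_le nc_ge0 andbT; apply/ler_addgt0Pr => e e0.
rewrite add0r; pose S := s + 2 / e.
have S0 : 0 < 2 / e by rewrite divr_gt0.
rewrite (@cmean_const _ _ _ s S); [|lra|rewrite /S; lra| |]; last 2 first.
- by move=> w /andP[ws _]; apply: hol_ccont; exact: dF.
- by move=> w /andP[ws _]; apply: dF; lra.
apply: (@le_trans _ _ (2 * (2 / e)^-1)); last first.
  by rewrite le_eqVlt; apply/orP; left; apply/eqP; field; lra.
apply: cmean_le; first by rewrite /S; lra.
  by move=> w ws; apply: hol_ccont; apply: dF; rewrite ws /S; lra.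
move=> w ws; rewrite ncV lef_pV2 ?posrE//.
  have := nc_triB (w - b) (z - b).
  have -> : w - b - (z - b) = w - z by ring.
  by rewrite ws /S; lra.
by rewrite nc_gt0; apply: nz; rewrite ws /S; lra.
Qed.

Lemma on_circle_ne b s z w : nc (z - b) != s -> nc (w - b) = s -> w - z != 0.
Proof. by move=> zs ws; apply: contraNneq zs => /subr0_eq <-; rewrite ws. Qed.

Lemma cont_circle_inv b s z : nc (z - b) != s -> cont_circle (fun w => (w - z)^-1) b s.
Proof.
move=> zs w ws; apply: ccontV; first exact: ccont_sub.
exact: on_circle_ne zs ws.
Qed.

Lemma cont_circleM F G b s : cont_circle F b s -> cont_circle G b s ->
  cont_circle (fun w => F w * G w) b s.
Proof. by move=> cF cG w ws; apply: ccontM; [exact: cF|exact: cG]. Qed.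

Lemma cont_circle_sub b s a : cont_circle (fun w => w - a) b s.
Proof. by move=> w _; exact: ccont_sub. Qed.

Lemma cont_circle_cst b s (k : C) : cont_circle (fun=> k) b s.
Proof. by move=> w _; exact: ccont_cst. Qed.

Lemma cmean_kernel_inside b s z : nc (z - b) < s ->
  cmean (fun w => (w - b) / (w - z)) b s = 1.
Proof.
move=> zs; have zb := nc_ge0 (z - b).
have zs' : nc (z - b) != s by rewrite lt_eqF.
have cI := cont_circle_inv zs'.
transitivity (cmean (fun w => 1 + (z - b) * (w - z)^-1) b s).
  apply: eq_cmean => [|w ws]; first lra.
  by field; exact: on_circle_ne zs' ws.
rewrite cmeanD; [|lra|exact: cont_circle_cst|]; last first.
  by apply: cont_circleM => //; exact: cont_circle_cst.
by rewrite cmean_cst cmeanZ ?cmean_inv_inside ?mulr0 ?addr0//; lra.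
Qed.

Lemma cmean_kernel_outside b s z : 0 <= s -> s < nc (z - b) ->
  cmean (fun w => (w - b) / (w - z)) b s = 0.
Proof.
move=> s0 zs.
have dF w : nc (w - b) <= s -> hol (fun w => (w - b) / (w - z)) w.
  move=> ws; apply: holM; first exact: hol_sub.
  apply: holV; first exact: hol_sub.
  by rewrite subr_eq0; apply: contraTneq ws => ->; rewrite -ltNge.
rewrite mean_value ?subrr ?mul0r//.
- by move=> w ws; apply: hol_ccont; exact: dF.
- by move=> w /andP[_ /ltW ws]; exact: dF.
Qed.

(** The difference quotient of phi at z, completed at z, is continuous on
    the annulus and holomorphic off z, so its mean is constant on either
    side of the circle through z, hence throughout. Splitting the quotient
    leaves the mean of the kernel, which is 1 on the circles around z and
    0 on the others. *)
Theorem cauchy_annulus phi b s1 s2 z : 0 <= s1 ->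
  (forall w, s1 <= nc (w - b) <= s2 -> ccont phi w) ->
  (forall w, s1 < nc (w - b) < s2 -> hol phi w) ->
  s1 < nc (z - b) < s2 ->
  phi z = cmean (fun w => phi w * ((w - b) / (w - z))) b s2
        - cmean (fun w => phi w * ((w - b) / (w - z))) b s1.
Proof.
move=> s10 cphi dphi hz; have /andP[z1 z2] := hz.
pose F w := dquot phi z w * (w - b).
have cF w : s1 <= nc (w - b) <= s2 -> ccont F w.
  move=> hw; apply: ccontM; last exact: ccont_sub.
  have [->|wz] := eqVneq w z; first by apply: ccont_dquot_at; exact: dphi.
  by apply: ccont_dquot => //; exact: cphi.
have dF w : s1 < nc (w - b) < s2 -> w != z -> hol F w.
  move=> hw wz; apply: holM; last exact: hol_sub.
  by apply: hol_dquot => //; exact: dphi.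
have E : cmean F b s1 = cmean F b s2.
  rewrite (@cmean_const _ F b s1 (nc (z - b)))//; [|lra| |]; last 2 first.
  - by move=> w /andP[? ?]; apply: cF; lra.
  - move=> w /andP[? wz]; apply: dF; first lra.
    by apply: contraTneq wz => ->; rewrite ltxx.
  apply: cmean_const => //; [lra|lra| |].
  - by move=> w /andP[? ?]; apply: cF; lra.
  - move=> w /andP[wz ?]; apply: dF; first lra.
    by apply: contraTneq wz => ->; rewrite ltxx.
have FE s : s1 <= s <= s2 -> nc (z - b) != s ->
    cmean F b s = cmean (fun w => phi w * ((w - b) / (w - z))) b s
      - phi z * cmean (fun w => (w - b) / (w - z)) b s.
  move=> hs zs; have s0 : 0 <= s by lra.
  have ck : cont_circle (fun w => (w - b) / (w - z)) b s.
    by apply: cont_circleM; [exact: cont_circle_sub|exact: cont_circle_inv].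
  have cp : cont_circle phi b s by move=> w ws; apply: cphi; rewrite ws.
  rewrite -cmeanZ// -cmeanB//; [|exact: cont_circleM|]; last first.
    by apply: cont_circleM => //; exact: cont_circle_cst.
  apply: eq_cmean => // w ws; have wz := on_circle_ne zs ws.
  rewrite /F /dquot ifN; last by rewrite -subr_eq0.
  by field.
have h1 : s1 <= s1 <= s2 by lra.
have h2 : s1 <= s2 <= s2 by lra.
move: E; rewrite (FE s1 h1 (negbT (gt_eqF z1))) (FE s2 h2 (negbT (lt_eqF z2))).
rewrite cmean_kernel_outside// cmean_kernel_inside// mulr0 subr0 mulr1 => ->.
by ring.
Qed.

(** At radius 0 the kernel vanishes, so the annulus formula has no inner
    term. The center itself is the case of the mean value property. *)
Theorem cauchy_disk phi b s z :
  (forall w, nc (w - b) <= s -> ccont phi w) ->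
  (forall w, 0 < nc (w - b) < s -> hol phi w) ->
  0 < nc (z - b) < s ->
  phi z = cmean (fun w => phi w * ((w - b) / (w - z))) b s.
Proof.
move=> cphi dphi hz.
rewrite (@cauchy_annulus phi b 0 s z)//; last by move=> w /andP[_]; exact: cphi.
rewrite [X in _ - X](_ : _ = 0) ?subr0// -[RHS](cmean_cst 0 b 0).
apply: eq_cmean => // w /Normc.eq0_normc ->.
by rewrite mul0r mulr0.
Qed.

Lemma circ_bounded F b s : 0 <= s -> cont_circle F b s ->
  exists2 B, 0 <= B & forall t, 0 <= t <= 2 * pi -> nc (F (circ b s t)) <= B.
Proof.
move=> s0 cF.
have c t : 0 <= t <= 2 * pi -> {for t, continuous (fun t => nc (F (circ b s t)))}.
  move=> ht; have /contRCP H := ccont_circ s0 cF ht.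
  apply/cvgrPdist_lt => e e0; apply: filterS (H e e0) => u.
  apply: le_lt_trans; rewrite ler_norml.
  have := nc_triB (F (circ b s u)) (F (circ b s t)).
  have := nc_triB (F (circ b s t)) (F (circ b s u)).
  by rewrite (ncB (F (circ b s t))); lra.
have [m _ Hm] := @EVT_max R (fun t => nc (F (circ b s t))) _ _ (@pi2_ge0 R) ltac:(
  apply: continuous_in_subspaceT => t; rewrite inE /= in_itv /=; exact: c).
exists (nc (F (circ b s m))) => [|t ht]; first exact: nc_ge0.
by apply: Hm; rewrite in_itv.
Qed.

Lemma cmean_le_circ F b s (K : R) : 0 <= s -> cont_circle F b s ->
  (forall t, 0 <= t <= 2 * pi -> nc (F (circ b s t)) <= K) -> nc (cmean F b s) <= 2 * K.
Proof.
have p0 := @pi2_gt0 R; have p1 := @pi2_ge0 R.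
move=> s0 cF FK; rewrite /cmean ncM nc_real ger0_norm ?invr_ge0// mulrC ler_pdivrMr//.
rewrite -[X in _ <= _ * X]subr0; apply: cint_le => //; exact: ccont_circ.
Qed.

(** Differentiation under the mean, when the integrand has a second-order
    remainder that is uniform on the circle. *)
Lemma cmean_param_cderiv (k : C -> C -> C) (k1 : C -> C) b s z (B d : R) :
  0 <= s -> 0 < d -> 0 <= B ->
  (forall z', nc (z' - z) < d -> cont_circle (k z') b s) ->
  cont_circle k1 b s ->
  (forall z' t, nc (z' - z) < d -> 0 <= t <= 2 * pi -> let w := circ b s t in
     nc (k z' w - k z w - (z' - z) * k1 w) <= B * nc (z' - z) ^+ 2) ->
  has_cderiv (fun z' => cmean (k z') b s) z (cmean k1 b s).
Proof.
move=> s0 d0 B0 ck ck1 H e e0.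
exists (Num.min d (e / (2 * B + 1))); first by rewrite lt_min d0 divr_gt0//; lra.
move=> z'; rewrite lt_min => /andP[z'd z'e].
have ckz : cont_circle (k z) b s by apply: ck; rewrite subrr Normc.normc0.
have ckk : cont_circle (fun w => k z' w - k z w) b s.
  move=> w ws; by apply: ccontB; [exact: ck ws|exact: ckz].
have cz1 : cont_circle (fun w => (z' - z) * k1 w) b s.
  by apply: cont_circleM => //; exact: cont_circle_cst.
rewrite [_ * (z' - z)]mulrC -cmeanZ// -cmeanB//; last exact: ck.
rewrite -cmeanB//.
apply: (@le_trans _ _ (2 * (B * nc (z' - z) ^+ 2))).
  apply: cmean_le_circ => //; last by move=> t ht; exact: H.
  by move=> w ws; apply: ccontB; [exact: ckk|exact: cz1].
rewrite mulrA expr2 mulrA; apply: ler_wpM2r; first exact: nc_ge0.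
have : nc (z' - z) * (2 * B + 1) < e by rewrite -ltr_pdivlMr//; lra.
have := nc_ge0 (z' - z); nra.
Qed.

Section CauchyTypeIntegral.
Variables (phi : C -> C) (b : C) (s : R).
Hypotheses (s0 : 0 <= s) (cphi : cont_circle phi b s).

(** Away from the circle the kernel is uniformly invertible, which is what
    makes the second-order remainders below uniform in w. *)
Lemma off_circle z : nc (z - b) != s -> exists2 d, 0 < d &
  forall z' t, nc (z' - z) < d -> [/\ nc (z' - b) != s,
    circ b s t - z' != 0 & nc (circ b s t - z')^-1 <= d^-1].
Proof.
move=> zs; pose d := `|nc (z - b) - s| / 2.
have d0 : 0 < d by rewrite divr_gt0// normr_gt0 subr_eq0.
have dd z' : nc (z' - z) < d -> d <= `|nc (z' - b) - s|.
  move=> zz; have h1 := nc_triB (z' - b) (z - b).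
  have h2 := nc_triB (z - b) (z' - b).
  have e1 : z' - b - (z - b) = z' - z by ring.
  have e2 : z - b - (z' - b) = - (z' - z) by ring.
  rewrite e1 in h1; rewrite e2 ncN in h2.
  have : 2 * d = `|nc (z - b) - s| by rewrite /d; field.
  have := ler_distD (nc (z' - b)) (nc (z - b)) s.
  have : `|nc (z - b) - nc (z' - b)| < d by rewrite ltr_norml; lra.
  by lra.
exists d => // z' t zz.
have f : d <= nc (circ b s t - z').
  apply: le_trans (dd _ zz) _.
  have cd : nc (circ b s t - b) = s by rewrite circ_dist ger0_norm.
  have h1 := nc_triB (z' - b) (circ b s t - b).
  have h2 := nc_triB (circ b s t - b) (z' - b).
  have e1 : z' - b - (circ b s t - b) = - (circ b s t - z') by ring.
  have e2 : circ b s t - b - (z' - b) = circ b s t - z' by ring.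
  rewrite e1 ncN cd in h1; rewrite e2 cd in h2.
  by rewrite ler_norml; lra.
split.
- by rewrite -subr_eq0 -normr_gt0; apply: lt_le_trans (dd _ zz).
- by rewrite -nc_gt0; apply: lt_le_trans f.
- by rewrite ncV lef_pV2 ?posrE//; apply: lt_le_trans f.
Qed.

Lemma cauchy_type_cderiv z : nc (z - b) != s ->
  has_cderiv (fun z => cmean (fun w => phi w * (w - z)^-1) b s) z
             (cmean (fun w => phi w * (w - z)^-1 ^+ 2) b s).
Proof.
move=> zs; have [d d0 Hd] := off_circle zs; have [B B0 HB] := circ_bounded s0 cphi.
have iv0 : 0 <= d^-1 by rewrite invr_ge0 ltW.
apply: (@cmean_param_cderiv _ _ b s z (B * (d^-1 ^+ 2 * d^-1)) d) => //.
- by rewrite !mulr_ge0 ?exprn_ge0.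
- move=> z' z'd; have [h _ _] := Hd z' 0 z'd.
  by apply: cont_circleM => //; exact: cont_circle_inv.
- by apply: cont_circleM => //; apply: cont_circleM; exact: cont_circle_inv.
move=> z' t z'd ht; set w := circ b s t; rewrite /=.
have [_ n1 b1] := Hd z' t z'd.
have [_ n2 b2] := Hd z t ltac:(by rewrite subrr Normc.normc0).
have -> : phi w / (w - z') - phi w / (w - z) - (z' - z) * (phi w * (w - z)^-1 ^+ 2)
    = phi w * ((w - z)^-1 ^+ 2 * (w - z')^-1) * (z' - z) ^+ 2.
  by rewrite -/w in n1 n2; field; rewrite n1 n2.
rewrite !(ncX, ncM); apply: ler_wpM2r; first by rewrite exprn_ge0 ?nc_ge0.
apply: ler_pM; rewrite ?nc_ge0 ?mulr_ge0 ?exprn_ge0 ?nc_ge0//; first exact: HB.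
apply: ler_pM b1; rewrite ?exprn_ge0 ?nc_ge0//.
by apply: lerXn2r b2; rewrite nnegrE ?nc_ge0.
Qed.

Lemma cauchy_type_cderiv2 z : nc (z - b) != s ->
  hol (fun z => cmean (fun w => phi w * (w - z)^-1 ^+ 2) b s) z.
Proof.
move=> zs; have [d d0 Hd] := off_circle zs; have [B B0 HB] := circ_bounded s0 cphi.
have iv0 : 0 <= d^-1 by rewrite invr_ge0 ltW.
apply/holP; exists (cmean (fun w => phi w * (2 * (w - z)^-1 ^+ 3)) b s).
apply: (@cmean_param_cderiv _ _ b s z (B * (d^-1 ^+ 2 * d^-1 * (3 * d^-1))) d) => //.
- by rewrite !mulr_ge0 ?exprn_ge0.
- move=> z' z'd; have [h _ _] := Hd z' 0 z'd.
  by apply: cont_circleM => //; apply: cont_circleM; exact: cont_circle_inv.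
- apply: cont_circleM => //; apply: cont_circleM; first exact: cont_circle_cst.
  by apply: cont_circleM; [|apply: cont_circleM]; exact: cont_circle_inv.
move=> z' t z'd ht; set w := circ b s t; rewrite /=.
have [_ n1 b1] := Hd z' t z'd.
have [_ n2 b2] := Hd z t ltac:(by rewrite subrr Normc.normc0).
have -> : phi w * (w - z')^-1 ^+ 2 - phi w * (w - z)^-1 ^+ 2
      - (z' - z) * (phi w * (2 * (w - z)^-1 ^+ 3))
    = phi w * ((w - z)^-1 ^+ 2 * (w - z')^-1 * ((w - z')^-1 + 2 * (w - z)^-1))
      * (z' - z) ^+ 2.
  by rewrite -/w in n1 n2; field; rewrite n1 n2.
rewrite !(ncX, ncM); apply: ler_wpM2r; first by rewrite exprn_ge0 ?nc_ge0.
apply: ler_pM; rewrite ?nc_ge0 ?mulr_ge0 ?exprn_ge0 ?nc_ge0//; first exact: HB.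
apply: ler_pM; rewrite ?mulr_ge0 ?exprn_ge0 ?nc_ge0//.
  apply: ler_pM b1; rewrite ?exprn_ge0 ?nc_ge0//.
  by apply: lerXn2r b2; rewrite nnegrE ?nc_ge0.
apply: le_trans (ncD _ _) _; rewrite ncM.
have := @nc_real R 2%:R; rewrite rmorph_nat normr_nat => ->.
by rewrite -/w in b1 b2; lra.
Qed.

End CauchyTypeIntegral.

(** Near z, G is an integral of Cauchy type, and such an integral can be
    differentiated twice. *)
Lemma hol_dC G z (r : R) : 0 < r ->
  (forall w, nc (w - z) < r -> hol G w) -> hol (dC G) z.
Proof.
move=> r0 dG; pose s := r / 2; have s0 : 0 < s by rewrite /s; lra.
have cG w : nc (w - z) <= s -> ccont G w.
  by move=> ws; apply: hol_ccont; apply: dG; rewrite /s in ws; lra.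
pose phi w := G w * (w - z).
have cphi : cont_circle phi z s.
  by apply: cont_circleM; [move=> w ws; apply: cG; rewrite ws|exact: cont_circle_sub].
have E v : nc (v - z) < s -> G v = cmean (fun w => phi w * (w - v)^-1) z s.
  move=> vs; have [->|vz] := eqVneq v z.
    rewrite -(@mean_value _ G z s)//; [|exact: ltW|]; last first.
      by move=> w /andP[_ ws]; apply: dG; rewrite /s in ws; lra.
    apply: eq_cmean => [|w ws]; first exact: ltW.
    rewrite /phi mulfK// subr_eq0; apply/eqP => wz.
    by move: ws; rewrite wz subrr Normc.normc0 => ws; rewrite -ws ltxx in s0.
  rewrite (@cauchy_disk G z s)//; last 2 first.
  - by move=> w /andP[_ ws]; apply: dG; rewrite /s in ws; lra.
  - by rewrite nc_sub_gt0 vz.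
  by apply: eq_cmean => [|w ws]; [exact: ltW|rewrite /phi mulrA].
have E' v : nc (v - z) < s -> cmean (fun w => phi w * (w - v)^-1 ^+ 2) z s = dC G v.
  move=> vs; symmetry; apply: has_cderiv_dCE.
  have s' : 0 < s - nc (v - z) by lra.
  apply: (has_cderiv_near s') (cauchy_type_cderiv (ltW s0) cphi _).
    move=> w wv; symmetry; apply: E.
    have := ncD (w - v) (v - z); rewrite addrA subrK; lra.
  by rewrite lt_eqF.
apply: (hol_near s0 E'); apply: cauchy_type_cderiv2 => //; first exact: ltW.
by rewrite subrr Normc.normc0 lt_eqF.
Qed.

(** Riemann's removable singularity theorem, for the singularity of a
    difference quotient: Cauchy's formula on a circle around a represents the
    quotient by an integral that is differentiable at a as well. *)
Lemma hol_dquot_at g a (r : R) : 0 < r ->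
  (forall w, nc (w - a) < r -> hol g w) -> hol (dquot g a) a.
Proof.
move=> r0 dg; pose s := r / 2; have s0 : 0 < s by rewrite /s; lra.
have cq w : nc (w - a) <= s -> ccont (dquot g a) w.
  move=> ws; have hw : hol g w by apply: dg; rewrite /s in ws; lra.
  have [e|wa] := eqVneq w a; first by rewrite e in hw *; exact: ccont_dquot_at.
  by apply: ccont_dquot => //; exact: hol_ccont.
have dq w : 0 < nc (w - a) < s -> hol (dquot g a) w.
  move=> /andP[wa ws]; apply: hol_dquot; first by rewrite -nc_sub_gt0.
  by apply: dg; rewrite /s in ws; lra.
pose phi w := dquot g a w * (w - a).
have cphi : cont_circle phi a s.
  by apply: cont_circleM; [move=> w ws; apply: cq; rewrite ws|exact: cont_circle_sub].
have E v : nc (v - a) < s -> cmean (fun w => phi w * (w - v)^-1) a s = dquot g a v.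
  move=> vs; have [->|va] := eqVneq v a.
    rewrite -(@mean_value _ (dquot g a) a s)//; last exact: ltW.
    apply: eq_cmean => [|w ws]; first exact: ltW.
    rewrite /phi mulfK// subr_eq0; apply/eqP => wa.
    by move: ws; rewrite wa subrr Normc.normc0 => ws; rewrite -ws ltxx in s0.
  rewrite (@cauchy_disk (dquot g a) a s v)//; last by rewrite nc_sub_gt0 va.
  by apply: eq_cmean => [|w ws]; [exact: ltW|rewrite /phi mulrA].
apply: (hol_near s0 E); apply/holP; eexists; apply: cauchy_type_cderiv => //.
  exact: ltW.
by rewrite subrr Normc.normc0 lt_eqF.
Qed.

(** The factor 2 is that of cmean_le_circ; a bound of the form constant
    times the maximum on the circle is enough for flat_zero. *)
Lemma cauchy_bound g a (s M : R) z :
  (forall w, nc (w - a) <= s -> hol g w) ->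
  (forall t, 0 <= t <= 2 * pi -> nc (g (circ a s t)) <= M) ->
  0 < nc (z - a) < s -> nc (g z) <= 2 * (M * (s / (s - nc (z - a)))).
Proof.
move=> dg gM hz; have /andP[z0 zs] := hz; have s0 : 0 <= s by lra.
rewrite (@cauchy_disk g a s z)//; last 2 first.
- by move=> w ws; apply: hol_ccont; exact: dg.
- by move=> w /andP[_ /ltW ws]; exact: dg.
apply: cmean_le_circ => //.
  apply: cont_circleM; first by move=> w ws; apply: hol_ccont; apply: dg; rewrite ws.
  by apply: cont_circleM; [exact: cont_circle_sub|apply: cont_circle_inv; rewrite lt_eqF].
move=> t ht; rewrite !ncM ncV circ_dist ger0_norm//.
apply: ler_pM; rewrite ?nc_ge0 ?mulr_ge0 ?invr_ge0 ?nc_ge0//; first exact: gM.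
have h := nc_triB (circ a s t - a) (z - a).
have e : circ a s t - a - (z - a) = circ a s t - z by ring.
rewrite e circ_dist ger0_norm// in h.
by rewrite ler_wpM2l// lef_pV2 ?posrE; lra.
Qed.

End CauchyFormula.

(** * Zeros of holomorphic functions *)

Section Zeros.
Context {R : realType}.
Local Notation C := R[i].
Local Notation nc := (@Normc.normc R).
Implicit Types (F G g h : C -> C) (a b z w : C) (s t r : R).

(** The Cauchy bound for h and g = (w - a)^m h give |g(z)| <= B (u / s)^m
    for every m, where u = |z - a| < s. *)
Lemma flat_zero g a r : 0 < r -> (forall w, nc (w - a) < r -> hol g w) ->
  (forall m, exists2 h, (forall w, nc (w - a) < r -> hol h w) &
     forall w, nc (w - a) < r -> g w = (w - a) ^+ m * h w) ->
  forall z, nc (z - a) < r -> g z = 0.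
Proof.
move=> r0 dg H z zr; have [->|za] := eqVneq z a.
  have [h _ ->] := H 1%N; first by rewrite subrr expr1 mul0r.
  by rewrite subrr Normc.normc0.
have z0 : 0 < nc (z - a) by rewrite nc_sub_gt0.
set u := nc (z - a) in zr z0.
pose s := (u + r) / 2; have s0 : 0 < s by rewrite /s; lra.
have us : u < s by rewrite /s; lra.
have [M M0 HM] : exists2 M, 0 <= M &
    forall t, 0 <= t <= 2 * pi -> nc (g (circ a s t)) <= M.
  apply: circ_bounded; first exact: ltW.
  by move=> w ws; apply: hol_ccont; apply: dg; rewrite ws /s; lra.
pose B := 2 * (M * (s / (s - u))).
have B0 : 0 <= B by rewrite /B !mulr_ge0 ?invr_ge0; lra.
have bound m : nc (g z) <= B * (u / s) ^+ m.
  have [h dh E] := H m; rewrite E// ncM ncX -/u.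
  have := @cauchy_bound _ h a s (M / s ^+ m) z.
  move=> /(_ _ _ _) Hb; apply: le_trans (ler_wpM2l _ (Hb _ _ _)) _.
  - by rewrite exprn_ge0 ?ltW.
  - by move=> w ws; apply: dh; rewrite /s in ws; lra.
  - move=> t ht; rewrite ler_pdivlMr ?exprn_gt0//; apply: le_trans (HM t ht).
    rewrite E ?ncM ?ncX circ_dist ger0_norm; try by rewrite ?(ltW s0)//.
      by rewrite mulrC.
    by rewrite /s; lra.
  - by rewrite -/u z0 us.
  rewrite -/u le_eqVlt; apply/orP; left; apply/eqP; rewrite /B [(u / s) ^+ m]expr_div_n.
  have X0 : s ^+ m != 0 by rewrite expf_neq0 ?gt_eqF.
  move: (s ^+ m) (u ^+ m) X0 => X Y X0. field; rewrite X0 /=; lra.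
have q0 : 0 <= u / s by apply: divr_ge0; exact: ltW.
have q1 : `|u / s| < 1 by rewrite (ger0_norm q0) ltr_pdivrMr// mul1r.
apply: Normc.eq0_normc; apply/eqP; rewrite eq_le nc_ge0 andbT.
apply/ler_addgt0Pr => e e0; rewrite add0r.
have e1 : 0 < e / (B + 1) by rewrite divr_gt0//; lra.
have /cvgrPdist_lt /(_ _ e1) [N _ /(_ N (leqnn _))] := cvg_expr q1.
rewrite /= sub0r normrN ger0_norm ?exprn_ge0// => HN.
apply: le_trans (bound N) _.
have : (u / s) ^+ N * (B + 1) < e by rewrite -ltr_pdivlMr//; lra.
have : 0 <= (u / s) ^+ N by rewrite exprn_ge0.
nra.
Qed.

(** If no such factorization existed, dividing by w - a could be repeated
    forever, each quotient being holomorphic at a, and g would be flat at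
    a. *)
Lemma order_on_disk g a r : 0 < r -> (forall w, nc (w - a) < r -> hol g w) ->
  (exists2 z, nc (z - a) < r & g z != 0) ->
  exists m h, [/\ forall w, nc (w - a) < r -> hol h w, h a != 0 &
    forall w, nc (w - a) < r -> g w = (w - a) ^+ m * h w].
Proof.
move=> r0 dg [z zr gz]; apply: contrapT => H; move/eqP: gz; apply.
apply: (flat_zero r0 dg) zr; elim=> [|m [h dh E]].
  by exists g => // w _; rewrite expr0 mul1r.
have ha : h a = 0.
  by apply/eqP/negPn/negP => ha; apply: H; exists m, h.
exists (dquot h a) => [w wr|w wr]; last first.
  by rewrite E// (dquotE h a w) ha add0r exprSr mulrA.
have [->|wa] := eqVneq w a; first exact: hol_dquot_at r0 dh.
by apply: hol_dquot => //; exact: dh.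
Qed.

Lemma has_orderP g a m : has_order g a m <-> exists2 r, 0 < r &
  exists h, [/\ forall w, nc (w - a) < r -> hol h w, h a != 0 &
    forall w, nc (w - a) < r -> g w = (w - a) ^+ m * h w].
Proof.
split=> [[h [/nbhsCP [r r0 Hr] ha /nbhsCP [d d0 Hd]]]|[r r0 [h [dh ha E]]]].
  exists (Num.min r d); first by rewrite lt_min r0.
  exists h; split=> // w; rewrite lt_min => /andP[wr wd]; last exact: Hd.
  by rewrite holE; exact: Hr.
exists h; split=> //; apply/nbhsCP; exists r => // w wr.
by rewrite -holE; exact: dh.
Qed.

Lemma isolated_zero g a r : 0 < r -> (forall w, nc (w - a) < r -> hol g w) ->
  (exists2 z, nc (z - a) < r & g z != 0) ->
  exists2 d, 0 < d & forall w, 0 < nc (w - a) < d -> g w != 0.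
Proof.
move=> r0 dg gz; have [m [h [dh ha E]]] := order_on_disk r0 dg gz.
have : ccont h a by apply: hol_ccont; apply: dh; rewrite subrr Normc.normc0.
move=> /ccontP /(_ (nc (h a))); rewrite nc_gt0 => /(_ ha) [d d0 Hd].
exists (Num.min r d); first by rewrite lt_min r0.
move=> w /andP[wa]; rewrite lt_min => /andP[wr wd].
rewrite E// mulf_neq0//; first by rewrite expf_neq0// -nc_gt0.
apply: contraTneq (Hd w wd) => ->.
by rewrite sub0r ncN ltxx.
Qed.

Definition zero_near g z := exists2 d, 0 < d & forall w, nc (w - z) < d -> g w = 0.

(** The parameters up to which g vanishes near the segment form an
    interval starting at 0. It is closed because zeros that are not
    isolated force vanishing on a disk, and relatively open by definition,
    hence it is all of [0, 1]. *)
Lemma zero_near_segment g p q :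
  (forall t, 0 <= t <= 1 -> exists2 r, 0 < r &
     forall w, nc (w - (p + t%:C * (q - p))) < r -> hol g w) ->
  zero_near g p -> zero_near g q.
Proof.
move=> dg gp; pose ga (t : R) : C := p + t%:C * (q - p).
have gad t u : nc (ga t - ga u) = `|t - u| * nc (q - p).
  have -> : ga t - ga u = (t - u)%:C * (q - p) by rewrite /ga rmorphB /=; ring.
  by rewrite ncM nc_real.
pose A : set R := [set t | 0 <= t <= 1 /\ forall s, 0 <= s <= t -> zero_near g (ga s)].
have A0 : A 0.
  split=> [|s s0]; first by rewrite lexx ler01.
  by have -> : ga s = p by rewrite /ga (_ : s = 0) ?mul0r ?addr0//; lra.
have hA : has_sup A by split; [exists 0|exists 1 => t [/andP[]]].
pose T := sup A.
have T01 : 0 <= T <= 1.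
  rewrite (sup_upper_bound hA)//=; apply: sup_le_ub; first by exists 0.
  by move=> t [/andP[]].
have AT s : 0 <= s < T -> zero_near g (ga s).
  move=> /andP[s0 sT]; have [t At st] := sup_adherent (eps := T - s) ltac:(lra) hA.
  by case: At => _; apply; rewrite -/T in st; lra.
have [r r0 Hr] := dg T T01; rewrite -/(ga T) in Hr.
pose L := nc (q - p) + 1; have L0 : 0 < L by rewrite /L; have := nc_ge0 (q - p); lra.
have gT : zero_near g (ga T).
  have [gz|nz] := pselect (forall z, nc (z - ga T) < r -> g z = 0); first by exists r.
  have [z zr gz] : exists2 z, nc (z - ga T) < r & g z != 0.
    apply: contrapT => H; apply: nz => z zr; apply/eqP/negPn/negP => gz.
    by apply: H; exists z.
  have [d d0 Hd] := isolated_zero r0 Hr (ex_intro2 _ _ z zr gz).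
  have [T0|T0] := eqVneq T 0; first by have [_ H0] := A0; rewrite T0; apply: H0; rewrite lexx.
  (* a parameter s < T for which ga s lies in the punctured disk; near ga s
     the function vanishes *)
  pose s := Num.max 0 (T - d / (2 * L)).
  have dL : 0 < d / (2 * L) by rewrite divr_gt0// mulr_gt0.
  have sT : 0 <= s < T by rewrite /s le_max lexx /= gt_max; lra.
  have [e e0 He] := AT s sT.
  have sd : nc (ga s - ga T) < d.
    rewrite gad; have Ts : `|s - T| <= d / (2 * L).
      have : T - d / (2 * L) <= s by rewrite /s le_max lexx orbT.
      by rewrite ler_norml; lra.
    have : d / (2 * L) * nc (q - p) < d.
      rewrite mulrAC ltr_pdivrMr ?mulr_gt0// ltr_pM2l// /L.
      by have := nc_ge0 (q - p); lra.
    apply: le_lt_trans; apply: ler_wpM2r => //; exact: nc_ge0.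
  have [w we wT] : exists2 w, nc (w - ga s) < Num.min e (d - nc (ga s - ga T)) & w != ga T.
    have [sTe|] := eqVneq (ga s) (ga T); last first.
      by move=> ne; exists (ga s) => //; rewrite subrr Normc.normc0 lt_min e0; lra.
    pose x := Num.min e (d - nc (ga s - ga T)).
    have x0 : 0 < x by rewrite /x lt_min e0; lra.
    exists (ga s + (x / 2)%:C).
      by rewrite addrC addKr nc_real ger0_norm; rewrite -/x; lra.
    by rewrite -sTe -subr_eq0 addrC addKr -nc_eq0 nc_real normr_eq0; lra.
  move: we; rewrite lt_min => /andP[we wd].
  have : g w != 0.
    apply: Hd; rewrite nc_sub_gt0 wT /=.
    have := ncD (w - ga s) (ga s - ga T); rewrite addrA subrK; lra.
  by rewrite He// eqxx.
have ATT : A T.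
  split=> // s /andP[s0]; rewrite le_eqVlt => /orP[/eqP->//|sT].
  by apply: AT; lra.
have [T1|T1] := eqVneq T 1.
  by move: gT; rewrite T1 /ga mul1r addrC subrK.
have {}T1 : T < 1 by case/andP: T01 => _; rewrite le_eqVlt (negbTE T1).
have [e e0 He] := gT.
pose t := Num.min 1 (T + e / (2 * L)).
have eL : 0 < e / (2 * L) by rewrite divr_gt0// mulr_gt0.
have Tt : T < t by rewrite /t lt_min T1; lra.
have t1 : t <= 1 by rewrite /t ge_min lexx.
suff : A t by move=> /(sup_upper_bound hA); rewrite -/T leNgt Tt.
split=> [|s /andP[s0 st]]; first by lra.
have [sT|Ts] := leP s T; first by case: ATT => _; apply; rewrite s0.
have sd : nc (ga s - ga T) < e.
  rewrite gad; have sT' : `|s - T| <= e / (2 * L).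
    rewrite ger0_norm; last lra.
    have : t <= T + e / (2 * L) by rewrite /t ge_min lexx orbT.
    lra.
  have : e / (2 * L) * nc (q - p) < e.
    rewrite mulrAC ltr_pdivrMr ?mulr_gt0// ltr_pM2l// /L.
    by have := nc_ge0 (q - p); lra.
  apply: le_lt_trans; apply: ler_wpM2r => //; exact: nc_ge0.
exists (e - nc (ga s - ga T)); first lra.
move=> w wd; apply: He.
have := ncD (w - ga s) (ga s - ga T); rewrite addrA subrK; lra.
Qed.

Lemma compact_box (S : R) :
  compact ([set z | `|complex.Re z| <= S /\ `|complex.Im z| <= S] : set C^o).
Proof.
pose f (p : R * R) : C^o := p.1 +i* p.2.
have -> : [set z : C^o | `|complex.Re z| <= S /\ `|complex.Im z| <= S] =
    f @` (`[- S, S]%classic `*` `[- S, S]%classic).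
  apply/seteqP; split=> [[x y] /= [hx hy]|_ [[x y] /= [hx hy] <-]] /=.
    by exists (x, y) => //=; rewrite !in_itv /= -!ler_norml.
  by move: hx hy; rewrite !in_itv /= -!ler_norml.
apply: continuous_compact; last by apply: compact_setX; exact: segment_compact.
apply: continuous_subspaceT => -[x y].
move=> A /nbhsCP [e e0 He].
apply/nbhs_ballP; exists (e / 2) => /=; first lra.
move=> [a b] [/= ax bY]; apply: He; apply: le_lt_trans (nc_ReIm _) _.
by rewrite /= (splitr e) ltrD// distrC.
Qed.

(** Every point of the box |Re|, |Im| <= S has a disk with at most one
    zero in K, its center; finitely many such disks cover the box. *)
Lemma finite_zeros g (K : set C) (S : R) :
  (forall z, K z -> nc z <= S) ->
  (forall z, ~ K z -> exists2 d, 0 < d & forall w, nc (w - z) < d -> ~ K w) ->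
  (forall a, K a -> exists2 d, 0 < d & forall w, 0 < nc (w - a) < d -> g w != 0) ->
  exists s : seq C, [/\ uniq s, forall a, a \in s -> K a /\ g a = 0 &
     forall a, K a -> g a = 0 -> a \in s].
Proof.
move=> KS Kc Ki.
have : forall a, exists d, 0 < d /\
    forall w, 0 < nc (w - a) < d -> K w -> g w != 0.
  move=> a; have [/Ki [d d0 H]|/Kc [d d0 H]] := pselect (K a).
    by exists d; split=> // w wd _; exact: H.
  by exists d; split=> // w /andP[_ wd] /(H _ wd).
move=> /choice [d Hd].
have := @compact_box S; rewrite compact_cover => cB.
have [|z Hz|D _ HD] := cB C setT (fun a => [set w | nc (w - a) < d a] : set C^o).
- move=> a _; rewrite openE => w /= wa; apply/nbhsCP.
  exists (d a - nc (w - a)); first by lra.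
  by move=> v vw /=; have := ncD (v - w) (w - a); rewrite addrA subrK; lra.
- by exists z => //=; rewrite subrr Normc.normc0; case: (Hd z).
exists [seq a <- undup (finmap.enum_fset D) | `[<K a>] && (g a == 0)]; split.
- exact/filter_uniq/undup_uniq.
- by move=> a; rewrite mem_filter => /andP[/andP[/asboolP Ka /eqP ga] _].
move=> a Ka ga; rewrite mem_filter asboolT// ga eqxx /= mem_undup.
have [|b bD /= ab] := HD a.
  by split; apply: le_trans (KS _ Ka); [exact: nc_Re|exact: nc_Im].
have [->//|ne] := eqVneq a b.
have [_ /(_ a)] := Hd b; rewrite nc_sub_gt0 ne ab => /(_ isT Ka).
by rewrite ga eqxx.
Qed.

Definition root_prod (s : seq C) (m : C -> nat) z := \prod_(a <- s) (z - a) ^+ m a.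

Lemma holX F n z : hol F z -> hol (fun w => F w ^+ n) z.
Proof.
move=> dF; elim: n => [|n IH].
  have -> : (fun w => F w ^+ 0) = (fun=> 1) by apply/funext => w; rewrite expr0.
  exact: hol_cst.
have -> : (fun w => F w ^+ n.+1) = (fun w => F w * F w ^+ n).
  by apply/funext => w; rewrite exprS.
exact: holM.
Qed.

Lemma hol_prod (I : Type) (s : seq I) (P : I -> C -> C) z :
  (forall i, hol (P i) z) -> hol (fun w => \prod_(i <- s) P i w) z.
Proof.
move=> dP; elim: s => [|i s IH].
  have -> : (fun w => \prod_(i <- [::]) P i w) = (fun=> 1).
    by apply/funext => w; rewrite big_nil.
  exact: hol_cst.
have -> : (fun w => \prod_(j <- i :: s) P j w) = (fun w => P i w * \prod_(j <- s) P j w).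
  by apply/funext => w; rewrite big_cons.
exact: holM.
Qed.

Lemma hol_sum (I : Type) (s : seq I) (P : I -> C -> C) z :
  (forall i, hol (P i) z) -> hol (fun w => \sum_(i <- s) P i w) z.
Proof.
move=> dP; elim: s => [|i s IH].
  have -> : (fun w => \sum_(i <- [::]) P i w) = (fun=> 0).
    by apply/funext => w; rewrite big_nil.
  exact: hol_cst.
have -> : (fun w => \sum_(j <- i :: s) P j w) = (fun w => P i w + \sum_(j <- s) P j w).
  by apply/funext => w; rewrite big_cons.
exact: holD.
Qed.

Lemma hol_root_prod (s : seq C) m z : hol (root_prod s m) z.
Proof. by apply: hol_prod => a; apply: holX; exact: hol_sub. Qed.

Lemma root_prod_neq0 (s : seq C) m z : z \notin s -> root_prod s m z != 0.
Proof.
move=> zs; rewrite prodf_seq_neq0; apply/allP => a as_ /=.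
by rewrite expf_neq0// subr_eq0; apply: contraNneq zs => ->.
Qed.

(** The zeros are divided out one at a time. At the zero b the quotient is
    given by the local factorization of g at b, which agrees with the
    global one around b. *)
Lemma factor_zeros g (U : set C) (s : seq C) (m : C -> nat) :
  (forall z, U z -> exists2 d, 0 < d & forall w, nc (w - z) < d -> U w) ->
  (forall z, U z -> hol g z) -> uniq s ->
  (forall a, a \in s -> U a /\ has_order g a (m a)) ->
  exists h, [/\ forall z, U z -> hol h z, forall a, a \in s -> h a != 0 &
    forall z, U z -> g z = root_prod s m z * h z].
Proof.
move=> oU dg; elim: s => [|b s IH] /=.
  by move=> _ _; exists g; split=> // z _; rewrite /root_prod big_nil mul1r.
move=> /andP[bs us] Hs.
have [a sa|h [dh h0 E]] := IH us; first by apply: Hs; rewrite inE sa orbT.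
have [Ub /has_orderP [r r0 [k [dk k0 Ek]]]] := Hs b (mem_head _ _).
pose P := root_prod s m.
have Pb : P b != 0 by exact: root_prod_neq0.
pose h' z := if z == b then k b / P b else h z / (z - b) ^+ m b.
have [d1 d10 Hd1] := oU b Ub.
have /ccontP /(_ (nc (P b))) := hol_ccont (hol_root_prod s m b).
rewrite nc_gt0 => /(_ Pb) [d2 d20 Hd2].
pose d := Num.min r (Num.min d1 d2).
have d0 : 0 < d by rewrite !lt_min r0 d10.
have P0 w : nc (w - b) < d -> P w != 0.
  rewrite !lt_min => /andP[_ /andP[_ /Hd2 H]]; apply: contraTneq H => Pw.
  by rewrite -/(P w) -/(P b) Pw sub0r ncN ltxx.
have near_b w : nc (w - b) < d -> k w / P w = h' w.
  move=> wd; have := P0 w wd.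
  move: wd; rewrite /h' !lt_min => /andP[wr /andP[wd1 _]] Pw.
  case: eqVneq => [->//|wb].
  have X0 : (w - b) ^+ m b != 0 by rewrite expf_neq0// subr_eq0.
  have := E w (Hd1 w wd1); rewrite Ek// -/(P w) => e.
  by apply/eqP; rewrite eqr_div// mulrC e mulrC.
have off_b z w : nc (w - z) < nc (z - b) -> h w / (w - b) ^+ m b = h' w.
  move=> wz; rewrite /h' ifN//; apply/eqP => wb.
  by move: wz; rewrite wb ncB ltxx.
exists h'; split=> [z Uz|a|z Uz].
- have [->|zb] := eqVneq z b.
    apply: (hol_near d0 near_b); apply: holM.
      by apply: dk; rewrite subrr Normc.normc0.
    by apply: holV => //; exact: hol_root_prod.
  have zb0 : 0 < nc (z - b) by rewrite nc_sub_gt0.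
  apply: (hol_near zb0 (off_b z)); apply: holM; first exact: dh.
  by apply: holV; [apply: holX; exact: hol_sub|rewrite expf_neq0// subr_eq0].
- rewrite inE => /orP[/eqP->|sa]; first by rewrite /h' eqxx mulf_neq0// invr_eq0.
  have ab : a != b by apply: contraNneq bs => <-.
  by rewrite /h' (negbTE ab) mulf_neq0 ?h0// invr_eq0 expf_neq0// subr_eq0.
rewrite /root_prod big_cons -/(root_prod s m z) -/P /h'; case: eqVneq => [->|zb].
  rewrite Ek ?subrr ?Normc.normc0// -mulrA; congr (_ * _).
  by rewrite mulrCA divff ?mulr1.
by rewrite E// -/(P z); field; rewrite expf_neq0// subr_eq0.
Qed.

End Zeros.

(** * The derivative of the logarithm of a modulus *)

Section LogMean.
Context {R : realType}.
Local Notation C := R[i].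
Local Notation nc := (@Normc.normc R).
Local Notation Re := (@complex.Re R).
Local Notation Im := (@complex.Im R).
Local Notation mu := (@lebesgue_measure R).
Implicit Types (F G g h : C -> C) (a b z w : C) (s t r x y : R).

Lemma has_cderiv_comp F G z k l : has_cderiv F z l -> has_cderiv G (F z) k ->
  has_cderiv (fun w => G (F w)) z (k * l).
Proof.
move=> HF HG e e0.
pose A := nc l + 1; have A0 : 0 < A by rewrite /A; have := nc_ge0 l; lra.
pose B := nc k + 1; have B0 : 0 < B by rewrite /B; have := nc_ge0 k; lra.
have [d1 d10 H1] := HG (e / (2 * A)) ltac:(by rewrite divr_gt0// mulr_gt0).
have [d2 d20 H2] := HF (Num.min 1 (e / (2 * B)))
  ltac:(by rewrite lt_min ltr01 divr_gt0// mulr_gt0).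
exists (Num.min d2 (d1 / A)); first by rewrite lt_min d20 divr_gt0.
move=> w; rewrite lt_min => /andP[w1 w2].
have := H2 w w1; set u := nc (w - z) => Hw; have u0 : 0 <= u := nc_ge0 _.
have Hw1 : nc (F w - F z - l * (w - z)) <= u.
  by apply: le_trans Hw _; rewrite -[leRHS]mul1r ler_wpM2r// ge_min lexx.
have Hw2 : nc (F w - F z - l * (w - z)) <= e / (2 * B) * u.
  by apply: le_trans Hw _; rewrite ler_wpM2r// ge_min lexx orbT.
have FwA : nc (F w - F z) <= A * u.
  have := ncD (F w - F z - l * (w - z)) (l * (w - z)).
  by rewrite subrK ncM -/u /A mulrDl mul1r; lra.
have Fw : nc (F w - F z) < d1.
  by apply: le_lt_trans FwA _; rewrite mulrC -ltr_pdivlMr.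
have := H1 _ Fw => HGw.
have -> : G (F w) - G (F z) - k * l * (w - z) =
   (G (F w) - G (F z) - k * (F w - F z)) + k * (F w - F z - l * (w - z)) by ring.
apply: le_trans (ncD _ _) _; rewrite ncM.
have h1 : nc (G (F w) - G (F z) - k * (F w - F z)) <= e / 2 * u.
  apply: le_trans HGw _; apply: (@le_trans _ _ (e / (2 * A) * (A * u))).
    by rewrite ler_wpM2l// divr_ge0 ?mulr_ge0 ?ltW.
  by rewrite le_eqVlt; apply/orP; left; apply/eqP; field; rewrite gt_eqF.
have h2 : nc k * nc (F w - F z - l * (w - z)) <= e / 2 * u.
  apply: (@le_trans _ _ (B * (e / (2 * B) * u))).
    by apply: ler_pM; rewrite ?nc_ge0// /B; lra.
  by rewrite le_eqVlt; apply/orP; left; apply/eqP; field; rewrite gt_eqF.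
lra.
Qed.

Lemma is_derive_of_small (f : R -> R) x l :
  (forall e, 0 < e -> exists2 d, 0 < d &
     forall t, `|t - x| < d -> `|f t - f x - l * (t - x)| <= e * `|t - x|) ->
  is_derive x 1 f l.
Proof.
move=> H.
have lim : h^-1 *: (f (h *: 1 + x) - f x) @[h --> 0^'] --> l.
  apply/cvgrPdist_le => e e0; have [d d0 Hd] := H e e0.
  rewrite near_withinE; apply/nbhs_ballP; exists d => // h.
  rewrite /ball /= sub0r normrN => hd h0.
  have := Hd (h + x); rewrite addrK => /(_ hd) Hx.
  rewrite /GRing.scale /= mulr1 -(ler_pM2r (_ : 0 < `|h|)) ?normr_gt0//.
  rewrite -normrM; apply: le_trans Hx; rewrite -normrN le_eqVlt.
  by apply/orP; left; apply/eqP; congr (`|_|); field.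
apply: DeriveDef; last by rewrite /derive; apply/cvg_lim.
by apply/cvg_ex; exists l.
Qed.

Lemma has_cderiv_horizontal F x y l : has_cderiv F (x +i* y) l ->
  is_derive x 1 (fun t => Re (F (t +i* y))) (Re l) /\
  is_derive x 1 (fun t => Im (F (t +i* y))) (Im l).
Proof.
move=> H.
have key e : 0 < e -> exists2 d, 0 < d & forall t, `|t - x| < d ->
    nc (F (t +i* y) - F (x +i* y) - l * (t - x)%:C) <= e * `|t - x|.
  move=> e0; have [d d0 Hd] := H e e0; exists d => // t tx.
  have E : (t +i* y) - (x +i* y) = (t - x)%:C by apply: eqC => //=; rewrite subrr.
  by have := Hd (t +i* y); rewrite E nc_real; apply.
split; apply: is_derive_of_small => e /key [d d0 Hd]; exists d => // t /Hd;
  apply: le_trans.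
  apply: le_trans (nc_Re _); rewrite !(ReD, ReN, ReM) /=.
  by rewrite mulr0 subr0.
apply: le_trans (nc_Im _); rewrite !(ImD, ImN, ImM) /=.
by rewrite mulr0 add0r.
Qed.

(** Working with ln(u^2 + v^2) / 2 yields the real part of F' / F without
    choosing a branch of the logarithm. *)
Lemma is_derive_ln_nc F x y l : has_cderiv F (x +i* y) l -> F (x +i* y) != 0 ->
  is_derive x 1 (fun t => ln (nc (F (t +i* y)))) (Re (l / F (x +i* y))).
Proof.
move=> /has_cderiv_horizontal [dR dI] F0.
set u := fun t => Re (F (t +i* y)) in dR; set v := fun t => Im (F (t +i* y)) in dI.
have E t : ln (nc (F (t +i* y))) = 2^-1 * ln (u t * u t + v t * v t).
  have -> : u t * u t + v t * v t = nc (F (t +i* y)) * nc (F (t +i* y)).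
    rewrite /u /v; case: (F _) => p q /=.
    by rewrite -[RHS]expr2 /Normc.normc sqr_sqrtr ?addr_ge0 ?sqr_ge0// !expr2.
  have := nc_ge0 (F (t +i* y)); rewrite le_eqVlt => /orP[/eqP <-|p0].
    by rewrite mulr0 ln0// mulr0.
  by rewrite lnM ?posrE//; field.
have S0 : 0 < u x * u x + v x * v x.
  have : 0 < nc (F (x +i* y)) by rewrite nc_gt0.
  rewrite /u /v /Normc.normc; case: (F _) => p q /=.
  by rewrite sqrtr_gt0 !expr2.
have dS : is_derive x 1 (fun t => u t * u t + v t * v t)
    (u x *: Re l + u x *: Re l + (v x *: Im l + v x *: Im l)).
  by apply: is_deriveD; apply: is_deriveM.
have dL : is_derive x 1 (fun t => ln (u t * u t + v t * v t))
    ((u x * u x + v x * v x)^-1 *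
      (u x *: Re l + u x *: Re l + (v x *: Im l + v x *: Im l))).
  by apply: (@is_derive1_comp _ (@ln R) (fun t => u t * u t + v t * v t)); exact: is_derive1_ln.
have := is_deriveZ (2^-1) dL.
have -> : (fun t => ln (nc (F (t +i* y)))) =
    2^-1 *: (fun t => ln (u t * u t + v t * v t)).
  by apply/funext => t; rewrite E.
move=> dd; apply: is_derive_eq dd _; rewrite /GRing.scale /=.
rewrite /u /v in S0 *; case: (F (x +i* y)) S0 => p q /= S0; case: l {dR dI dS dL} => l1 l2 /=.
by rewrite !expr2; field; rewrite gt_eqF.
Qed.

End LogMean.

(** * Logarithmic means of zero-free functions *)

Section LogMeanZeroFree.
Context {R : realType}.
Local Notation C := R[i].
Local Notation nc := (@Normc.normc R).
Local Notation Re := (@complex.Re R).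
Local Notation Im := (@complex.Im R).
Local Notation mu := (@lebesgue_measure R).
Implicit Types (F G g h : C -> C) (a b z w : C) (s t r x y : R).

Lemma circle_mean_cmean (u : C -> R) b s :
  cmean (fun w => (u w)%:C) b s = (circle_mean u b s)%:C.
Proof.
rewrite /cmean /circle_mean; apply: eqC; rewrite !(ReM, ImM) /=.
  by rewrite mul0r subr0.
by rewrite rint_cst ?pi2_ge0// !mul0r mulr0 addr0.
Qed.

Lemma ccont_ln_nc h z : ccont h z -> h z != 0 ->
  ccont (fun w => (ln (nc (h w)))%:C) z.
Proof.
move=> /ccontP ch hz; apply/ccontP => e e0.
have p0 : 0 < nc (h z) by rewrite nc_gt0.
have /cvgrPdist_lt /(_ e e0) /nbhs_ballP [r r0 Hr] := @continuous_ln R _ p0.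
have [d d0 Hd] := ch r r0; exists d => // w /Hd wd.
rewrite -rmorphB nc_real distrC; apply: Hr; rewrite /ball /=.
apply: le_lt_trans wd; rewrite ler_norml.
have := nc_triB (h w) (h z); have := nc_triB (h z) (h w).
by rewrite (ncB (h z)); lra.
Qed.

(** The derivative of log h with respect to log(w - b); its real part is
    the radial derivative of ln |h| on the logarithmic scale. *)
Definition dlog h b w : C := dC h w / h w * (w - b).

Lemma hol_dlog h b z r : 0 < r -> (forall w, nc (w - z) < r -> hol h w) ->
  h z != 0 -> hol (dlog h b) z.
Proof.
move=> r0 dh hz; apply: holM; last exact: hol_sub.
apply: holM; first exact: hol_dC r0 dh.
by apply: holV => //; apply: dh; rewrite subrr Normc.normc0.
Qed.

Section Annulus.
Variables (h : C -> C) (b : C) (s1 s2 : R).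
Hypotheses (s10 : 0 <= s1)
  (dh : forall w, s1 < nc (w - b) < s2 -> hol h w)
  (h0 : forall w, s1 < nc (w - b) < s2 -> h w != 0).

Lemma annulus_open z : s1 < nc (z - b) < s2 -> exists2 r, 0 < r &
  forall w, nc (w - z) < r -> s1 < nc (w - b) < s2.
Proof.
move=> /andP[z1 z2].
exists (Num.min (nc (z - b) - s1) (s2 - nc (z - b))); first by rewrite lt_min; lra.
move=> w; rewrite lt_min => /andP[w1 w2].
have e1 : z - b - (w - b) = - (w - z) by ring.
have e2 : w - b - (z - b) = w - z by ring.
have := nc_triB (w - b) (z - b); have := nc_triB (z - b) (w - b).
by rewrite e1 e2 ncN; lra.
Qed.

Lemma hol_dlog_annulus w : s1 < nc (w - b) < s2 -> hol (dlog h b) w.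
Proof.
move=> hw; have [r r0 Hr] := annulus_open hw.
by apply: (hol_dlog _ r0 _ (h0 hw)) => v /Hr; exact: dh.
Qed.

Lemma dlog_mean_const t1 t2 : s1 < t1 < s2 -> s1 < t2 < s2 ->
  cmean (dlog h b) b t1 = cmean (dlog h b) b t2.
Proof.
move=> ht1 ht2; wlog t12 : t1 t2 ht1 ht2 / t1 <= t2.
  by move=> H; have [tu|/ltW tu] := leP t1 t2; [|symmetry]; apply: H.
have t10 : 0 < t1 by move: ht1 => /andP[? _]; exact: le_lt_trans s10 _.
apply: cmean_const_open => // w hw; apply: hol_dlog_annulus.
by move: ht1 ht2 hw => /andP[? ?] /andP[? ?] /andP[? ?]; lra.
Qed.

Let f x y := ln (nc (h (circ b (expR x) y))).

Lemma cont_circle_dlog t : s1 < t < s2 -> cont_circle (dlog h b) b t.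
Proof. by move=> ht w wt; apply: hol_ccont; apply: hol_dlog_annulus; rewrite wt. Qed.

Lemma cont_circle_ln t : s1 < t < s2 -> cont_circle (fun w => (ln (nc (h w)))%:C) b t.
Proof.
move=> ht w wt; apply: ccont_ln_nc; last by apply: h0; rewrite wt.
by apply: hol_ccont; apply: dh; rewrite wt.
Qed.

(** With x = ln |w - b|, radial motion is horizontal motion of the
    argument of w = b + exp z. *)
Lemma is_derive_radial x y : s1 < expR x < s2 ->
  is_derive x 1 (f^~ y) (Re (dlog h b (circ b (expR x) y))).
Proof.
move=> hx; have hw : s1 < nc (circ b (expR x) y - b) < s2.
  by rewrite circ_dist ger0_norm ?expR_ge0.
pose F z := h (b + cexp z).
have dF : has_cderiv F (x +i* y) (dC h (circ b (expR x) y) * cexp (x +i* y)).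
  apply: (@has_cderiv_comp _ (fun z => b + cexp z)); last first.
    by rewrite -circ_cexp; apply: has_cderiv_dC; exact: dh.
  move=> e e0; have [d d0 Hd] := cexp_has_cderiv (x +i* y) e0.
  exists d => // w /Hd; apply: le_trans.
  by rewrite le_eqVlt; apply/orP; left; apply/eqP; congr nc; ring.
have F0 : F (x +i* y) != 0 by rewrite /F -circ_cexp; exact: h0.
have := is_derive_ln_nc dF F0.
have -> : (fun t => ln (nc (F (t +i* y)))) = f^~ y.
  by apply/funext => t; rewrite /f circ_cexp.
have -> // : dC h (circ b (expR x) y) * cexp (x +i* y) / F (x +i* y) =
    dlog h b (circ b (expR x) y).
rewrite /dlog mulrAC /F -circ_cexp; congr (_ * _).
by rewrite circ_cexp addrC addKr.
Qed.

Lemma is_derive_radial_mean x : s1 < expR x < s2 ->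
  is_derive x 1 (fun x => rint (f x) 0 (2 * pi))
    (2 * pi * Re (cmean (dlog h b) b (expR x))).
Proof.
move=> hx; have ex0 := expR_ge0 x.
have cD := cont_circle_dlog hx.
have [B B0 HB] := circ_bounded ex0 cD.
have /nbhs_ballP [d1 /= d10 H1] : \forall t \near x, s1 < expR t < s2.
  have ce := @continuous_expR R x.
  have /andP[hx1 hx2] := hx.
  have n1 : \forall t \near x, s1 < expR t by exact: (cvgr_gt _ ce).
  have n2 : \forall t \near x, expR t < s2 by exact: (cvgr_lt _ ce).
  by apply: filterS2 n1 n2 => t -> ->.
have /nbhs_ballP [d2 /= d20 H2] : \forall t \near x, forall y, 0 <= y <= 2 * pi ->
    nc (dlog h b (circ b (expR t) y) - dlog h b (circ b (expR x) y)) < 1.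
  exact: (@continuous_expR R x _ (circ_radius_unif ex0 cD ltr01)).
pose d := Num.min d1 d2; have d0 : 0 < d by rewrite lt_min d10.
have near_x t : `]x - d, x + d[%classic t -> s1 < expR t < s2 /\
    forall y, 0 <= y <= 2 * pi -> nc (dlog h b (circ b (expR t) y)) <= B + 1.
  rewrite /= in_itv /= => ht; have : `|x - t| < d by rewrite ltr_norml; lra.
  rewrite lt_min => /andP[/H1 h1 /H2 h2]; split=> // y hy.
  have := ncD (dlog h b (circ b (expR t) y) - dlog h b (circ b (expR x) y))
              (dlog h b (circ b (expR x) y)).
  by rewrite subrK; have := h2 y hy; have := HB y hy; lra.
have xI : `]x - d, x + d[%classic x by rewrite /= in_itv /=; lra.
have cf t : s1 < expR t < s2 -> cont_on (f t) 0 (2 * pi).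
  move=> ht; have := @ccont_circ _ _ b (expR t) 0 (2 * pi) (expR_ge0 t) (cont_circle_ln ht).
  exact: ccont_Re.
have If t : `]x - d, x + d[%classic t -> mu.-integrable `[0, 2 * pi] (EFin \o f t).
  by move=> /near_x [ht _]; apply: cont_on_integrable; exact: cf.
have Df t y : `]x - d, x + d[%classic t -> `[0, 2 * pi]%classic y ->
    derivable (f ^~ y) t 1.
  by move=> /near_x [ht _] _; have [] := is_derive_radial y ht.
have E1 t y : `]x - d, x + d[%classic t ->
    partial1of2 f t y = Re (dlog h b (circ b (expR t) y)).
  move=> /near_x [ht _]; rewrite partial1of2E.
  by have [_ ->] := is_derive_radial y ht.
have IG : mu.-integrable `[0, 2 * pi] (EFin \o (fun=> B + 1)).
  by apply: (@cont_on_integrable _ (fun=> B + 1)); exact: cst_cont_on.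
have Gub t y : `]x - d, x + d[%classic t -> `[0, 2 * pi]%classic y ->
    `|partial1of2 f t y| <= B + 1.
  move=> It hy; rewrite E1//; have [_ H] := near_x t It.
  apply: le_trans (nc_Re _) _; apply: H.
  by move: hy; rewrite /= in_itv.
have B1 : 0 <= B + 1 by lra.
apply: DeriveDef.
  by apply: (derivable_under_integral _ xI If Df (fun=> B1) IG Gub); exact: measurable_itv.
rewrite -derive1E (differentiation_under_integral _ xI If Df (fun=> B1) IG Gub); last exact: measurable_itv.
have -> : 2 * pi * Re (cmean (dlog h b) b (expR x)) =
    rint (fun y => Re (dlog h b (circ b (expR x) y))) 0 (2 * pi).
  by rewrite /cmean ReM /= mul0r subr0 mulrA divff ?mul1r// gt_eqF// pi2_gt0.
by apply: eq_Rintegral => y _; rewrite E1.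
Qed.

(** As a function of the logarithm of the radius the mean of ln |h| has
    derivative the real part of the mean of dlog, which does not depend on
    the radius. *)
Theorem log_mean_annulus t1 t2 : s1 < t1 -> t1 <= t2 -> t2 < s2 ->
  circle_mean (fun w => ln (nc (h w))) b t2
  - circle_mean (fun w => ln (nc (h w))) b t1 =
  Re (cmean (dlog h b) b t1) * (ln t2 - ln t1).
Proof.
have h10 := s10; move=> ht1 t12 ht2; have t10 : 0 < t1 by lra.
have t20 : 0 < t2 by lra.
have l12 : ln t1 <= ln t2 by rewrite ler_ln.
set k := Re _.
have hx x : ln t1 <= x <= ln t2 -> s1 < expR x < s2.
  rewrite -(ler_expR (ln t1)) -(ler_expR x) !lnK ?posrE//; lra.
have H : rint (fun=> 2 * pi * k) (ln t1) (ln t2) =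
    rint (f (ln t2)) 0 (2 * pi) - rint (f (ln t1)) 0 (2 * pi).
  apply: (@rint_FTC _ _ (fun x => rint (f x) 0 (2 * pi))) l12 _ _.
    exact: cst_cont_on.
  move=> x hxx; apply: is_derive_eq (is_derive_radial_mean (hx x hxx)) _.
  by rewrite /k (@dlog_mean_const t1 (expR x))//; [lra|exact: hx].
rewrite /circle_mean -mulrBr.
have E t : 0 < t -> \int[mu]_(x in `[0, 2 * pi]) ln (nc (h (b + t * cos x +i* (t * sin x))))
    = rint (f (ln t)) 0 (2 * pi).
  by move=> t0; apply: eq_rint => y _; rewrite /f lnK.
rewrite !E// -H.
by rewrite rint_cst// -[2 * pi * k * _]mulrA mulKf// gt_eqF// pi2_gt0.
Qed.

End Annulus.

(** The mean value property of the harmonic function ln |h|: the residue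
    of its logarithmic derivative is 0, so the mean is constant in the
    radius, and it tends to the value at the center. *)
Theorem log_mean_disk h b S s : 0 < s < S ->
  (forall w, nc (w - b) < S -> hol h w) ->
  (forall w, nc (w - b) < S -> h w != 0) ->
  circle_mean (fun w => ln (nc (h w))) b s = ln (nc (h b)).
Proof.
move=> /andP[s0 sS] dh h0.
have dh' w : 0 < nc (w - b) < S -> hol h w by move=> /andP[_]; exact: dh.
have h0' w : 0 < nc (w - b) < S -> h w != 0 by move=> /andP[_]; exact: h0.
have hd w : nc (w - b) < S -> hol (dlog h b) w.
  move=> wS; have r0 : 0 < S - nc (w - b) by lra.
  apply: (hol_dlog _ r0) => [v vw|]; last exact: h0.
  by apply: dh; have := ncD (v - w) (w - b); rewrite addrA subrK; lra.
have k0 t : 0 < t < S -> cmean (dlog h b) b t = 0.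
  move=> ht; rewrite mean_value; first by rewrite /dlog subrr mulr0.
  - lra.
  - by move=> w wt; apply: hol_ccont; apply: hd; lra.
  - by move=> w wt; apply: hd; lra.
have const t : 0 < t -> t <= s -> circle_mean (fun w => ln (nc (h w))) b t =
    circle_mean (fun w => ln (nc (h w))) b s.
  move=> t0 ts; have := log_mean_annulus (lexx 0) dh' h0' t0 ts sS.
  by rewrite k0 ?mul0r; [move=> /eqP; rewrite subr_eq0 => /eqP|lra].
have cl w : nc (w - b) < S -> ccont (fun w => (ln (nc (h w)))%:C) w.
  by move=> wS; apply: ccont_ln_nc; [apply: hol_ccont; exact: dh|exact: h0].
apply: (@complexI R); rewrite -circle_mean_cmean.
rewrite -[RHS](cmean_cst _ b 0) -[RHS](_ : cmean (fun w => (ln (nc (h w)))%:C) b 0 = _); last first.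
  by apply: eq_cmean => // w /Normc.eq0_normc /eqP; rewrite subr_eq0 => /eqP ->.
apply/eqP; rewrite -subr_eq0 -nc_eq0 eq_le nc_ge0 andbT.
apply/ler_addgt0Pr => e e0; rewrite add0r.
have c0 w : 0 <= nc (w - b) <= s -> ccont (fun w => (ln (nc (h w)))%:C) w.
  by move=> /andP[_ ws]; apply: cl; lra.
have /nbhs_ballP [d d0 Hd] := @cmean_cont _ _ b 0 s 0 e (lexx 0) ltac:(by rewrite lexx ltW) c0 e0.
have {}d0 : 0 < d := d0.
pose t := Num.min s (d / 2).
have t0 : 0 < t by rewrite lt_min s0 divr_gt0.
have ts : t <= s by rewrite ge_min lexx.
have td : t <= d / 2 by rewrite ge_min lexx orbT.
rewrite circle_mean_cmean -(const t t0 ts) -circle_mean_cmean.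
apply: Hd; last by rewrite ltW.
by rewrite /ball /= sub0r normrN ger0_norm ?ltW//; lra.
Qed.

End LogMeanZeroFree.

(** * The logarithmic mean of a linear factor *)

Section LogKernelMean.
Context {R : realType}.
Local Notation C := R[i].
Local Notation nc := (@Normc.normc R).
Local Notation Re := (@complex.Re R).
Local Notation Im := (@complex.Im R).
Local Notation mu := (@lebesgue_measure R).
Local Notation D := (`[0, 2 * pi]%classic : set R).
Implicit Types (F G g h : C -> C) (a b z w : C) (s t r x y : R).

(** The equation fixes cos t, and the cosine takes each value at most
    twice on [0, 2 pi]. *)
Lemma circ_hit b s a t : 0 < s -> 0 <= t <= 2 * pi -> circ b s t = a ->
  t = acos (Re (a - b) / s) \/ t = 2 * pi - acos (Re (a - b) / s).
Proof.
move=> s0 /andP[t0 t2] <-.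
have -> : Re (circ b s t - b) / s = cos t.
  by rewrite /circ addrC addKr /= mulrC mulKf// gt_eqF.
have [tpi|tpi] := leP t pi; [left|right].
  by rewrite cosK// in_itv /= t0.
have -> : cos t = cos (2 * pi - t).
  by rewrite cosB mulr_natl cos2pi sin2pi mul1r mul0r addr0.
by rewrite cosK ?in_itv /=; lra.
Qed.

Lemma circ_hits_finite b s (l : seq C) : 0 < s ->
  finite_set [set t | 0 <= t <= 2 * pi /\ circ b s t \in l].
Proof.
move=> s0; elim: l => [|a l IH].
  by apply: sub_finite_set (finite_set0 _) => t /= [].
pose u := acos (Re (a - b) / s).
apply: sub_finite_set (_ : _ `<=` [set u] `|` [set 2 * pi - u] `|`
  [set t | 0 <= t <= 2 * pi /\ circ b s t \in l]) _.
  move=> t /= [ht]; rewrite inE => /orP[/eqP ta|tl]; last by right.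
  by left; have [->|->] := circ_hit s0 ht ta; [left|right].
rewrite !finite_setU; split=> //; split; exact: finite_set1.
Qed.

Lemma finite_null (N : set R) : finite_set N -> measurable N /\ mu N = 0%E.
Proof.
move=> /finite_set_countable cN; split; last exact: countable_lebesgue_measure0.
by apply: countable_measurable => // t; exact: measurable_set1.
Qed.

(** A finite set is null and all its subsets are measurable, so v inherits
    the measurability of u. *)
Lemma integrable_off_finite (u v : R -> R) x y (N : set R) : finite_set N ->
  mu.-integrable `[x, y] (EFin \o u) ->
  (forall t, x <= t <= y -> ~ N t -> v t = u t) ->
  mu.-integrable `[x, y] (EFin \o v) /\
  rint v x y = rint u x y.
Proof.
move=> fN iu uv; have [mN N0] := finite_null fN.
have mD : measurable (`[x, y]%classic : set R) by exact: measurable_itv.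
have uvD t : `[x, y]%classic t -> ~ N t -> v t = u t.
  by rewrite /= in_itv; exact: uv.
have mv : measurable_fun `[x, y] (EFin \o v).
  move=> _ Y mY.
  have -> : `[x, y] `&` (EFin \o v) @^-1` Y =
      (`[x, y] `&` (EFin \o u) @^-1` Y) `\` N `|`
      (N `&` (`[x, y] `&` (EFin \o v) @^-1` Y)).
    apply/seteqP; split=> t [].
      move=> Dt Yt; have [Nt|Nt] := pselect (N t); [by right|left].
      by split=> //; split=> //=; rewrite -uvD.
    by move=> [[Dt Yt] Nt]; split=> //=; rewrite uvD.
    by move=> [].
  apply: measurableU.
    by apply: measurableD => //; exact: (measurable_int _ iu).
  by apply: (finite_null _).1; apply: sub_finite_set fN => t [].
have iv : mu.-integrable `[x, y] (EFin \o v).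
  apply: (@negligible_integrable _ _ R mu _ N _ mN mD mv N0).2.
  have := (@negligible_integrable _ _ R mu _ N _ mN mD (measurable_int _ iu) N0).1 iu.
  by apply: eq_integrable => [|t /set_mem [Dt Nt]]; [exact: measurableD|rewrite /= uvD].
split=> //; rewrite /rint /Rintegral.
rewrite (@negligible_integral _ _ R mu _ N _ mN mD iv N0).
rewrite (@negligible_integral _ _ R mu _ N _ mN mD iu N0).
by congr fine; apply: eq_integral => t /set_mem [Dt Nt]; rewrite /= uvD.
Qed.

Lemma cont_on_measurable (u : R -> R) x y : cont_on u x y -> measurable_fun `[x, y] u.
Proof.
by move=> /cont_on_integrable /measurable_int /measurable_EFinP.
Qed.

Lemma cont_on_nc (F : R -> C) x y : ccont_on F x y -> cont_on (fun t => nc (F t)) x y.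
Proof.
move=> cF t ht; have /contRCP H := cF t ht.
apply/cvgrPdist_lt => e e0; apply: filterS (H e e0) => u.
apply: le_lt_trans; rewrite ler_norml.
have := nc_triB (F u) (F t); have := nc_triB (F t) (F u).
by rewrite (ncB (F t)); lra.
Qed.

Lemma cont_on_ln (u : R -> R) x y : (forall t, x <= t <= y -> 0 < u t) ->
  cont_on u x y -> cont_on (fun t => ln (u t)) x y.
Proof.
move=> u0 cu t ht; apply: (@continuous_comp _ _ _ u (@ln R)); first exact: cu.
by apply: continuous_ln; exact: u0.
Qed.

Lemma ccont_circ_sub b s a x y : ccont_on (fun t => circ b s t - a) x y.
Proof.
move=> t _; apply: (@cvgB _ C^o); first exact: cont_circ.
exact: (@cst_continuous _ C^o).
Qed.

Lemma nc_circ_sub_gt0 b s a t : 0 <= s -> s != nc (a - b) -> 0 < nc (circ b s t - a).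
Proof.
move=> s0 sa; rewrite nc_sub_gt0; apply: contraNneq sa => <-.
by rewrite circ_dist ger0_norm.
Qed.

Lemma cont_on_ln_circ b s a : 0 <= s -> s != nc (a - b) ->
  cont_on (fun t => ln (nc (circ b s t - a))) 0 (2 * pi).
Proof.
move=> s0 sa; apply: cont_on_ln => [t _|]; first exact: nc_circ_sub_gt0.
by apply: cont_on_nc; exact: ccont_circ_sub.
Qed.

Lemma log_mean_far b s a : 0 < s < nc (a - b) ->
  circle_mean (fun w => ln (nc (w - a))) b s = ln (nc (a - b)).
Proof.
move=> hs; rewrite (@log_mean_disk _ (fun w => w - a) b (nc (a - b)) s)//.
- by rewrite ncB.
- by move=> w _; exact: hol_sub.
- by move=> w ws; rewrite -nc_gt0 nc_sub_gt0; apply: contraTneq ws => ->; rewrite ltxx.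
Qed.

Lemma nc_conj z : nc (conjc z) = nc z.
Proof. by case: z => p q; rewrite /Normc.normc /= sqrrN. Qed.

(** Reflection in the circle: on |w - b| = s the distance to a equals a
    modulus that is zero-free inside, because
    |s e^it - c| = |s - c' e^it| for c = a - b and c' its conjugate. *)
Lemma log_mean_near b s a : 0 < s -> nc (a - b) < s ->
  circle_mean (fun w => ln (nc (w - a))) b s = ln s.
Proof.
move=> s0 sa; set al := a - b; set n := nc al; have n0 : 0 <= n := nc_ge0 _.
pose h w : C := s%:C - conjc al * w.
pose S := 2 * s / (s + n).
have sn : 0 < s + n by lra.
have S1 : 1 < S by rewrite /S ltr_pdivlMr// mul1r; rewrite -/al -/n in sa; lra.
have nS : n * S <= s.
  rewrite /S mulrA ler_pdivrMr//; rewrite -/al -/n in sa; nra.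
have hh : hol h = fun=> True.
  by apply/funext => w; apply/propext; split=> // _; apply: holB;
     [exact: hol_cst|apply: holM; [exact: hol_cst|exact: hol_id]].
have := @log_mean_disk _ h 0 S 1.
rewrite /h mulr0 subr0 nc_real (gtr0_norm s0) => <-; first last.
- move=> w; rewrite subr0 -/(h w) => wS; rewrite -nc_gt0 /h.
  have := nc_triB s%:C (conjc al * w).
  rewrite nc_real gtr0_norm// ncM nc_conj -/n.
  have [n00|n00] := eqVneq n 0; first by rewrite n00 mul0r subr0; exact: lt_le_trans.
  have n1 : 0 < n by rewrite lt_neqAle eq_sym n00.
  have h1 : n * nc w < n * S by rewrite ltr_pM2l.
  by apply: lt_le_trans; rewrite subr_gt0; exact: lt_le_trans h1 nS.
- by move=> w _; rewrite -/h hh.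
- by rewrite ltr01.
rewrite /circle_mean; congr (_ * _); apply: eq_rint => t _; congr ln.
have c1 : conjc (cis t) * cis t = 1.
  apply: eqC; rewrite ?ReM ?ImM /=; last by ring.
  by rewrite -(cos2Dsin2 t); ring.
have := circE b s t; rewrite /circ => ->.
have := circE 0 1 t; rewrite /circ => ->.
have -> : b + s%:C * cis t - a = s%:C * cis t - al by rewrite /al; ring.
rewrite -[LHS]nc_conj -[LHS]mulr1 -(nc_cis t) -ncM; congr nc.
have -> : conjc (s%:C * cis t - al) = s%:C * conjc (cis t) - conjc al.
  by case: (al) => p q; apply: eqC; rewrite /=; ring.
by rewrite mulrBl -mulrA c1 nc_cis rmorph1 add0r mul1r mulr1.
Qed.

Section OnTheCircle.
Variables (b a : C) (s : R).
Hypotheses (s0 : 0 < s) (sa : nc (a - b) = s).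

Let lam (n : nat) : R := 1 - (n.+2%:R)^-1.
Let F t := ln (nc (circ b s t - a)).
Let Fn n t := ln (nc (circ b (lam n * s) t - a)).

Lemma lam_itv n : 0 < lam n < 1.
Proof.
have h : 0 < (n.+2%:R : R)^-1 by rewrite invr_gt0.
have : (n.+2%:R : R)^-1 <= 2^-1 by rewrite lef_pV2 ?posrE// ler_nat.
by rewrite /lam; move: (n.+2%:R^-1) h => x h; lra.
Qed.

Lemma lam_cvg : lam n @[n --> \oo] --> (1 : R).
Proof.
rewrite -[X in _ --> X]subr0; apply: cvgB; first exact: cvg_cst.
apply/(@cvgr0Pnorm_lt R R^o) => e e0; near=> n.
rewrite ger0_norm; last by rewrite invr_ge0.
rewrite invf_plt ?posrE//.
have : e^-1 < n%:R by near: n; exact: nbhs_infty_gtr.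
by move=> /lt_le_trans; apply; rewrite ler_nat; do 2 apply: leqW.
Unshelve. all: by end_near. Qed.

Lemma cvg_dist t : nc (circ b (lam n * s) t - a) @[n --> \oo] --> nc (circ b s t - a).
Proof.
apply/cvgrPdist_lt => e e0; near=> n.
have := nc_triB (circ b (lam n * s) t - a) (circ b s t - a).
have := nc_triB (circ b s t - a) (circ b (lam n * s) t - a).
have -> : circ b s t - a - (circ b (lam n * s) t - a) = ((1 - lam n) * s)%:C * cis t.
  by rewrite !circE !(rmorphM, rmorphB, rmorph1); ring.
have -> : circ b (lam n * s) t - a - (circ b s t - a) = - (((1 - lam n) * s)%:C * cis t).
  by rewrite !circE !(rmorphM, rmorphB, rmorph1); ring.
rewrite ncN ncM nc_cis nc_real mulr1 normrM (gtr0_norm s0).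
have : `|1 - lam n| < e / s.
  near: n; have /cvgrPdist_lt := lam_cvg; apply; exact: divr_gt0.
rewrite ltr_pdivlMr// => h1 h2 h3; rewrite ltr_norml; lra.
Unshelve. all: by end_near. Qed.

(** Moving from the smaller circle to the larger one at most doubles the
    distance to a, because a has distance (1 - lam n) s from the smaller
    circle; this bounds ln of the smaller distance from below. *)
Lemma dist_half n t : nc (circ b s t - a) <= 2 * nc (circ b (lam n * s) t - a).
Proof.
have /andP[l0 l1] := lam_itv n.
have d1 : nc (circ b s t - a) <= nc (circ b (lam n * s) t - a) + (1 - lam n) * s.
  have := ncD (circ b (lam n * s) t - a) (circ b s t - circ b (lam n * s) t).
  have -> : circ b (lam n * s) t - a + (circ b s t - circ b (lam n * s) t) = circ b s t - a by ring.
  have -> : circ b s t - circ b (lam n * s) t = ((1 - lam n) * s)%:C * cis t.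
    by rewrite !circE !(rmorphM, rmorphB, rmorph1); ring.
  rewrite ncM nc_cis nc_real mulr1 ger0_norm// mulr_ge0//; last exact: ltW.
  by rewrite subr_ge0 ltW.
have := nc_triB (a - b) (circ b (lam n * s) t - b).
have -> : a - b - (circ b (lam n * s) t - b) = - (circ b (lam n * s) t - a) by ring.
have ls : 0 <= lam n * s by rewrite mulr_ge0// ltW.
rewrite ncN circ_dist sa (ger0_norm ls) => d2.
lra.
Qed.

Lemma dist_le n t : nc (circ b (lam n * s) t - a) <= 2 * s.
Proof.
have /andP[l0 l1] := lam_itv n.
have := ncD (circ b (lam n * s) t - b) (b - a).
have -> : circ b (lam n * s) t - b + (b - a) = circ b (lam n * s) t - a by ring.
have ls : 0 <= lam n * s by rewrite mulr_ge0// ltW.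
rewrite circ_dist (ncB b) sa (ger0_norm ls) => d.
have : lam n * s <= s by rewrite ger_pMl// ltW.
lra.
Qed.

Lemma lam_s_lt n : 0 < lam n * s < s.
Proof. by have /andP[l0 l1] := lam_itv n; rewrite mulr_gt0//= gtr_pMl. Qed.

Lemma cont_Fn n : cont_on (Fn n) 0 (2 * pi).
Proof.
have /andP[h0 h1] := lam_s_lt n; apply: cont_on_ln_circ; first exact: ltW.
by rewrite sa lt_eqF.
Qed.

Lemma int_Fn n : rint (Fn n) 0 (2 * pi) = 2 * pi * ln s.
Proof.
have := @log_mean_far b (lam n * s) a; rewrite sa => /(_ (lam_s_lt n)) <-.
by rewrite /circle_mean mulVKf// gt_eqF// pi2_gt0.
Qed.

Lemma dist_gt0 n t : 0 < nc (circ b (lam n * s) t - a).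
Proof.
have /andP[h0 h1] := lam_s_lt n.
by apply: nc_circ_sub_gt0; rewrite ?sa ?lt_eqF ?ltW.
Qed.

(** When a lies on the circle, it is outside the concentric circles of
    radius lam n * s < s, over which the mean is therefore ln s. Fatou bounds
    the integral of the limit, and dist_half then provides a dominating
    function. *)
Lemma log_mean_on : mu.-integrable D (EFin \o F) /\
  rint F 0 (2 * pi) = 2 * pi * ln s.
Proof.
have [mN N0] := finite_null (@circ_hits_finite b s [:: a] s0).
set N := [set t | _] in mN N0.
have mD : measurable D by exact: measurable_itv.
pose D' := D `\` N; have mD' : measurable D' by exact: measurableD.
have D'D : D' `<=` D by move=> t [].
have pos t : D' t -> 0 < nc (circ b s t - a).
  move=> [Dt Nt]; rewrite nc_sub_gt0; apply/eqP => ta.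
  by apply: Nt; split; [move: Dt; rewrite /= in_itv|rewrite ta mem_head].
have mF : measurable_fun D F.
  apply: (@measurableT_comp _ _ _ _ _ _ (@ln R)) => //.
  apply: cont_on_measurable; apply: cont_on_nc; exact: ccont_circ_sub.
have iFn n : mu.-integrable D (EFin \o Fn n) by apply: cont_on_integrable; exact: cont_Fn.
have cvF t : D' t -> Fn n t @[n --> \oo] --> F t.
  move=> D't; have p := pos t D't.
  by apply: continuous_cvg; [exact: continuous_ln|exact: cvg_dist].
pose C0 := ln (2 * s).
have FnC n t : Fn n t <= C0.
  by rewrite ler_ln ?posrE ?dist_le ?dist_gt0 ?mulr_gt0.
have iC : mu.-integrable D (EFin \o (fun=> C0)).
  by apply: (@cont_on_integrable _ (fun=> C0)); exact: cst_cont_on.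
pose gn n t := (C0 - Fn n t)%:E.
have ign n : mu.-integrable D (gn n).
  apply: (@cont_on_integrable _ (fun t => C0 - Fn n t)) => t ht.
  by apply: cvgB; [exact: cvg_cst|exact: cont_Fn].
have Ign n : (\int[mu]_(t in D') gn n t)%E = (2 * pi * (C0 - ln s))%:E.
  rewrite -(@negligible_integral _ _ R mu D N _ mN mD (ign n) N0).
  rewrite -[LHS]fineK; last exact: integrable_fin_num.
  congr EFin; transitivity (rint (fun t => C0 - Fn n t) 0 (2 * pi)); first by [].
  rewrite rintB; [|exact: cst_cont_on|exact: cont_Fn].
  by rewrite int_Fn rint_cst ?pi2_ge0//; ring.
have mgn n : measurable_fun D' (gn n) by apply: measurable_funS D'D (measurable_int _ (ign n)).
have G0 t : D' t -> 0 <= C0 - F t.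
  move=> D't; rewrite subr_ge0 ler_ln ?posrE ?mulr_gt0 ?pos//.
  have := ncD (circ b s t - b) (b - a); rewrite addrA subrK.
  have -> : 2 * s = s + s by ring.
  by rewrite circ_dist (ncB b) sa gtr0_norm.
have g0 n t : D' t -> (0 <= gn n t)%E by rewrite lee_fin subr_ge0 FnC.
(* Fatou's lemma bounds the integral of C0 - F, so that F is integrable; the
   limit itself then follows by domination. *)
have := @fatou _ _ _ mu D' mD' gn mgn g0.
rewrite [in X in (_ <= X)%E -> _](_ : (fun n => \int[mu]_(t in D') gn n t)%E =
  fun=> (2 * pi * (C0 - ln s))%:E); last by apply/funext => n; exact: Ign.
rewrite (cvg_limn_einf_sup (cvg_cst _)).1.
rewrite (@eq_integral _ _ _ mu D' (fun t => (C0 - F t)%:E)); last first.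
  move=> t /set_mem D't; apply: (cvg_limn_einf_sup _).1.
  apply: cvg_EFin; first exact: nearW.
  by apply: cvgB; [exact: cvg_cst|exact: cvF].
move=> fat.
have mC : measurable_fun D (fun t => C0 - F t) by exact: measurable_funB.
have iG : mu.-integrable D' (fun t => (C0 - F t)%:E).
  apply/integrableP; split.
    by apply: (measurable_funS _ D'D) => //; exact/measurable_EFinP.
  rewrite (@eq_integral _ _ _ mu D' (fun t => (C0 - F t)%:E)).
    exact: le_lt_trans fat (ltry _).
  by move=> t /set_mem D't; rewrite /= ger0_norm// G0.
have iC' : mu.-integrable D' (EFin \o (fun=> C0)).
  by apply: integrableS iC => //; exact: measurableD.
have iF' : mu.-integrable D' (EFin \o F).
  have := integrableB _ iC' iG; move=> /(_ _) H; apply: eq_integrable (H _) => //.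
  by move=> t _; rewrite /= -EFinB; congr EFin; ring.
have iF : mu.-integrable D (EFin \o F).
  apply: (@negligible_integrable _ _ R mu D N _ mN mD _ N0).2 => //.
  exact/measurable_EFinP.
split=> //.
have IFn n : (\int[mu]_(t in D') (EFin \o Fn n) t)%E = (2 * pi * ln s)%:E.
  rewrite -(@negligible_integral _ _ R mu D N _ mN mD (iFn n) N0) -(int_Fn n).
  by rewrite -[LHS]fineK//; exact: integrable_fin_num.
have B0 n t : D' t -> `|Fn n t| <= `|C0| + ln 2 + `|F t|.
  move=> D't; have h1 := FnC n t; have h2 : F t <= ln 2 + Fn n t.
    rewrite -lnM ?posrE ?dist_gt0// ler_ln ?posrE ?mulr_gt0 ?dist_gt0 ?pos//.
    exact: dist_half.
  have h3 : 0 <= ln (2 : R) by rewrite ln_ge0// ler1n.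
  rewrite ler_norml; have := ler_norm C0; have := ler_norm (- F t).
  have := normr_ge0 C0; have := normr_ge0 (F t); rewrite normrN; lra.
have iB : mu.-integrable D' (EFin \o (fun t => `|C0| + ln 2 + `|F t|)).
  apply: (@eq_integrable _ _ _ mu D' _ ((EFin \o (fun=> `|C0| + ln 2)) \+ (EFin \o (fun t => `|F t|)))) => //.
  apply: integrableD => //; last exact: integrable_norm.
  apply: (@integrableS _ _ _ mu D) => //.
  by apply: (@cont_on_integrable _ (fun=> _)); exact: cst_cont_on.
have mFn n : measurable_fun D' (EFin \o Fn n).
  exact: measurable_int (@integrableS _ _ R mu D D' _ mD mD' D'D (iFn n)).
have cvE : {ae mu, forall t, D' t ->
    (EFin \o Fn n) t @[n --> \oo] --> (EFin \o F) t}.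
  apply: aeW => t D't; apply: cvg_EFin; first exact: nearW.
  exact: cvF.
have BE : {ae mu, forall t n, D' t ->
    (`|(EFin \o Fn n) t| <= (`|C0| + ln 2 + `|F t|)%R%:E)%E}.
  by apply: aeW => t n D't; rewrite /= lee_fin B0.
have [_ _] := @dominated_convergence _ _ R mu D' mD' _ _ _ mFn
  (measurable_int _ iF') cvE iB BE.
rewrite (_ : [sequence _]_n = fun=> (2 * pi * ln s)%:E); last first.
  by apply/funext => n; exact: IFn.
move=> /(cvg_unique _ (cvg_cst _)) E.
rewrite /rint /Rintegral (@negligible_integral _ _ R mu D N _ mN mD iF N0) -E//.
Qed.

End OnTheCircle.

End LogKernelMean.

(** * The theorem of Cauchy for a disk with holes *)

Section Residues.
Context {R : realType}.
Local Notation C := R[i].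
Local Notation nc := (@Normc.normc R).

Lemma hol_cauchy_type (phi : C -> C) b s z : 0 <= s -> cont_circle phi b s ->
  nc (z - b) != s -> hol (fun z => cmean (fun w => phi w * (w - z)^-1) b s) z.
Proof.
by move=> s0 cphi zs; apply/holP; eexists; exact: cauchy_type_cderiv.
Qed.

(** Up to sign the Cauchy integral over |w - b| = s, evaluated outside:
    the part of the Laurent expansion of phi at b with negative exponents. *)
Definition principal_part (phi : C -> C) b s z : C :=
  - cmean (fun w => phi w * (w - b) * (w - z)^-1) b s.

Section PrincipalPart.
Variables (phi : C -> C) (b : C) (s : R).
Hypotheses (s0 : 0 <= s) (cphi : cont_circle phi b s).

Let cphib : cont_circle (fun w => phi w * (w - b)) b s.
Proof. by apply: cont_circleM => //; exact: cont_circle_sub. Qed.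

Lemma hol_principal_part z : nc (z - b) != s -> hol (principal_part phi b s) z.
Proof.
move=> zs; have := holB (hol_cst 0 z) (hol_cauchy_type s0 cphib zs).
by congr hol; apply/funext => w; rewrite sub0r.
Qed.

(** At infinity z * psi(z) tends to the residue, so its mean over any large
    circle around the origin is the residue. *)
Lemma principal_part_mean T : nc b + s < T ->
  cmean (fun z => principal_part phi b s z * z) 0 T =
  cmean (fun w => phi w * (w - b)) b s.
Proof.
have h0 := s0; move=> hT; set W := nc b + s in hT.
have W0 : 0 <= W by rewrite /W addr_ge0 ?nc_ge0.
set A := RHS.
have far z : W < nc z -> s < nc (z - b).
  by move=> hz; have := ncD (z - b) b; rewrite subrK -/W; rewrite /W in hz; lra.
have hpp z : W < nc z -> hol (fun z => principal_part phi b s z * z) z.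
  move=> /far hz; apply: holM; last exact: hol_id.
  by apply: hol_principal_part; rewrite gt_eqF.
have [B B0 HB] := circ_bounded s0 cphib.
have bound z : W < nc z -> nc (principal_part phi b s z * z - A) <= 2 * (B * (W / (nc z - W))).
  move=> hz; have hz' := far z hz; have zs : nc (z - b) != s by rewrite gt_eqF.
  have cI := cont_circle_inv zs.
  have -> : principal_part phi b s z * z - A =
      cmean (fun w => phi w * (w - b) * (- w * (w - z)^-1)) b s.
    rewrite /principal_part mulNr mulrC -mulrN -[X in _ * X]mulN1r mulrA mulrN1.
    rewrite -cmeanZ//; last exact: cont_circleM.
    rewrite /A -cmeanB//; last first.
      by apply: cont_circleM; [exact: cont_circle_cst|exact: cont_circleM].
    apply: eq_cmean => // w ws; field.
    exact: on_circle_ne zs ws.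
  apply: cmean_le_circ => //.
    apply: cont_circleM => //; apply: cont_circleM => // w _.
    have := ccontB (ccont_cst 0 w) (ccont_id w).
    by congr ccont; apply/funext => v; rewrite sub0r.
  move=> t ht; rewrite !ncM ncN ncV -ncM.
  apply: ler_pM; rewrite ?nc_ge0 ?mulr_ge0 ?invr_ge0 ?nc_ge0//; first exact: HB.
  have cW : nc (circ b s t) <= W.
    have := ncD (circ b s t - b) b; rewrite subrK circ_dist ger0_norm//.
    by rewrite /W addrC.
  have := nc_triB z (circ b s t); rewrite ncB => hd.
  apply: ler_pM; rewrite ?nc_ge0 ?invr_ge0 ?nc_ge0//.
  by rewrite lef_pV2 ?posrE; lra.
apply/eqP; rewrite -subr_eq0 -nc_eq0 eq_le nc_ge0 andbT.
apply/ler_addgt0Pr => e e0; rewrite add0r.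
(* radius at which the bound, doubled by cmean_le, is below e *)
pose S := T + 4 * (B * W) / e.
have Q0 : 0 <= 4 * (B * W) / e by rewrite divr_ge0 ?mulr_ge0// ltW.
have ST : T <= S by rewrite /S lerDl.
rewrite (@cmean_const _ _ 0 T S)//; [|lra| |]; last 2 first.
- by move=> w /andP[h1 _]; apply: hol_ccont; apply: hpp; rewrite subr0 in h1; lra.
- by move=> w /andP[h1 _]; apply: hpp; rewrite subr0 in h1; lra.
have S0 : 0 <= S by lra.
rewrite -(cmean_cst A 0 S) -cmeanB//; last exact: cont_circle_cst; last first.
  by move=> w ws; apply: hol_ccont; apply: hpp; rewrite subr0 in ws; lra.
apply: (@le_trans _ _ (2 * (2 * (B * (W / (S - W)))))).
  apply: cmean_le => //.
    move=> w ws; rewrite subr0 in ws; apply: ccontB; last exact: ccont_cst.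
    by apply: hol_ccont; apply: hpp; lra.
  by move=> w; rewrite subr0 => ws; rewrite -ws; apply: bound; lra.
have -> : 2 * (2 * (B * (W / (S - W)))) = 4 * (B * W) / (S - W).
  by field; rewrite gt_eqF//; lra.
rewrite ler_pdivrMr; last lra.
have h1 : e * (4 * (B * W) / e) = 4 * (B * W) by field; rewrite gt_eqF.
have -> : e * (S - W) = e * (T - W) + e * (4 * (B * W) / e) by rewrite /S; ring.
by rewrite h1 lerDr mulr_ge0 ?ltW ?subr_gt0.
Qed.

End PrincipalPart.

(** Cauchy's theorem for a disk with M holes.  The principal parts of phi at
    the holes are subtracted; what is left extends holomorphically over the
    holes, each principal part contributes its own residue. *)
Theorem cauchy_holes (M : nat) (c : 'I_M -> C) (phi : C -> C) (e1 E1 T S : R) :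
  0 < e1 -> e1 < E1 -> 0 < T -> T < S ->
  (forall j k z, j != k -> nc (z - c j) <= E1 -> E1 < nc (z - c k)) ->
  (forall j, nc (c j) + E1 < T) ->
  (forall z, nc z < S -> (forall j, e1 <= nc (z - c j)) -> hol phi z) ->
  cmean (fun w => phi w * w) 0 T =
  \sum_(j < M) cmean (fun w => phi w * (w - c j)) (c j) e1.
Proof.
move=> e10 eE T0 TS disj cT0 dphi.
have inT j z : nc (z - c j) <= E1 -> nc z < T.
  by move=> zE; have := ncD (z - c j) (c j); rewrite subrK; have := cT0 j; lra.
have E10 : 0 < E1 by lra.
have inS j z : e1 <= nc (z - c j) <= E1 -> hol phi z.
  move=> /andP[h1 h2]; apply: dphi => [|k]; first by have := inT j z h2; lra.
  have [<-//|jk] := eqVneq j k.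
  by have := disj j k z jk h2; lra.
have cphi j s : e1 <= s <= E1 -> cont_circle phi (c j) s.
  by move=> hs w ws; apply: hol_ccont; apply: (inS j); rewrite ws.
have ce1 j : cont_circle phi (c j) e1 by apply: cphi; rewrite lexx ltW.
have cE1 j : cont_circle phi (c j) E1 by apply: cphi; rewrite lexx andbT ltW.
pose psi j := principal_part phi (c j) e1.
pose reg j z := cmean (fun w => phi w * (w - c j) * (w - z)^-1) (c j) E1.
have split_phi j z : e1 < nc (z - c j) < E1 -> phi z = reg j z + psi j z.
  move=> hz; rewrite (@cauchy_annulus _ phi (c j) e1 E1 z)//.
  - by congr (_ - _); apply: eq_cmean => [|w _]; rewrite ?mulrA// ltW.
  - exact: ltW.
  - by move=> w hw; apply: hol_ccont; exact: (inS j).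
  - by move=> w /andP[h1 h2]; apply: (inS j); lra.
(* phi minus all principal parts; inside a hole phi minus its own principal
   part is the regular part of the Laurent splitting *)
pose phi' z : C := if [pick j | nc (z - c j) < E1] is Some j
  then reg j z - \sum_(k < M | k != j) psi k z else phi z - \sum_(k < M) psi k z.
have outE z : (forall j, e1 < nc (z - c j)) -> phi' z = phi z - \sum_(k < M) psi k z.
  move=> hz; rewrite /phi'; case: pickP => // j hj.
  rewrite [in RHS](bigD1 j)//= (@split_phi j z) ?hz//.
  by rewrite opprD addrA addrK.
have inE j z : nc (z - c j) < E1 -> phi' z = reg j z - \sum_(k < M | k != j) psi k z.
  move=> hj; rewrite /phi'; case: pickP => [k hk|/(_ j)]; last by rewrite hj.
  have [->//|kj] := eqVneq k j.
  by have := disj k j z kj (ltW hk); rewrite ltNge (ltW hj).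
have hsum (P : pred 'I_M) z : (forall k, P k -> e1 < nc (z - c k)) ->
    hol (fun z => \sum_(k < M | P k) psi k z) z.
  move=> hz.
  have -> : (fun z => \sum_(k < M | P k) psi k z) =
      (fun z => \sum_(k < M) (fun z => if P k then psi k z else 0) z).
    by apply/funext => w; rewrite big_mkcond.
  apply: hol_sum => k; case: (boolP (P k)) => Pk; last exact: hol_cst.
  by apply: hol_principal_part; [exact: ltW|exact: ce1|rewrite gt_eqF// hz].
have hphi' z : nc z < S -> hol phi' z.
  move=> zS; have [[j hj]|nj] := pselect (exists j, nc (z - c j) < E1).
    have d0 : 0 < E1 - nc (z - c j) by lra.
    have near_z w : nc (w - z) < E1 - nc (z - c j) ->
        reg j w - \sum_(k < M | k != j) psi k w = phi' w.
      move=> wz; rewrite (inE j)//.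
      by have := ncD (w - z) (z - c j); rewrite addrA subrK; lra.
    apply: (hol_near d0 near_z); apply: holB.
      apply: hol_cauchy_type; [exact: ltW| |by rewrite lt_eqF].
      by apply: cont_circleM; [exact: cE1|exact: cont_circle_sub].
    apply: hsum => k kj; apply: lt_trans eE _; apply: (disj j).
      by rewrite eq_sym.
    exact: ltW.
  have hz j : E1 <= nc (z - c j) by rewrite leNgt; apply/negP => hj; apply: nj; exists j.
  have d0 : 0 < E1 - e1 by lra.
  have near_z w : nc (w - z) < E1 - e1 -> phi w - \sum_(k < M) psi k w = phi' w.
    move=> wz; rewrite outE// => j.
    have := ncD (z - w) (w - c j); rewrite addrA subrK (ncB z w).
    by have := hz j; lra.
  apply: (hol_near d0 near_z); apply: holB.
    by apply: dphi => // j; have := hz j; lra.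
  by apply: hsum => k _; have := hz k; lra.
have onT w : nc w = T -> forall j, E1 < nc (w - c j).
  by move=> wT j; rewrite ltNge; apply/negP => /inT; rewrite wT ltxx.
have onT' w : nc (w - 0) = T -> forall j, E1 < nc (w - c j) by rewrite subr0; exact: onT.
have hphiT w : nc (w - 0) = T -> hol phi w.
  move=> wT; apply: dphi; first by rewrite subr0 in wT; rewrite wT.
  by move=> j; have := onT' w wT j; lra.
have m0 : cmean (fun w => phi' w * w) 0 T = 0.
  rewrite mean_value ?mulr0//; first exact: ltW.
  - move=> w; rewrite subr0 => wT; apply: hol_ccont; apply: holM; last exact: hol_id.
    by apply: hphi'; lra.
  - move=> w; rewrite subr0 => wT; apply: holM; last exact: hol_id.
    by apply: hphi'; lra.
have hpsiT k w : nc (w - 0) = T -> hol (fun w => psi k w * w) w.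
  move=> wT; apply: holM; last exact: hol_id.
  apply: hol_principal_part; [exact: ltW|exact: ce1|rewrite gt_eqF//].
  by have := onT' w wT k; lra.
have cT (P : 'I_M -> C -> C) (l : seq 'I_M) :
    (forall k w, nc (w - 0) = T -> hol (P k) w) ->
    cmean (fun w => \sum_(k <- l) P k w) 0 T = \sum_(k <- l) cmean (P k) 0 T.
  move=> hP; elim: l => [|k l IH].
    rewrite big_nil -[RHS](cmean_cst 0 0 T); apply: eq_cmean => [|w _]; first exact: ltW.
    by rewrite big_nil.
  rewrite big_cons -IH -cmeanD.
  - by apply: eq_cmean => [|w _]; [exact: ltW|rewrite big_cons].
  - exact: ltW.
  - by move=> w wT; apply: hol_ccont; exact: hP.
  - by move=> w wT; apply: hol_ccont; apply: hol_sum => i; exact: hP.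
have : cmean (fun w => phi w * w) 0 T - cmean (fun w => \sum_(k < M) psi k w * w) 0 T = 0.
  transitivity (cmean (fun w => phi' w * w) 0 T); last exact: m0.
  rewrite -cmeanB.
  - apply: eq_cmean => [|w wT]; first exact: ltW.
    rewrite outE; last by move=> j; have := onT' w wT j; lra.
    by rewrite mulrBl mulr_suml.
  - exact: ltW.
  - by move=> w wT; apply: hol_ccont; apply: holM; [exact: hphiT|exact: hol_id].
  - by move=> w wT; apply: hol_ccont; apply: hol_sum => k; exact: hpsiT.
move=> /eqP; rewrite subr_eq0 => /eqP ->; rewrite cT//.
apply: eq_bigr => j _; apply: principal_part_mean => //; first exact: ltW.
by have := cT0 j; lra.
Qed.

End Residues.

(** * Counting densities and the geometry of the exhaustion *)

Section StepIntegral.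
Context {R : realType}.
Local Notation C := R[i].
Local Notation nc := (@Normc.normc R).
Local Notation mu := (@lebesgue_measure R).
Implicit Types (a b z w : C) (s t r x y al : R).

(** The formula of Jensen for a linear factor; the maximum covers a
    outside, inside and on the circle. *)
Lemma log_kernel b s a : 0 < s ->
  mu.-integrable `[0, 2 * pi] (EFin \o (fun t => ln (nc (circ b s t - a)))) /\
  circle_mean (fun w => ln (nc (w - a))) b s = ln (Num.max s (nc (a - b))).
Proof.
move=> s0; have [sa|as_|e] := ltgtP s (nc (a - b)).
- split; last by rewrite log_mean_far// s0.
  by apply: cont_on_integrable; apply: cont_on_ln_circ; [exact: ltW|rewrite lt_eqF].
- split; last by rewrite log_mean_near.
  by apply: cont_on_integrable; apply: cont_on_ln_circ; [exact: ltW|rewrite gt_eqF].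
- have [i1 i2] := log_mean_on s0 (esym e); split=> //.
  rewrite /circle_mean -[X in _ * X]/(rint (fun t => ln (nc (circ b s t - a))) 0 (2 * pi)).
  by rewrite i2 mulKf// gt_eqF// pi2_gt0.
Qed.

(** The density dt / t restricted to t > al: a point that enters the
    domain at radius al contributes its integral to the counting function,
    and ln max on the side of the means. *)
Definition step al t : R := if al < t then t^-1 else 0.

Lemma cont_on_inv x y : 0 < x -> cont_on (fun t : R => t^-1) x y.
Proof. by move=> x0 t /andP[xt _]; apply: inv_continuous; rewrite gt_eqF//; lra. Qed.

Lemma rint_inv x y : 0 < x -> x <= y -> rint (fun t => t^-1) x y = ln y - ln x.
Proof.
move=> x0 xy; apply: rint_FTC => //; first exact: cont_on_inv.
by move=> t /andP[xt _]; apply: is_derive1_ln; lra.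
Qed.

Lemma step_integrable al x y : 0 < x -> mu.-integrable `[x, y] (EFin \o step al).
Proof.
move=> x0; have ii := cont_on_integrable (@cont_on_inv x y x0).
apply: le_integrable ii => //.
  apply/measurable_EFinP.
  have -> : step al = (fun t => \1_(`]al, +oo[) t * t^-1).
    apply/funext => t; rewrite /step indicE mem_setE in_itv /= andbT.
    by case: ifP => _; rewrite ?mul1r ?mul0r.
  apply: measurable_funM; last exact: cont_on_measurable (@cont_on_inv x y x0).
  by apply: measurable_indic.
move=> t; rewrite /= in_itv /= => /andP[xt _]; rewrite lee_fin /step.
by case: ifP => _; rewrite ?normr0.
Qed.

Lemma step_integral al x y : 0 < x -> x <= y ->
  rint (step al) x y = ln (Num.max y al) - ln (Num.max x al).
Proof.
move=> x0 xy.
have E : rint (step al) x y = \int[mu]_(t in `[x, y] `&` `]al, +oo[) t^-1.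
  rewrite Rintegral_mkcondr; apply: eq_rint => t _.
  by rewrite /step patchE mem_setE in_itv /= andbT.
have [alx|xal] := ltP al x.
  rewrite E; have -> : `[x, y] `&` `]al, +oo[ = `[x, y]%classic :> set R.
    apply/seteqP; split=> [t []//|t /= h]; split=> //.
    by move: h; rewrite !in_itv /= => /andP[h _]; rewrite andbT; lra.
  rewrite -/(rint (fun t => t^-1) x y) rint_inv//.
  by have -> : Num.max y al = y by apply/max_idPl; lra.
have [yal|aly] := ltP y al.
  rewrite E; have -> : `[x, y] `&` `]al, +oo[ = set0 :> set R.
    apply/seteqP; split=> [t [] /=|//]; rewrite !in_itv /= => /andP[_ h].
    by rewrite andbT => h'; lra.
  by rewrite Rintegral_set0 subrr.
rewrite E; have -> : `[x, y] `&` `]al, +oo[ = `]al, y]%classic :> set R.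
  apply/seteqP; split=> [t [] /=|t /=]; rewrite !in_itv /=.
    by move=> /andP[_ ->]; rewrite andbT => ->.
  by move=> /andP[h ->]; rewrite !andbT h; split=> //; lra.
rewrite Rintegral_itv_obnd_cbnd; last first.
  have ii := cont_on_integrable (@cont_on_inv x y x0).
  apply: integrableS ii => // t /=; rewrite !in_itv /= => /andP[h ->]; lra.
rewrite -/(rint (fun t => t^-1) al y) rint_inv//; lra.
Qed.

(** The mean over the circle of radius 1/t around a puncture, in terms of
    the radius t. *)
Lemma ln_max_inv t be : 0 < t -> 0 < be ->
  ln (Num.max t^-1 be) = ln (Num.max t be^-1) + ln be - ln t.
Proof.
move=> t0 b0.
have -> : Num.max t^-1 be = Num.max t be^-1 * be / t.
  rewrite maxr_pMl ?ltW// mulVf ?gt_eqF// maxr_pMl ?invr_ge0 ?ltW//.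
  by rewrite mulrAC divff ?gt_eqF// !mul1r maxC.
rewrite lnM ?posrE ?invr_gt0// ?mulr_gt0 ?lt_max ?t0//.
by rewrite lnM ?posrE ?lt_max ?t0// lnV ?posrE.
Qed.

End StepIntegral.

Section Geometry.
Context {R : realType} {M : nat}.
Local Notation C := R[i].
Local Notation nc := (@Normc.normc R).
Variable c : 'I_M -> C.
Hypotheses (hM : (2 <= M)%N) (hc : injective c).

Let j0 : 'I_M := Ordinal (ltnW hM).
Let j1 : 'I_M := Ordinal hM.

Let cmax : R := \big[Num.max/0]_(j < M) nc (c j).

Lemma le_cmax j : nc (c j) <= cmax.
Proof. by rewrite /cmax (bigD1 j)//= le_max lexx. Qed.

Lemma two_rho_le j k : j != k -> 2 * rho c <= nc (c j - c k).
Proof.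
move=> jk; rewrite /rho mulrA divff ?mul1r//.
apply: ge_inf; first by exists 0 => _ [jk' _ <-]; exact: nc_ge0.
by exists (j, k).
Qed.

Lemma rho_gt0 : 0 < rho c.
Proof.
rewrite /rho mulr_gt0 ?invr_gt0//.
pose d := \big[Num.min/1]_(p : 'I_M * 'I_M | p.1 != p.2) nc (c p.1 - c p.2).
have d0 : 0 < d.
  apply: lt_bigmin => // p p12; rewrite nc_sub_gt0.
  by apply: contraNneq p12 => /hc ->.
apply: lt_le_trans d0 _; apply: lb_le_inf.
  by exists (nc (c j0 - c j1)); exists (j0, j1).
by move=> _ [p p12 <-]; apply: bigmin_le_cond.
Qed.

Lemma rho_le_cmax : rho c <= cmax.
Proof.
have := two_rho_le (isT : j0 != j1); have := ncD (c j0) (- c j1).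
by rewrite ncN; have := le_cmax j0; have := le_cmax j1; lra.
Qed.

(** What the choice of r0 provides: from this radius on, the disks around
    the punctures are pairwise disjoint and lie inside the outer circle. *)
Lemma r0_bounds : [/\ 0 < r0 c, (r0 c)^-1 < rho c &
  forall j, nc (c j) + (r0 c)^-1 < r0 c].
Proof.
have p0 := rho_gt0; have pc := rho_le_cmax; have pi0 : 0 < (rho c)^-1 by rewrite invr_gt0.
have r0E : r0 c = (rho c)^-1 + cmax by [].
have r00 : 0 < r0 c by rewrite r0E; lra.
have h1 : (r0 c)^-1 < rho c.
  by rewrite invf_plt ?posrE// r0E; lra.
have h2 : (r0 c)^-1 < (rho c)^-1.
  by rewrite ltf_pV2 ?posrE// r0E; lra.
split=> // j; rewrite [X in _ < X]r0E; have := le_cmax j; lra.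
Qed.

Lemma disks_disjoint (s : R) j k z : s < rho c -> j != k ->
  nc (z - c j) <= s -> s < nc (z - c k).
Proof.
move=> sr jk zj; have := two_rho_le jk; have := ncD (c j - z) (z - c k).
by rewrite addrA subrK (ncB (c j)); lra.
Qed.

Lemma inv_le_r0 t : r0 c <= t -> 0 < t /\ t^-1 <= (r0 c)^-1.
Proof.
have [r00 _ _] := r0_bounds.
by move=> rt; have t0 : 0 < t by [lra]; split=> //; rewrite lef_pV2 ?posrE.
Qed.

Lemma disk_in_Omega_t t j z : r0 c <= t -> nc (z - c j) <= t^-1 -> nc z < t.
Proof.
move=> rt zt; have [t0 ti] := inv_le_r0 rt; have [_ _ h] := r0_bounds.
by have := ncD (z - c j) (c j); rewrite subrK; have := h j; lra.
Qed.

Lemma Omega_tP t z : Omega_t c t z <->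
  nc z < t /\ forall j, t^-1 < nc (z - c j).
Proof.
rewrite /Omega_t /disk /closed_disk /=; rewrite subr0; split=> [[zt H]|[zt H]].
  by split=> // j; rewrite ltNge; apply/negP => h; apply: H; exists j.
by split=> // -[j _ /=]; rewrite leNgt H.
Qed.

(** The closed disks around the punctures are disjoint and contained in
    |z| < t, so the indicator of Omega_t is a difference of indicators. *)
Lemma indicator_Omega_t t z : r0 c <= t -> (forall j, z != c j) ->
  (`[< Omega_t c t z >])%:R * t^-1 =
  step (nc z) t - \sum_(j < M) (t^-1 - step (nc (z - c j))^-1 t).
Proof.
move=> rt zc; have [t0 ti] := inv_le_r0 rt.
have [_ rr _] := r0_bounds.
have stepE j : step (nc (z - c j))^-1 t = if t^-1 < nc (z - c j) then t^-1 else 0.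
  by rewrite /step invf_plt ?posrE// nc_sub_gt0.
have [[j hj]|nj] := pselect (exists j, nc (z - c j) <= t^-1).
  rewrite asboolF; last by move=> /Omega_tP [_ /(_ j)]; rewrite ltNge hj.
  rewrite mul0r /step (disk_in_Omega_t rt hj) (bigD1 j)//= big1; last first.
    move=> k kj; rewrite -/(step _ _) stepE (@disks_disjoint t^-1 j k)// ?subrr//; last first.
      by rewrite eq_sym.
    by lra.
  by rewrite -/(step _ _) stepE ltNge hj /= subr0 addr0 subrr.
have hj j : t^-1 < nc (z - c j) by rewrite ltNge; apply/negP => h; apply: nj; exists j.
rewrite big1 => [|j _]; last by rewrite stepE hj subrr.
rewrite subr0 /step; case: ifP => zt.
  by rewrite asboolT ?mul1r//; apply/Omega_tP.
by rewrite asboolF ?mul0r// => /Omega_tP [+ _]; rewrite zt.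
Qed.

End Geometry.

(** * Boundary means of the exhaustion *)

Section BoundaryMeans.
Context {R : realType} {M : nat}.
Local Notation C := R[i].
Local Notation nc := (@Normc.normc R).
Local Notation mu := (@lebesgue_measure R).
Variable c : 'I_M -> C.
Hypotheses (hM : (2 <= M)%N) (hc : injective c).

Lemma rint_sum (I : Type) (s : seq I) (F : I -> R -> R) (x y : R) :
  (forall i, mu.-integrable `[x, y] (EFin \o F i)) ->
  mu.-integrable `[x, y] (EFin \o (fun t => \sum_(i <- s) F i t)) /\
  rint (fun t => \sum_(i <- s) F i t) x y = \sum_(i <- s) rint (F i) x y.
Proof.
move=> iF; elim: s => [|i s [IH1 IH2]].
  have -> : (fun t => \sum_(i <- [::]) F i t) = (fun=> 0).
    by apply/funext => t; rewrite big_nil.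
  split; first by apply: (@cont_on_integrable _ (fun=> 0)); exact: cst_cont_on.
  by rewrite big_nil /rint -[RHS](mul0r (fine (mu `[x, y]))) Rintegral_cst.
have -> : (fun t => \sum_(j <- i :: s) F j t) = (fun t => F i t + \sum_(j <- s) F j t).
  by apply/funext => t; rewrite big_cons.
split; first exact: (integrableD _ (iF i) IH1).
by rewrite big_cons -IH2 /rint RintegralD.
Qed.

(** The formula of Jensen in the punctured plane for a linear factor: by
    log_kernel the left side, and by step_integral the right side, is an
    alternating sum of terms ln max. *)
Lemma kernel_boundary (a : C) (r : R) : r0 c <= r -> (forall j, a != c j) ->
  let ind t := (`[< Omega_t c t a >])%:R * t^-1 in
  mu.-integrable `[r0 c, r] (EFin \o ind) /\
  boundary_mean c (fun w => ln (nc (w - a))) r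
  - boundary_mean c (fun w => ln (nc (w - a))) (r0 c) = rint ind (r0 c) r.
Proof.
move=> rr ac /=; have [r00 _ _] := r0_bounds hM hc.
have r0' : 0 < r by lra.
pose F j t := t^-1 - step (nc (a - c j))^-1 t.
have iinv := cont_on_integrable (@cont_on_inv R (r0 c) r r00).
have istep al := @step_integrable R al (r0 c) r r00.
have iF j : mu.-integrable `[r0 c, r] (EFin \o F j).
  exact: (integrableB _ iinv (istep _)).
have [iS eS] := @rint_sum _ (index_enum 'I_M) F (r0 c) r iF.
have E t : r0 c <= t <= r -> (`[< Omega_t c t a >])%:R * t^-1 =
    step (nc a) t - \sum_(j < M) F j t.
  by move=> /andP[rt _]; exact: indicator_Omega_t.
have iU : mu.-integrable `[r0 c, r] (EFin \o (fun t => step (nc a) t - \sum_(j < M) F j t)).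
  exact: (integrableB _ (istep (nc a)) iS).
split.
  apply: eq_integrable iU => // t /set_mem; rewrite /= in_itv /= => ht.
  by rewrite E.
rewrite (eq_rint E) /rint RintegralB// -/(rint _ _ _) -/(rint _ _ _).
rewrite step_integral// eS.
have FE j : rint (F j) (r0 c) r = (ln r - ln (r0 c))
    - (ln (Num.max r (nc (a - c j))^-1) - ln (Num.max (r0 c) (nc (a - c j))^-1)).
  rewrite /rint RintegralB// -/(rint _ _ _) -/(rint _ _ _).
  by rewrite rint_inv// step_integral.
have BE s : 0 < s -> boundary_mean c (fun w => ln (nc (w - a))) s =
    ln (Num.max s (nc a)) + \sum_(j < M)
      (ln (Num.max s (nc (a - c j))^-1) + ln (nc (a - c j)) - ln s).
  move=> s0; rewrite /boundary_mean (@log_kernel _ 0 s a s0).2 subr0; congr (_ + _).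
  apply: eq_bigr => j _; rewrite (@log_kernel _ (c j) s^-1 a _).2 ?invr_gt0//.
  by rewrite ln_max_inv// nc_sub_gt0.
rewrite !BE// opprD addrACA -sumrB; congr (_ + _).
rewrite -sumrN; apply: eq_bigr => j _; rewrite FE; ring.
Qed.

(** For a zero-free holomorphic function the logarithmic means around the
    outer circle and the punctures are affine in ln t; the slopes are the
    residues of the logarithmic derivative and cancel by Cauchy's theorem. *)
Lemma zero_free_boundary (h : C -> C) (r S : R) : r0 c < r -> r < S ->
  (forall z, nc z < S -> (forall j, S^-1 < nc (z - c j)) -> hol h z) ->
  (forall z, nc z < S -> (forall j, S^-1 < nc (z - c j)) -> h z != 0) ->
  boundary_mean c (fun w => ln (nc (h w))) r =
  boundary_mean c (fun w => ln (nc (h w))) (r0 c).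
Proof.
move=> rr rS dh h0; have [r00 rrho cr] := r0_bounds hM hc.
have r0' : 0 < r by lra.
have S0 : 0 < S by lra.
have Sr : S^-1 < r^-1 by rewrite ltf_pV2.
have rr' : r^-1 < (r0 c)^-1 by rewrite ltf_pV2.
have ri : 0 < r^-1 by rewrite invr_gt0.
have Si : 0 < S^-1 by rewrite invr_gt0.
pose E := (r0 c)^-1; rewrite -/E in rrho cr rr'.
pose phi w := dC h w / h w.
have U_open z : nc z < S -> (forall j, S^-1 < nc (z - c j)) -> hol phi z.
  move=> zS zc.
  have [d d0 Hd] : exists2 d, 0 < d & forall w, nc (w - z) < d ->
      nc w < S /\ forall j, S^-1 < nc (w - c j).
    pose m := \big[Num.min/1]_(j < M) (nc (z - c j) - S^-1).
    have m0 : 0 < m by apply: lt_bigmin => // j _; rewrite subr_gt0.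
    exists (Num.min m (S - nc z)); first by rewrite lt_min m0 subr_gt0.
    move=> w; rewrite lt_min => /andP[wm wS]; split.
      by have := ncD (w - z) z; rewrite subrK; lra.
    move=> j; have mj : m <= nc (z - c j) - S^-1 by apply: bigmin_le_cond.
    by have := ncD (z - w) (w - c j); rewrite addrA subrK (ncB z w); lra.
  apply: holM.
    by apply: hol_dC d0 _ => w /Hd [w1 w2]; exact: dh.
  by apply: holV; [exact: dh|exact: h0].
(* a slightly larger annulus around each puncture *)
pose s2 := Num.min (E + (S - r)) (rho c).
have Es2 : E < s2 by rewrite /s2 lt_min rrho andbT; lra.
have s2rho : s2 <= rho c by rewrite /s2 ge_min lexx orbT.
have s2E : s2 <= E + (S - r) by rewrite /s2 ge_min lexx.
have inner j w : S^-1 < nc (w - c j) < s2 -> nc w < S /\ forall k, S^-1 < nc (w - c k).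
  move=> /andP[w1 w2]; split.
    by have := ncD (w - c j) (c j); rewrite subrK; have := cr j; lra.
  move=> k; have [<-//|jk] := eqVneq j k.
  have := two_rho_le c jk; have := ncD (c j - w) (w - c k).
  by rewrite addrA subrK (ncB (c j)); lra.
have outer w : r0 c <= nc w -> forall j, E < nc (w - c j).
  by move=> w1 j; have := ncD (w - c j) (c j); rewrite subrK; have := cr j; lra.
(* slope at the puncture c j *)
have slope_in j : circle_mean (fun w => ln (nc (h w))) (c j) E
    - circle_mean (fun w => ln (nc (h w))) (c j) r^-1 =
    complex.Re (cmean (dlog h (c j)) (c j) r^-1) * (ln E - ln r^-1).
  apply: (@log_mean_annulus _ h (c j) S^-1 s2) => //; try exact: ltW.
  - by move=> w /inner [w1 w2]; exact: dh.
  - by move=> w /inner [w1 w2]; exact: h0.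
pose sm := \big[Num.max/0]_(j < M) (nc (c j) + E).
have sm0 : 0 <= sm by rewrite /sm; apply: bigmax_ge_id.
have smr : sm < r0 c by apply: bigmax_lt => // i _; exact: cr.
have outer' w : sm < nc (w - 0) < S -> nc w < S /\ forall j, S^-1 < nc (w - c j).
  rewrite subr0 => /andP[w1 w2]; split=> [//|k].
  have : nc (c k) + E <= sm by apply: le_bigmax_cond.
  by have := ncD (w - c k) (c k); rewrite subrK; lra.
have slope_out : circle_mean (fun w => ln (nc (h w))) 0 r
    - circle_mean (fun w => ln (nc (h w))) 0 (r0 c) =
    complex.Re (cmean (dlog h 0) 0 (r0 c)) * (ln r - ln (r0 c)).
  apply: (@log_mean_annulus _ h 0 sm S) => //; try exact: ltW.
  - by move=> w /outer' [w1 w2]; exact: dh.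
  - by move=> w /outer' [w1 w2]; exact: h0.
have residues : cmean (dlog h 0) 0 (r0 c) =
    \sum_(j < M) cmean (dlog h (c j)) (c j) r^-1.
  rewrite -(@cauchy_holes _ M c phi r^-1 E (r0 c) S)//.
  - by apply: eq_cmean => [|w _]; [exact: ltW|rewrite /dlog subr0].
  - lra.
  - by move=> i k z ik zi; apply: (@disks_disjoint _ _ c E i).
  - by move=> z zS zc; apply: U_open => // i; have := zc i; lra.
apply/eqP; rewrite -subr_eq0. rewrite /boundary_mean opprD addrACA -sumrB slope_out residues.
have ReS (I : Type) (l : seq I) (P : I -> C) :
    complex.Re (\sum_(i <- l) P i) = \sum_(i <- l) complex.Re (P i).
  by elim/big_rec2: _ => // i x y _ <-; rewrite ReD.
rewrite ReS; pose k j := complex.Re (cmean (dlog h (c j)) (c j) r^-1).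
rewrite (eq_bigr k)// mulr_suml -big_split /= big1// => j _.
by have := slope_in j; rewrite -/(k j) /E !lnV ?posrE// => e; lra.
Qed.

End BoundaryMeans.

(** * Logarithmic means of functions with zeros *)

Section LogMeanFactor.
Context {R : realType}.
Local Notation C := R[i].
Local Notation nc := (@Normc.normc R).
Local Notation mu := (@lebesgue_measure R).
Implicit Types (g h : C -> C) (a b z w : C) (s t r : R).

Lemma ln_root_prod (l : seq C) (m : C -> nat) z : z \notin l ->
  ln (nc (root_prod l m z)) = \sum_(a <- l) (m a)%:R * ln (nc (z - a)).
Proof.
elim: l => [_|a l IH]; first by rewrite /root_prod !big_nil Normc.normc1 ln1.
rewrite inE negb_or => /andP[za zl].
rewrite /root_prod !big_cons -/(root_prod l m z) ncM lnM ?posrE ?nc_gt0; last 2 first.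
- by rewrite expf_neq0// subr_eq0.
- exact: root_prod_neq0.
by rewrite IH// ncX lnXn ?nc_sub_gt0// mulr_natl.
Qed.

Lemma circle_meanE (u : C -> R) b s :
  circle_mean u b s = (2 * pi)^-1 * rint (fun t => u (circ b s t)) 0 (2 * pi).
Proof. by []. Qed.

(** Off the finitely many parameters at which the circle meets l, the
    integrand is the sum of the logarithms of the factors. *)
Lemma log_mean_root_prod g h (l : seq C) (m : C -> nat) b s : 0 < s ->
  (forall w, nc (w - b) = s -> [/\ ccont h w, h w != 0 & g w = root_prod l m w * h w]) ->
  mu.-integrable `[0, 2 * pi] (EFin \o (fun t => ln (nc (g (circ b s t))))) /\
  circle_mean (fun w => ln (nc (g w))) b s =
    \sum_(a <- l) (m a)%:R * circle_mean (fun w => ln (nc (w - a))) b s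
    + circle_mean (fun w => ln (nc (h w))) b s.
Proof.
move=> s0 H.
have onc t : nc (circ b s t - b) = s by rewrite circ_dist gtr0_norm.
have ch : cont_on (fun t => ln (nc (h (circ b s t)))) 0 (2 * pi).
  apply: cont_on_ln => [t _|].
    by rewrite nc_gt0; have [] := H _ (onc t).
  apply: cont_on_nc; apply: ccont_circ; first exact: ltW.
  by move=> w /H [].
pose F a t := (m a)%:R * ln (nc (circ b s t - a)).
have mD : measurable (`[0, 2 * pi]%classic : set R) by exact: measurable_itv.
have iF a : mu.-integrable `[0, 2 * pi] (EFin \o F a).
  exact: (@integrableZl _ _ R mu _ mD (m a)%:R _ (@log_kernel _ b s a s0).1).
have [iS eS] := rint_sum l iF.
have ih := cont_on_integrable ch.
have iU := @integrableD _ _ _ mu _ mD _ _ iS ih.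
have fN := @circ_hits_finite _ b s l s0.
have [|i e] := @integrable_off_finite _ _ (fun t => ln (nc (g (circ b s t)))) 0 (2 * pi) _ fN iU.
  move=> t ht Nt; have [_ h0 ->] := H _ (onc t).
  have tl : circ b s t \notin l by apply/negP => tl; apply: Nt.
  by rewrite ncM lnM ?posrE ?nc_gt0 ?root_prod_neq0// ln_root_prod.
split=> //; rewrite !circle_meanE e.
rewrite {1}/rint RintegralD// -!/(rint _ _ _) eS mulrDr mulr_sumr; congr (_ + _).
apply: eq_bigr => a _; rewrite circle_meanE mulrCA; congr (_ * _).
by rewrite /rint RintegralZl//; exact: (@log_kernel _ b s a s0).1.
Qed.

(** The logarithm splits off the zeros of g, and the circle meets these
    for finitely many parameters only. *)
Lemma log_mean_quotient g (A : C -> R) d (l : seq C) b s : 0 < s ->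
  mu.-integrable `[0, 2 * pi] (EFin \o (fun t => ln (nc (g (circ b s t))))) ->
  (forall w, nc (w - b) = s -> w \notin l -> g w != 0) ->
  (forall w, nc (w - b) = s -> 0 < A w) ->
  cont_on (fun t => A (circ b s t)) 0 (2 * pi) ->
  circle_mean (fun w => ln (A w ^+ d / nc (g w))) b s =
  d%:R * circle_mean (fun w => ln (A w)) b s - circle_mean (fun w => ln (nc (g w))) b s.
Proof.
move=> s0 ig g0 A0 cA.
have onc t : nc (circ b s t - b) = s by rewrite circ_dist gtr0_norm.
have mD : measurable (`[0, 2 * pi]%classic : set R) by exact: measurable_itv.
have iA : mu.-integrable `[0, 2 * pi] (EFin \o (fun t => ln (A (circ b s t)))).
  apply: cont_on_integrable; apply: cont_on_ln => // t _; exact: A0.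
have idA := @integrableZl _ _ R mu _ mD d%:R _ iA.
have iU := @integrableB _ _ _ mu _ mD _ _ idA ig.
have fN := @circ_hits_finite _ b s l s0.
have [|i e] := @integrable_off_finite _ _
    (fun t => ln (A (circ b s t) ^+ d / nc (g (circ b s t)))) 0 (2 * pi) _ fN iU.
  move=> t ht Nt; have A0t := A0 _ (onc t).
  have gt : g (circ b s t) != 0 by apply: g0 => //; apply/negP => tl; exact: Nt.
  rewrite lnM ?posrE ?exprn_gt0// ?invr_gt0 ?nc_gt0// lnV ?posrE ?nc_gt0// lnXn//.
  by rewrite mulr_natl.
rewrite !circle_meanE e {1}/rint RintegralB// -!/(rint _ _ _) mulrBr; congr (_ - _).
by rewrite mulrCA; congr (_ * _); rewrite /rint RintegralZl.
Qed.

End LogMeanFactor.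

(** * Identity theorem and zeros in the punctured plane *)

Section ZerosInOmega.
Context {R : realType} {M : nat}.
Local Notation C := R[i].
Local Notation nc := (@Normc.normc R).
Variable c : 'I_M -> C.
Implicit Types (a p q z w : C) (s t r S : R).

Lemma Omega_open z : Omega c z -> exists2 d, 0 < d & forall w, nc (w - z) < d -> Omega c w.
Proof.
move=> zc; exists (\big[Num.min/1]_(j < M) nc (z - c j)).
  by apply: lt_bigmin => // j _; rewrite nc_sub_gt0.
move=> w wz j; apply: contraTneq wz => ->; rewrite -leNgt ncB.
exact: bigmin_le_cond.
Qed.

(** Of the broken lines from p to q with a vertex on the perpendicular
    bisector, at most two pass through a given puncture, and there are
    infinitely many vertices. *)
Lemma broken_line p q : Omega c p -> Omega c q -> exists m,
  (forall t, 0 <= t <= 1 -> Omega c (p + t%:C * (m - p))) /\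
  (forall t, 0 <= t <= 1 -> Omega c (m + t%:C * (q - m))).
Proof.
move=> cp cq; have [<-|pq] := eqVneq p q.
  by exists p; split=> t _; rewrite subrr mulr0 addr0.
set v := q - p; have v0 : v != 0 by rewrite subr_eq0 eq_sym.
pose x j := complex.Re ((c j - p) / v); pose y j := complex.Im ((c j - p) / v).
(* tau exceeds the two heights at which a line through p, respectively q, and
   c j meets the bisector, in the coordinate with p at 0 and q at 1 *)
pose tau := 1 + \big[Num.max/0]_(j < M)
  Num.max `|y j / (2 * x j)| `|y j / (2 - 2 * x j)|.
have tauP j : `|y j / (2 * x j)| < tau /\ `|y j / (2 - 2 * x j)| < tau.
  have := @le_bigmax_cond _ R 'I_M 0 j xpredT
    (fun j => Num.max `|y j / (2 * x j)| `|y j / (2 - 2 * x j)|) isT.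
  rewrite ge_max => /andP[h1 h2].
  by split; [apply: le_lt_trans h1 _|apply: le_lt_trans h2 _]; rewrite /tau; lra.
have tau0 (j : 'I_M) : 0 < tau by have [h _] := tauP j; exact: le_lt_trans h.
have xyE j (k : C) : p + k * v = c j -> x j = complex.Re k /\ y j = complex.Im k.
  by rewrite /x /y => <-; rewrite addrAC subrr add0r mulfK.
exists (p + (2^-1 +i* tau) * v); split=> t /andP[t0 t1] j; apply/eqP.
  rewrite addrAC subrr add0r mulrA => e; have [ex ey] := xyE j _ e.
  have [h _] := tauP j; move: h; rewrite ex ey /=.
  have [tz|tnz] := eqVneq t 0.
    by move: e (cp j); rewrite tz mul0r mul0r addr0 => ->; rewrite eqxx.
  have -> : (t * tau + 0 / 2) / (2 * (t / 2 - 0 * tau)) = tau by field.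
  by rewrite gtr0_norm ?(tau0 j)// ltxx.
have -> : p + (2^-1 +i* tau) * v + t%:C * (q - (p + (2^-1 +i* tau) * v)) =
    p + ((2^-1 +i* tau) + t%:C * (1 - (2^-1 +i* tau))) * v.
  by rewrite /v; ring.
move=> e; have [ex ey] := xyE j _ e.
have [_ h] := tauP j; move: h; rewrite ex ey /=.
have [tz|tnz] := eqVneq t 1.
  by move: e (cq j); rewrite tz rmorph1 mul1r [_ + (1 - _)]addrC subrK mul1r addrC subrK => ->; rewrite eqxx.
have tnz' : 1 - t != 0 by rewrite subr_eq0 eq_sym.
have -> : (tau + (t * (0 - tau) + 0 * (1 - 2^-1))) /
   (2 - 2 * (2^-1 + (t * (1 - 2^-1) - 0 * (0 - tau)))) = tau.
  by field; rewrite opprD addrA (_ : 2 - 1 = 1)//; ring.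
by rewrite gtr0_norm ?(tau0 j)// ltxx.
Qed.

Variable g : C -> C.
Hypotheses (dg : forall z, Omega c z -> hol g z)
  (g0 : exists2 z, Omega c z & g z != 0).

(** The identity theorem: vanishing near a would spread along a broken
    line in Omega to every other point. *)
Lemma nonzero_nearby a r : Omega c a -> 0 < r -> exists2 z, nc (z - a) < r & g z != 0.
Proof.
move=> ca r0; have [z0 cz0 gz0] := g0; apply: contrapT => H.
have za : zero_near g a.
  exists r => // w wr; apply/eqP/negPn/negP => gw; apply: H; by exists w.
have [m [h1 h2]] := broken_line ca cz0.
have near_hol z : Omega c z -> exists2 r, 0 < r & forall w, nc (w - z) < r -> hol g w.
  by move=> /Omega_open [d d0 Hd]; exists d => // w /Hd; exact: dg.
have zm : zero_near g m by apply: zero_near_segment za => t /h1 /near_hol.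
have [d d0 /(_ z0)] : zero_near g z0 by apply: zero_near_segment zm => t /h2 /near_hol.
by rewrite subrr Normc.normc0 => /(_ d0) e; rewrite e eqxx in gz0.
Qed.

Lemma zero_multiplicityP a : Omega c a -> has_order g a (zero_multiplicity g a).
Proof.
move=> ca; have [d d0 Hd] := Omega_open ca; apply: xgetPex.
have [|m [h H]] := @order_on_disk _ g a d d0 _ (nonzero_nearby ca d0).
  by move=> w /Hd; exact: dg.
by exists m; apply/has_orderP; exists d => //; exists h.
Qed.

Lemma zeros_in_compact S : 0 < S -> exists l : seq C, [/\ uniq l,
  forall a, a \in l -> Omega c a &
  forall a, nc a <= S -> (forall j, S^-1 <= nc (a - c j)) -> (a \in l) = (g a == 0)].
Proof.
move=> S0; have Si : 0 < S^-1 by rewrite invr_gt0.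
pose K := [set z | nc z <= S /\ forall j, S^-1 <= nc (z - c j)].
have KO z : K z -> Omega c z.
  by move=> [_ h] j; rewrite -nc_sub_gt0; exact: lt_le_trans (h j).
have [z [] //|z|a Ka|l [ul lK Kl]] := @finite_zeros _ g K S.
- move=> /not_andP[/negP|/existsNP[j /negP]]; rewrite -ltNge => h.
    exists (nc z - S) => [|w wz [wS _]]; first by lra.
    by have := ncD (z - w) w; rewrite subrK (ncB z); lra.
  exists (S^-1 - nc (z - c j)) => [|w wz [_ /(_ j)]]; first by lra.
  by have := ncD (w - z) (z - c j); rewrite addrA subrK; lra.
- have ca := KO _ Ka; have [d d0 Hd] := Omega_open ca.
  apply: (@isolated_zero _ g a d d0 _ (nonzero_nearby ca d0)).
  by move=> w /Hd; exact: dg.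
exists l; split=> // [a /lK [/KO //]|a aS ac].
by apply/idP/eqP => [/lK []//|]; exact: Kl.
Qed.

End ZerosInOmega.

(** * Counting zeros *)

Section Counting.
Context {R : realType} {M : nat}.
Local Notation C := R[i].
Local Notation nc := (@Normc.normc R).
Local Notation mu := (@lebesgue_measure R).
Variable c : 'I_M -> C.
Hypotheses (hM : (2 <= M)%N) (hc : injective c).
Implicit Types (a z w : C) (s t r S : R).

Lemma closure_Omega_t t z : closure (Omega_t c t : set C^o) z ->
  nc z <= t /\ forall j, t^-1 <= nc (z - c j).
Proof.
move=> clz.
have H e : 0 < e -> exists2 w, Omega_t c t w & nc (w - z) < e.
  move=> e0; have [|w [tw we]] := clz [set w | nc (w - z) < e].
    by apply/nbhsCP; exists e.
  by exists w.
split=> [|j]; apply/ler_addgt0Pr => e /H [w /Omega_tP [w1 w2] wz].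
  by have := ncD (z - w) w; rewrite subrK (ncB z); lra.
have := ncD (w - z) (z - c j); rewrite addrA subrK.
by have := w2 j; lra.
Qed.

Lemma outer_circle_dist s w k : r0 c <= s -> nc w = s -> s^-1 <= nc (w - c k).
Proof.
move=> rs ws; have [s0 si] := inv_le_r0 hM hc rs; have [_ _ cr] := r0_bounds hM hc.
by have := ncD (w - c k) (c k); rewrite subrK; have := cr k; lra.
Qed.

Lemma inner_circle_dist s w j k : r0 c <= s -> nc (w - c j) = s^-1 ->
  s^-1 <= nc (w - c k).
Proof.
move=> rs ws; have [s0 si] := inv_le_r0 hM hc rs; have [_ rr _] := r0_bounds hM hc.
have [<-|jk] := eqVneq j k; first by rewrite ws.
apply: ltW; apply: (@disks_disjoint _ _ c s^-1 j) => //; first lra.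
by rewrite ws.
Qed.

(** The property shared by the outer circle and the circles around the
    punctures: their points lie in the closed region bounded by them all. *)
Lemma boundary_circle s : r0 c <= s ->
  (0 < s /\ forall w, nc (w - 0) = s -> nc w <= s /\ forall k, s^-1 <= nc (w - c k)) /\
  (forall j, 0 < s^-1 /\ forall w, nc (w - c j) = s^-1 ->
    nc w <= s /\ forall k, s^-1 <= nc (w - c k)).
Proof.
move=> rs; have [s0 si] := inv_le_r0 hM hc rs.
split=> [|j]; split; rewrite ?invr_gt0// => w.
  by rewrite subr0 => ws; split=> [|k]; [rewrite ws|exact: outer_circle_dist].
move=> ws; split=> [|k]; last exact: inner_circle_dist ws.
by apply: ltW; apply: (disk_in_Omega_t hM hc rs (j := j)); rewrite ws.
Qed.

(** The radii at which a point of l lies on the boundary of Omega_t. Only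
    there can the closure contain points of l that Omega_t does not. *)
Lemma critical_radii_finite (l : seq C) : finite_set
  [set t | exists2 a, a \in l & t = nc a \/ exists j, t^-1 = nc (a - c j)].
Proof.
apply: (@sub_finite_set _ _ [set` [seq nc a | a <- l] ++
    [seq (nc (a - c j))^-1 | a <- l, j <- enum 'I_M]]); last exact: finite_seq.
move=> t /= [a al]; rewrite mem_cat => -[->|[j e]]; first by rewrite map_f.
apply/orP; right; apply/allpairsP; exists (a, j) => /=; split=> //.
  by rewrite mem_enum.
by rewrite -e invrK.
Qed.

Section ZerosOfFunction.
Variable g : C -> C.
Hypotheses (dg : forall z, Omega c z -> hol g z)
  (g0 : exists2 z, Omega c z & g z != 0).
Let m := zero_multiplicity g.

Let count t := \big[addn/0%N]_(z \in closure (Omega_t c t : set C^o) `&` [set z | g z = 0])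
  m z.

Section Factor.
Variables (S : R) (l : seq C).
Hypotheses (S0 : 0 < S) (ul : uniq l) (lO : forall a, a \in l -> Omega c a)
  (lP : forall a, nc a <= S -> (forall j, S^-1 <= nc (a - c j)) -> (a \in l) = (g a == 0)).

Lemma count_noncritical t : r0 c <= t -> t <= S ->
  (forall a, a \in l -> t <> nc a /\ forall j, t^-1 <> nc (a - c j)) ->
  (count t)%:R / t = \sum_(a <- l) (m a)%:R * ((`[< Omega_t c t a >])%:R * t^-1).
Proof.
move=> rt tS Nt; have [t0 ti] := inv_le_r0 hM hc rt.
have Sti : S^-1 <= t^-1 by rewrite lef_pV2.
have E : closure (Omega_t c t : set C^o) `&` [set z | g z = 0] =
    [set` [seq a <- l | `[< Omega_t c t a >]]].
  apply/seteqP; split=> z /=; rewrite mem_filter.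
    move=> [/closure_Omega_t [zt zc] gz].
    have zl : z \in l.
      by rewrite lP ?gz ?eqxx// => [|j]; [exact: le_trans zt _|exact: le_trans (zc j)].
    have [zt' zc'] := Nt z zl.
    rewrite zl andbT; apply/asboolP/Omega_tP; split=> [|j].
      by rewrite lt_neqAle zt andbT; apply/eqP => e; exact: zt'.
    by rewrite lt_neqAle zc andbT; apply/eqP; exact: zc'.
  move=> /andP[/asboolP zt zl]; split; first by apply: subset_closure.
  have /Omega_tP [z1 z2] := zt.
  apply/eqP; rewrite -lP// => [|j]; first by lra.
  by apply: le_trans Sti _; exact: ltW.
rewrite /count E -fsbig_seq ?filter_uniq// big_filter natr_sum big_mkcond/= mulr_suml.
apply: eq_bigr => a _; case: ifP => _; first by rewrite mul1r.
by rewrite !mul0r mulr0.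
Qed.

Lemma count_integral r : r0 c <= r -> r <= S ->
  rint (fun t => (count t)%:R / t) (r0 c) r =
  \sum_(a <- l) (m a)%:R * (boundary_mean c (fun w => ln (nc (w - a))) r
                            - boundary_mean c (fun w => ln (nc (w - a))) (r0 c)).
Proof.
move=> rr rS; pose ind a t := (`[< Omega_t c t a >])%:R * t^-1.
have mD : measurable (`[r0 c, r]%classic : set R) by exact: measurable_itv.
pose F a t := if a \in l then (m a)%:R * ind a t else 0.
have kb a (al : a \in l) := @kernel_boundary _ _ c hM hc a r rr (lO al).
have iF a : mu.-integrable `[r0 c, r] (EFin \o F a).
  rewrite /F; case: (boolP (a \in l)) => [al|_].
    exact: (@integrableZl _ _ R mu _ mD (m a)%:R _ (kb a al).1).
  by apply: (@cont_on_integrable _ (fun=> 0)); exact: cst_cont_on.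
have [iS eS] := rint_sum l iF.
have [|_ ->] := integrable_off_finite (critical_radii_finite l) iS
  (v := fun t => (count t)%:R / t).
  move=> t /andP[rt tr] Nt; rewrite count_noncritical//; last 2 first.
  - exact: le_trans rS.
  - move=> a al; split=> [e|j e]; apply: Nt; exists a => //; first by left.
    by right; exists j.
  by rewrite big_seq [RHS]big_seq; apply: eq_bigr => a al; rewrite /F al.
rewrite eS big_seq [RHS]big_seq; apply: eq_bigr => a al.
have [ia ->] := kb a al.
have -> : F a = fun t => (m a)%:R * ind a t by apply/funext => t; rewrite /F al.
by rewrite /rint RintegralZl.
Qed.

End Factor.

(** Only the zeros in a compact part of Omega are divided out, so that h
    is zero-free there and finitely many factors suffice. *)
Lemma factor_Omega S : 0 < S -> exists l h, [/\ uniq l /\ (forall a, a \in l -> Omega c a),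
  forall a, nc a <= S -> (forall j, S^-1 <= nc (a - c j)) -> (a \in l) = (g a == 0),
  forall z, Omega c z -> hol h z,
  forall z, nc z <= S -> (forall j, S^-1 <= nc (z - c j)) -> h z != 0 &
  forall z, Omega c z -> g z = root_prod l m z * h z].
Proof.
move=> S0; have [l [ul lO lP]] := zeros_in_compact dg g0 S0.
have [a al|h [dh h0 gh]] := @factor_zeros _ g (Omega c) l m (@Omega_open _ _ c) dg ul.
  by split; [exact: lO|exact: (zero_multiplicityP dg g0 (lO a al))].
exists l, h; split=> // z zS zc.
have Oz : Omega c z by move=> j; rewrite -nc_sub_gt0; apply: lt_le_trans (zc j); rewrite invr_gt0.
have [zl|zl] := boolP (z \in l); first exact: h0.
have : g z != 0 by rewrite -(lP z zS zc).
by rewrite gh// mulf_eq0 negb_or => /andP[].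
Qed.

End ZerosOfFunction.
End Counting.

(** * The formula of Jensen and the first main theorem *)

Section Jensen.
Context {R : realType} {M : nat}.
Local Notation C := R[i].
Local Notation nc := (@Normc.normc R).
Local Notation mu := (@lebesgue_measure R).
Variable c : 'I_M -> C.
Hypotheses (hM : (2 <= M)%N) (hc : injective c).
Implicit Types (a z w : C) (s t r S : R).

Section Factored.
Variables (g h : C -> C) (l : seq C) (m : C -> nat) (S : R).
Hypotheses (dh : forall z, Omega c z -> hol h z)
  (h0 : forall z, nc z <= S -> (forall j, S^-1 <= nc (z - c j)) -> h z != 0)
  (gh : forall z, Omega c z -> g z = root_prod l m z * h z).

Lemma factored_on_boundary s w : r0 c <= s -> s <= S ->
  nc w <= s /\ (forall k, s^-1 <= nc (w - c k)) ->
  [/\ ccont h w, h w != 0 & g w = root_prod l m w * h w].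
Proof.
move=> rs sS [ws wc]; have [s0 _] := inv_le_r0 hM hc rs.
have Ss : S^-1 <= s^-1 by rewrite lef_pV2 ?posrE//; lra.
have Ow : Omega c w.
  by move=> j; rewrite -nc_sub_gt0; apply: lt_le_trans (wc j); rewrite invr_gt0.
split; [exact: hol_ccont (dh Ow)|apply: h0|exact: gh]; first exact: le_trans sS.
by move=> j; exact: le_trans (wc j).
Qed.

Lemma boundary_mean_factored s : r0 c <= s -> s <= S ->
  boundary_mean c (fun w => ln (nc (g w))) s =
  \sum_(a <- l) (m a)%:R * boundary_mean c (fun w => ln (nc (w - a))) s
  + boundary_mean c (fun w => ln (nc (h w))) s.
Proof.
move=> rs sS; have [[s0 out] inn] := boundary_circle hM hc rs.
have F w := @factored_on_boundary s w rs sS.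
rewrite /boundary_mean (@log_mean_root_prod _ g h l m 0 s s0 _).2; last first.
  by move=> w /out /F.
rewrite (eq_bigr (fun j => \sum_(a <- l) (m a)%:R *
    circle_mean (fun w => ln (nc (w - a))) (c j) s^-1
    + circle_mean (fun w => ln (nc (h w))) (c j) s^-1)); last first.
  move=> j _; have [si inj] := inn j.
  by rewrite (@log_mean_root_prod _ g h l m (c j) s^-1 si _).2// => w /inj /F.
rewrite big_split /= addrACA exchange_big /= -big_split /=; congr (_ + _).
by apply: eq_bigr => a _; rewrite mulrDr mulr_sumr.
Qed.

Lemma boundary_mean_quotient (A : C -> R) d s : r0 c <= s -> s <= S ->
  (forall z, Omega c z -> 0 < A z) ->
  (forall b t, 0 < t -> (forall w, nc (w - b) = t -> Omega c w) ->
     cont_on (fun x => A (circ b t x)) 0 (2 * pi)) ->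
  boundary_mean c (fun w => ln (A w ^+ d / nc (g w))) s =
  d%:R * boundary_mean c (fun w => ln (A w)) s
  - boundary_mean c (fun w => ln (nc (g w))) s.
Proof.
move=> rs sS A0 cA; have [[s0 out] inn] := boundary_circle hM hc rs.
have F w := @factored_on_boundary s w rs sS.
have circle b t : 0 < t ->
    (forall w, nc (w - b) = t -> nc w <= s /\ forall k, s^-1 <= nc (w - c k)) ->
    circle_mean (fun w => ln (A w ^+ d / nc (g w))) b t =
    d%:R * circle_mean (fun w => ln (A w)) b t
    - circle_mean (fun w => ln (nc (g w))) b t.
  move=> t0 on.
  have Ob w : nc (w - b) = t -> Omega c w.
    move=> /on [_ wc] j; rewrite -nc_sub_gt0; apply: lt_le_trans (wc j).
    by rewrite invr_gt0.
  apply: (@log_mean_quotient _ g A d l b t t0).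
  - by apply: (@log_mean_root_prod _ g h l m b t t0 _).1 => w /on /F.
  - by move=> w /on /F [_ hw ->] wl; rewrite mulf_neq0// root_prod_neq0.
  - by move=> w /Ob; exact: A0.
  - exact: cA.
rewrite /boundary_mean circle// mulrDr opprD addrACA; congr (_ + _).
rewrite mulr_sumr -sumrB; apply: eq_bigr => j _.
by have [si inj] := inn j; exact: circle.
Qed.

End Factored.

(** Both sides are additive over the factors of g: each linear factor
    contributes according to kernel_boundary, the zero-free one nothing by
    zero_free_boundary. *)
Lemma jensen (g : C -> C) r : (forall z, Omega c z -> hol g z) ->
  (exists2 z, Omega c z & g z != 0) -> r0 c < r ->
  boundary_mean c (fun w => ln (nc (g w))) r
  - boundary_mean c (fun w => ln (nc (g w))) (r0 c) =
  rint (fun t => (\big[addn/0%N]_(z \in closure (Omega_t c t : set C^o) `&`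
    [set z | g z = 0]) zero_multiplicity g z)%:R / t) (r0 c) r.
Proof.
move=> dg g0 rr; have [r00 _ _] := r0_bounds hM hc.
(* zeros are divided out a little beyond Omega_r, since zero_free_boundary asks
   for a neighbourhood of the boundary circles *)
have S0 : 0 < r + 1 by lra.
have [l [h [[ul lO] lP dh h0 gh]]] := factor_Omega dg g0 S0.
rewrite (@count_integral _ _ c hM hc g (r + 1) l)//; [|lra|lra].
rewrite !(boundary_mean_factored dh h0 gh); try lra.
rewrite (@zero_free_boundary _ _ c hM hc h r (r + 1))//; last first.
- by move=> z z1 zc; apply: h0 => [|j]; exact: ltW.
- move=> z z1 zc; apply: dh => j; rewrite -nc_sub_gt0; apply: lt_trans (zc j).
  by rewrite invr_gt0.
- lra.
by rewrite opprD addrACA subrr addr0 -sumrB; apply: eq_bigr => a _; rewrite mulrBr.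
Qed.

End Jensen.

Section MaxNorm.
Context {R : realType} {n : nat}.
Local Notation C := R[i].
Local Notation nc := (@Normc.normc R).

Lemma max_norm_gt0 (x : 'I_n.+1 -> C) i : x i != 0 -> 0 < max_norm x.
Proof.
rewrite -nc_gt0 => /lt_le_trans; apply.
exact: (@le_bigmax_cond _ R 'I_n.+1 0 i xpredT (fun i => nc (x i))).
Qed.

Lemma cont_on_max_norm (x : R -> 'I_n.+1 -> C) (a b : R) :
  (forall i, ccont_on (fun t => x t i) a b) -> cont_on (fun t => max_norm (x t)) a b.
Proof.
move=> cx; rewrite /max_norm; elim: (index_enum _) => [|i l IH].
  have -> : (fun t => \big[Num.max/0]_(i <- [::]) nc (x t i)) = (fun=> 0).
    by apply/funext => t; rewrite big_nil.
  exact: cst_cont_on.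
have -> : (fun t => \big[Num.max/0]_(i <- i :: l) nc (x t i)) =
    (fun t => nc (x t i)) \max (fun t => \big[Num.max/0]_(i <- l) nc (x t i)).
  by apply/funext => t; rewrite big_cons.
by move=> t ht; apply: continuous_max; [exact: cont_on_nc ht|exact: IH].
Qed.

Lemma hol_meval (f : C -> 'I_n.+1 -> C) (Q : mpoly n.+1 C) z :
  (forall i, hol (fun w => f w i) z) -> hol (fun w => meval (f w) Q) z.
Proof.
move=> df.
have -> : (fun w => meval (f w) Q) = (fun w => \sum_(k <- msupp Q)
    mcoeff k Q * \prod_i f w i ^+ fun_of_multinom k i).
  by apply/funext => w; rewrite mevalE.
apply: hol_sum => k; apply: holM; first exact: hol_cst.
by apply: hol_prod => i; exact: holX.
Qed.

End MaxNorm.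

Theorem theorem1 (R : realType) (M : nat) (hM : (2 <= M)%N)
    (c : 'I_M -> R[i]) (hc : injective c)
    (n d : nat) (hd : (0 < d)%N)
    (Q : mpoly n.+1 R[i]) (hQ0 : Q != 0)
    (hQ : Q \is ishomog1 d mdeg)
    (f : R[i] -> 'I_n.+1 -> R[i])
    (hf : reduced_representation (Omega c) f)
    (hfD : ~ (f @` Omega c `<=` hypersurface Q)) :
  exists K : R, forall r : R, r0 c < r ->
    `| d%:R * characteristic_function c f r
       - (proximity_function c f Q d r + counting_function c f Q r) |
      <= K.
Proof.
pose g z := meval (f z) Q.
have df z i : Omega c z -> hol (fun w => f w i) z.
  by rewrite holE; exact: hf.1.
have dg z : Omega c z -> hol g z by move=> Oz; exact: (hol_meval Q (fun i => df z i Oz)).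
have g0 : exists2 z, Omega c z & g z != 0.
  apply: contrapT => H; apply: hfD => _ [z Oz <-].
  by apply: contrapT => /eqP gz; apply: H; exists z.
exists `|boundary_mean c (fun w => ln (Normc.normc (g w))) (r0 c)| => r rr.
have [r00 _ _] := r0_bounds hM hc; have r0' : 0 < r by lra.
have [l [h [_ _ dh h0 gh]]] := factor_Omega dg g0 r0'.
rewrite /proximity_function (@boundary_mean_quotient _ _ c hM hc g h l _ r dh h0 gh
  (fun z => max_norm (f z)) d)//; first last.
- move=> b t t0 Ob; apply: cont_on_max_norm => i; apply: (@ccont_circ _ (fun w => f w i) b t); first exact: ltW.
  by move=> w /Ob Ow; apply: hol_ccont; exact: df.
- by move=> z Oz; have [i fi] := hf.2 z Oz; exact: max_norm_gt0 fi.
- exact: ltW.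
have -> : counting_function c f Q r = boundary_mean c (fun w => ln (Normc.normc (g w))) r
    - boundary_mean c (fun w => ln (Normc.normc (g w))) (r0 c).
  by rewrite (jensen hM hc dg g0 rr).
(* what remains is the boundary mean of ln |Q(f)| at radius r0 *)
rewrite /characteristic_function; set X := _ * _; set Y := boundary_mean _ _ r.
set Z := boundary_mean _ _ _.
by have -> : X - (X - Y + (Y - Z)) = Z by ring.
Qed.
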